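(* Let $h \in \mathbb{R}^n$ and let $J \neq 0$ be a real symmetric positive semidefinite $n\times n$ matrix with constant diagonal, $J_{ii} = \alpha \ge 0$ for all $i$. Let $\nu$ be the Ising model on $\{\pm 1\}^n$ given by $$\nu(x) \propto \exp\left(\tfrac12 \langle x, Jx\rangle + \langle h, x\rangle\right).$$ Let $\eta = \alpha/\|J\|_{\mathrm{op}} \in [0,1]$. Then $$\|\operatorname{cov}(\nu)\|_{\mathrm{op}} \le q_\eta(\|J\|_{\mathrm{op}}),$$ where $q_\eta : \mathbb{R}_{\ge 0} \to \mathbb{R}_{\ge 0}\cup\{\infty\}$ solves the Volterra integral equation $$q_\eta(z) = r(\eta z) + \int_0^z q_\eta(y)^2\, dy$$ with $$r(t) = \mathbb{E}\left[1 - \tanh^2\left(t x + \sqrt{t}\, g\right)\right] \le 1,$$ where $x$ is uniform on $\{\pm 1\}$ and $g \sim \mathcal{N}(0,1)$ is independent of $x$. Furthermore, $\nu$ satisfies approximate tensorization of entropy with constant at most $$\exp\left(\int_0^{\|J\|_{\mathrm{op}}} q_\eta(z)\, dz\right).$$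
   Context: $\|\cdot\|_{\mathrm{op}}$ is the Euclidean operator norm and $\operatorname{cov}(\nu) = \mathbb{E}_{\nu}[xx^\top] - \mathbb{E}_\nu[x]\mathbb{E}_\nu[x]^\top$. The integral equation has a unique solution up to a possible blow-up time $T\in(0,\infty]$; if $T<\infty$ the solution tends to $\infty$ as $z \to T$, and one sets $q_\eta(z)=\infty$ for $z\ge T$. For a probability measure $\mu$ and a nonnegative function $f$, $\operatorname{Ent}_\mu[f] = \mathbb{E}_\mu[f\log f] - \mathbb{E}_\mu[f]\log \mathbb{E}_\mu[f]$. A probability measure $\mu$ on a product space $\Omega_1\times\cdots\times\Omega_n$ satisfies approximate tensorization of entropy (ATE) with constant $C$ if for all nonnegative functions $f$, $$\operatorname{Ent}_\mu[f] \le C\sum_{i=1}^n \mathbb{E}_{x\sim\mu}\left[\operatorname{Ent}_{\mu(\cdot\mid X_{\sim i}=x_{\sim i})}[f]\right],$$ where $x_{\sim i}$ denotes $x$ with its $i$th coordinate removed. *)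

(* Defs.v *)
From HB Require Import structures.
From mathcomp Require Import all_boot all_order all_algebra.
From mathcomp Require Import all_classical all_reals all_analysis measurable_realfun.

Set Implicit Arguments.
Unset Strict Implicit.
Unset Printing Implicit Defensive.

Import Order.TTheory GRing.Theory Num.Theory.
Import numFieldNormedType.Exports.

Local Open Scope classical_set_scope.
Local Open Scope ring_scope.

Definition dotv (R : realType) (n : nat) (u v : 'cV[R]_n) : R :=
  \sum_(i < n) u i 0 * v i 0.

Definition l2norm (R : realType) (n : nat) (u : 'cV[R]_n) : R :=
  Num.sqrt (dotv u u).

(* The library norm on matrices is the entrywise maximum, whence this one. *)
Definition opnorm (R : realType) (n : nat) (A : 'M[R]_n) : R :=
  sup [set l2norm (A *m u) | u in [set u : 'cV[R]_n | l2norm u <= 1]].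

Definition symmetric_psd (R : realType) (n : nat) (A : 'M[R]_n) : Prop :=
  A^T = A /\ forall u : 'cV[R]_n, 0 <= dotv u (A *m u).

(* Measures on finite spaces are given by their mass functions. *)

Definition mean (R : realType) (T : finType) (mu f : T -> R) : R :=
  \sum_(x : T) mu x * f x.

(* [ln 0 = 0] in the library, so [f * ln f] vanishes where [f] does. *)
Definition Ent (R : realType) (T : finType) (mu f : T -> R) : R :=
  mean mu (fun x => f x * ln (f x)) - mean mu f * ln (mean mu f).

Definition agree_off (n : nat) (S : finType) (i : 'I_n)
    (x y : {ffun 'I_n -> S}) : bool :=
  [forall j : 'I_n, (j != i) ==> (x j == y j)].

(* The law of [X] given that [X] agrees with [x] off the [i]th coordinate. *)
Definition cond_law (R : realType) (n : nat) (S : finType)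
    (mu : {ffun 'I_n -> S} -> R) (i : 'I_n) (x : {ffun 'I_n -> S}) :
    {ffun 'I_n -> S} -> R :=
  fun y => if agree_off i x y then
             mu y / \sum_(z : {ffun 'I_n -> S} | agree_off i x z) mu z
           else 0.

(* The constant may be [+oo], with the convention [+oo * 0 = 0]. *)
Definition approx_tensorization (R : realType) (n : nat) (S : finType)
    (mu : {ffun 'I_n -> S} -> R) (C : \bar R) : Prop :=
  forall f : {ffun 'I_n -> S} -> R, (forall x, 0 <= f x) ->
  ((Ent mu f)%:E <=
     C * (\sum_(i < n) mean mu (fun x => Ent (cond_law mu i x) f))%:E)%E.

Definition spin (R : realType) (b : bool) : R := if b then 1 else -1.

Definition spinv (R : realType) (n : nat) (s : {ffun 'I_n -> bool}) : 'cV[R]_n :=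
  \col_(i < n) spin R (s i).

Definition ising_weight (R : realType) (n : nat) (J : 'M[R]_n) (h : 'cV[R]_n)
    (s : {ffun 'I_n -> bool}) : R :=
  expR (2^-1 * dotv (spinv R s) (J *m spinv R s) + dotv h (spinv R s)).

Definition ising (R : realType) (n : nat) (J : 'M[R]_n) (h : 'cV[R]_n)
    (s : {ffun 'I_n -> bool}) : R :=
  ising_weight J h s / \sum_(s' : {ffun 'I_n -> bool}) ising_weight J h s'.

Definition mean_mx (R : realType) (n p q : nat)
    (mu : {ffun 'I_n -> bool} -> R) (F : 'cV[R]_n -> 'M[R]_(p, q)) :
    'M[R]_(p, q) :=
  \sum_(s : {ffun 'I_n -> bool}) mu s *: F (spinv R s).

Definition cov (R : realType) (n : nat) (mu : {ffun 'I_n -> bool} -> R) :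
    'M[R]_n :=
  mean_mx mu (fun x => x *m x^T) - mean_mx mu id *m (mean_mx mu id)^T.

Definition tanh (R : realType) (x : R) : R :=
  (expR x - expR (- x)) / (expR x + expR (- x)).

(* Under the product measure, [spin R w.1] is uniform on [{1, -1}] and [w.2] is
   an independent standard Gaussian. *)
Definition rfun (R : realType) (t : R) : R :=
  \int[(bernoulli_prob (2^-1 : R) \x normal_prob (0 : R) 1)%E]_w
    (1 - tanh (t * spin R w.1 + Num.sqrt t * w.2) ^+ 2).

(* [q] is the maximal solution, with blow-up time [T], extended by [+oo];
   the values of [q] at negative arguments are irrelevant. *)
Definition volterra_solution (R : realType) (eta : R) (q : R -> \bar R) : Prop :=
  measurable_fun (`[0, +oo[%classic : set R) q /\
  exists T : \bar R,
  [/\ (0 < T)%E,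
      forall z : R, 0 <= z -> (z%:E < T)%E -> (0 <= q z < +oo)%E,
      forall z : R, 0 <= z -> (z%:E < T)%E ->
        q z = ((rfun (eta * z))%:E +
               \int[lebesgue_measure]_(y in `[0%R, z]) (q y ^+ 2))%E,
      forall t : R, T = t%:E -> q z @[z --> t^'-] --> +oo%E
    & forall z : R, (T <= z%:E)%E -> q z = +oo%E].

(* Main.v *)
Require Import Defs.
From HB Require Import structures.
From mathcomp Require Import all_boot all_order all_algebra.
From mathcomp Require Import all_classical all_reals all_analysis measurable_realfun.
From mathcomp Require Import ring lra.

(** Write [J = lam * J'] with [lam] the operator norm of [J], factor [J'] as a sum
    of squares of rows [b k] ([psd_factor]), and let the interaction strength be a
    time [z] running from [0] to [lam].  Every sum over configurations
    [wsum b c z h], with weights [expR (z / 2 * quad b x + lin h x)], solves the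
    heat equation in the external field [h] whose diffusion has covariance [J']
    ([heat_wsum]).  Stochastic localization says that a quantity averaged over the
    random field that replaces the interaction is a solution of this equation;
    here the stochastic process is replaced by a maximum principle for the
    equation ([heat_max_principle], [gibbs_max_principle]), and a quantity built
    from the measure at time [z] is controlled by the sign of its heat defect.

    A perspective [D * phi (C / D)] of two solutions has a defect given by the
    curvature of [phi] ([heat_persp]).  For a square this says that the variance of
    [lin v] grows at the rate of the sum of its squared covariances with the
    [b k], which is at most the square of a bound on the covariance matrix.  What
    would remain without this growth is the final part, the sum over [i] of
    [v 0 i ^+ 2] times the expected variance of the spin [i] once the interaction
    has become a random field.  It is an explicit solution of the heat equation
    ([heat_cavity]), a Gaussian average of [sech], and it is largest in a zero
    field ([sech_mean_le]), where its value is [rfun (eta * z)]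
    ([cavity_sum_le], [rfun_psi]).  So the largest variance is a subsolution of the
    Volterra equation, and a Gronwall iteration bounds it by [q] ([cova_le]).

    For [phi t = t * ln t], the entropy of a function grows at the rate of the
    squared displacement of the mean that the function induces.  By entropic
    stability this is at most the covariance bound times the entropy
    ([entropic_stability]), so the entropy grows at the rate [q] at most.  The sum
    of the local entropies can only grow ([heat_local_part]), and at [z = 0] the
    measure is a product, for which entropy tensorizes with constant 1
    ([entropy_tensorize0]).  The maximum principle compares the two at the time
    [lam] ([entropy_flow]).

    The function [q] may be infinite.  Since no covariance matrix has norm above [n], it can be
    replaced by its minimum with [n], which is finite and continuous and still
    satisfies the inequality used above ([volterra_truncate]). *)

Set Implicit Arguments.
Unset Strict Implicit.
Unset Printing Implicit Defensive.
Import Order.TTheory GRing.Theory Num.Theory.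
Import numFieldNormedType.Exports.
Local Open Scope classical_set_scope.
Local Open Scope ring_scope.


(** * Pointwise calculus of one real variable *)
Section calculus.
(* The functions below are in applied form, so that a derivative can be built as
   one term and its value compared with the expected one by [ring] or [field]. *)
Variable R : realType.
Implicit Types (f g : R -> R) (x a b : R).

Lemma der_eq f x a b : is_derive x 1 f a -> a = b -> is_derive x 1 f b.
Proof. by move=> + <-. Qed.

Lemma der_ext f g x a : f =1 g -> is_derive x 1 f a -> is_derive x 1 g a.
Proof. by move=> /funext ->. Qed.

Lemma der_cst c x : is_derive x 1 (fun=> c : R) 0.
Proof. exact: is_derive_cst. Qed.

Lemma der_id x : is_derive x 1 (fun y : R => y) 1.
Proof. exact: is_derive_id. Qed.

Lemma derD f g x a b : is_derive x 1 f a -> is_derive x 1 g b ->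
  is_derive x 1 (fun y => f y + g y) (a + b).
Proof. by move=> hf hg; exact: (is_deriveD hf hg). Qed.

Lemma derN f x a : is_derive x 1 f a -> is_derive x 1 (fun y => - f y) (- a).
Proof. by move=> hf; exact: (is_deriveN hf). Qed.

Lemma derB f g x a b : is_derive x 1 f a -> is_derive x 1 g b ->
  is_derive x 1 (fun y => f y - g y) (a - b).
Proof. by move=> hf hg; exact: (is_deriveB hf hg). Qed.

Lemma derM f g x a b : is_derive x 1 f a -> is_derive x 1 g b ->
  is_derive x 1 (fun y => f y * g y) (a * g x + f x * b).
Proof.
move=> hf hg; apply: der_eq (is_deriveM hf hg) _.
by rewrite /GRing.scale/= addrC (mulrC (g x)).
Qed.

Lemma derMl c f x a : is_derive x 1 f a -> is_derive x 1 (fun y => c * f y) (c * a).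
Proof.
by move=> hf; apply: der_eq (derM (der_cst c x) hf) _; rewrite mul0r add0r.
Qed.

Lemma derV f x a : is_derive x 1 f a -> f x != 0 ->
  is_derive x 1 (fun y => (f y)^-1) (- a / f x ^+ 2).
Proof.
move=> hf f0; apply: der_eq (is_deriveV f0 hf) _.
by rewrite /GRing.scale/= mulrC mulrN mulNr.
Qed.

Lemma der_comp f g x a b : is_derive (g x) 1 f a -> is_derive x 1 g b ->
  is_derive x 1 (fun y => f (g y)) (a * b).
Proof. by move=> hf hg; exact: (is_derive1_comp hf hg). Qed.

Lemma der_exp f x a : is_derive x 1 f a ->
  is_derive x 1 (fun y => expR (f y)) (expR (f x) * a).
Proof. by move=> hf; apply: der_comp hf; exact: is_derive_expR. Qed.

Lemma der_ln f x a : is_derive x 1 f a -> 0 < f x ->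
  is_derive x 1 (fun y => ln (f y)) (a / f x).
Proof.
move=> hf f0; apply: der_eq (der_comp (is_derive1_ln f0) hf) _.
by rewrite mulrC.
Qed.

Lemma der_bigsum (I : Type) (s : seq I) (f : I -> R -> R) (a : I -> R) x :
  (forall i, is_derive x 1 (f i) (a i)) ->
  is_derive x 1 (fun y => \sum_(i <- s) f i y) (\sum_(i <- s) a i).
Proof.
move=> h; elim: s => [|i s ih].
  by rewrite big_nil; apply: der_ext (der_cst 0 x) => y; rewrite big_nil.
by rewrite big_cons; apply: der_ext (derD (h i) ih) => y; rewrite big_cons.
Qed.

Lemma der_sum (I : finType) (f : I -> R -> R) (a : I -> R) x :
  (forall i, is_derive x 1 (f i) (a i)) ->
  is_derive x 1 (fun y => \sum_i f i y) (\sum_i a i).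
Proof. exact: der_bigsum. Qed.

Lemma der_continuous f x a : is_derive x 1 f a -> {for x, continuous f}.
Proof.
by move=> [h _]; apply/differentiable_continuous/derivable1_diffP.
Qed.

End calculus.

(** * Hyperbolic functions *)
Section hyperbolic.
Variable R : realType.
Implicit Types x b u : R.

Definition cosh x : R := (expR x + expR (- x)) / 2.

Definition sinh x : R := (expR x - expR (- x)) / 2.

Lemma cosh_sqr x : cosh x ^+ 2 = 1 + sinh x ^+ 2.
Proof.
rewrite /cosh /sinh expRN; have := lt0r_neq0 (expR_gt0 x).
by move: (expR x) => e e0; field.
Qed.

Lemma cosh_gt0 x : 0 < cosh x.
Proof. by rewrite divr_gt0// addr_gt0// expR_gt0. Qed.

Lemma cosh_neq0 x : cosh x != 0.
Proof. exact: lt0r_neq0 (cosh_gt0 x). Qed.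

Lemma cosh_ge1 x : 1 <= cosh x.
Proof.
rewrite -(@ler_pXn2r _ 2)// ?nnegrE ?ler01 ?(ltW (cosh_gt0 _))//.
by rewrite expr1n cosh_sqr lerDl sqr_ge0.
Qed.

Lemma tanhE x : tanh x = sinh x / cosh x.
Proof.
have := cosh_neq0 x; rewrite /tanh /sinh /cosh => h; field.
by move: h; rewrite mulf_eq0 negb_or => /andP[].
Qed.

Lemma one_minus_tanh2 x : 1 - tanh x ^+ 2 = (cosh x)^-2.
Proof.
have h := cosh_neq0 x; have := cosh_sqr x; rewrite tanhE => e.
by rewrite expr_div_n -[1 in LHS](@divff _ (cosh x ^+ 2)) ?sqrf_eq0// -mulrBl e addrK mul1r.
Qed.

Lemma der_expN x : is_derive x 1 (fun y : R => expR (- y)) (- expR (- x)).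
Proof. by apply: der_eq (der_exp (derN (der_id x))) _; rewrite mulrN1. Qed.

Lemma der_cosh x : is_derive x 1 cosh (sinh x).
Proof.
rewrite /cosh; apply: der_eq (derM (derD (is_derive_expR x) (der_expN x)) (der_cst 2^-1 x)) _.
by rewrite mulr0 addr0.
Qed.

Lemma der_sinh x : is_derive x 1 sinh (cosh x).
Proof.
rewrite /sinh; apply: der_eq (derM (derB (is_derive_expR x) (der_expN x)) (der_cst 2^-1 x)) _.
by rewrite mulr0 addr0 opprK.
Qed.

Definition sech x : R := (cosh x)^-1.

Definition dsech x : R := - sinh x / cosh x ^+ 2.

(** Eliminating [sinh] from the second derivative of [sech] leaves a polynomial
    in [sech], which is visibly bounded. *)
Definition ddsech x : R := sech x - 2 * sech x ^+ 3.

Lemma der_sech x : is_derive x 1 sech (dsech x).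
Proof. exact: derV (der_cosh x) (cosh_neq0 x). Qed.

Lemma der_dsech x : is_derive x 1 dsech (ddsech x).
Proof.
have h := cosh_neq0 x.
have h2 : cosh x * cosh x != 0 by rewrite mulf_neq0.
apply: (@der_ext _ (fun y => - sinh y * (cosh y * cosh y)^-1)).
  by move=> y; rewrite /dsech expr2.
apply: der_eq (derM (derN (der_sinh x)) (derV (derM (der_cosh x) (der_cosh x)) h2)) _.
rewrite /ddsech /sech.
have e : sinh x * sinh x = cosh x ^+ 2 - 1 by rewrite cosh_sqr expr2; ring.
transitivity (- (cosh x)^-1 + 2 * (sinh x * sinh x) / cosh x ^+ 3).
  by field.
by rewrite e; field.
Qed.

Lemma sech_gt0 x : 0 < sech x.
Proof. by rewrite invr_gt0 cosh_gt0. Qed.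

Lemma sech_le1 x : sech x <= 1.
Proof. by rewrite invf_le1 ?cosh_gt0 ?cosh_ge1. Qed.

Lemma dsech_bound x : `|dsech x| <= 1.
Proof.
rewrite -[_ <= _](@ler_pXn2r _ 2) ?nnegrE// real_normK ?num_real// expr1n.
have -> : dsech x ^+ 2 = sech x ^+ 2 * (1 - sech x ^+ 2).
  rewrite /dsech /sech; have h := cosh_neq0 x; have := cosh_sqr x.
  move: (sinh x) (cosh x) h => s c h e.
  have -> : (- s / c ^+ 2) ^+ 2 = s ^+ 2 / c ^+ 4 by field.
  have -> : s ^+ 2 = c ^+ 2 - 1 by rewrite e; ring.
  by field.
have := sech_le1 x; have := sech_gt0 x; move: (sech x) => s; nra.
Qed.

Lemma ddsech_bound x : `|ddsech x| <= 1.
Proof.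
rewrite /ddsech; have := sech_le1 x; have := sech_gt0 x; move: (sech x) => s s0 s1.
by rewrite ler_norml; apply/andP; split; nra.
Qed.

(** Here is why the zero field is extremal.  By the addition formulas the mean
    equals [cosh b * cosh u / (cosh b ^+ 2 + cosh u ^+ 2 - 1)], and the
    denominator is at least [cosh u ^+ 2]. *)
Lemma sech_mean_le b u : (sech (b + u) + sech (b - u)) / 2 <= cosh b * sech u.
Proof.
have sum : cosh (b + u) + cosh (b - u) = 2 * cosh b * cosh u.
  by rewrite /cosh !opprD !opprK !expRD; field.
have prod : cosh (b + u) * cosh (b - u) = cosh b ^+ 2 + cosh u ^+ 2 - 1.
  rewrite /cosh !opprD !opprK !expRD.
  have := expRxMexpNx_1 b; have := expRxMexpNx_1 u.
  move: (expR b) (expR (- b)) (expR u) (expR (- u)) => p q r s rs pq.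
  suff : 4 * ((p * r + q * s) / 2 * ((p * s + q * r) / 2)) =
         4 * (((p + q) / 2) ^+ 2 + ((r + s) / 2) ^+ 2 - 1) by lra.
  have -> : 4 * ((p * r + q * s) / 2 * ((p * s + q * r) / 2)) =
    (r * s) * (p ^+ 2 + q ^+ 2) + (p * q) * (r ^+ 2 + s ^+ 2) by field.
  have -> : 4 * (((p + q) / 2) ^+ 2 + ((r + s) / 2) ^+ 2 - 1) =
    p ^+ 2 + q ^+ 2 + 2 * (p * q) + (r ^+ 2 + s ^+ 2 + 2 * (r * s)) - 4 by field.
  by rewrite rs pq; ring.
have -> : (sech (b + u) + sech (b - u)) / 2 =
    cosh b * cosh u / (cosh b ^+ 2 + cosh u ^+ 2 - 1).
  rewrite -prod /sech.
  transitivity ((cosh (b + u) + cosh (b - u)) / 2 / (cosh (b + u) * cosh (b - u))).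
    by field; rewrite !cosh_neq0.
  by rewrite sum; congr (_ / _); field.
rewrite -mulrA ler_pM2l ?cosh_gt0// /sech.
have := cosh_ge1 b; have := cosh_ge1 u; move: (cosh b) (cosh u) => p r r1 p1.
rewrite ler_pdivrMr; last by nra.
by rewrite mulrC ler_pdivlMr; nra.
Qed.

End hyperbolic.

(** * Gaussian integrals *)
Section gaussian.
Variable R : realType.
Implicit Types (x b c d s M : R) (f : R -> R).

Local Notation gauss := (normal_prob (0 : R) 1).
Local Notation leb := (@lebesgue_measure R).

Lemma ge0_integral_normal (f : R -> \bar R) :
  measurable_fun [set: R] f -> (forall x, 0 <= f x)%E ->
  (\int[gauss]_x f x = \int[leb]_x (f x * (normal_pdf 0 1 x)%:E))%E.
Proof.
move=> mf f0.
have dom := normal_prob_dominates (0 : R) 1.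
rewrite -(Radon_Nikodym_SigmaFinite.change_of_variables dom f0 measurableT mf).
apply: ae_eq_integral => //.
- apply: emeasurable_funM => //.
  exact: measurable_int (Radon_Nikodym_SigmaFinite.f_integrable dom).
- apply: emeasurable_funM => //; apply/measurable_EFinP.
  exact: measurable_normal_pdf.
- apply: ae_eqe_mul2l; apply: integral_ae_eq => //.
  + exact: Radon_Nikodym_SigmaFinite.f_integrable.
  + apply/measurable_EFinP; exact: measurable_normal_pdf.
  + move=> E _ mE.
    by rewrite -(Radon_Nikodym_SigmaFinite.f_integral dom mE).
Qed.

Lemma normal_pdf_shift c x : normal_pdf 0 1 (x - c) =
  expR (c * x - c ^+ 2 / 2) * normal_pdf 0 1 x.
Proof.
rewrite !normal_pdfE ?oner_eq0// mulrCA; congr (_ * _).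
rewrite /normal_fun -expRD; congr expR.
by rewrite !subr0 expr1n -[1 *+ 2]/2; field.
Qed.

(** The Cameron--Martin formula: translating the variable multiplies the
    Gaussian density by an exponential. *)
Lemma ge0_integral_normal_shift f c : continuous f -> (forall x, 0 <= f x) ->
  (\int[gauss]_x (f (x + c))%:E =
   \int[gauss]_x (f x * expR (c * x - c ^+ 2 / 2))%:E)%E.
Proof.
move=> cf f0.
have cshift a : continuous (fun x : R => x + a).
  by move=> x; apply: cvgD; [exact: cvg_id|exact: cvg_cst].
have cfs : continuous (fun x => f (x + c)).
  by move=> x; apply: continuous_comp; [exact: cshift|exact: cf].
have ce : continuous (fun x => expR (c * x - c ^+ 2 / 2)).
  move=> x; apply: continuous_comp; last exact: continuous_expR.
  apply: cvgB; last exact: cvg_cst.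
  by apply: cvgM; [exact: cvg_cst|exact: cvg_id].
rewrite ge0_integral_normal; first last.
- by move=> x; rewrite lee_fin.
- by apply/measurable_EFinP; exact: continuous_measurable_fun.
rewrite ge0_integral_normal; first last.
- by move=> x; rewrite lee_fin mulr_ge0// expR_ge0.
- apply/measurable_EFinP/measurable_funM; exact: continuous_measurable_fun.
pose F x := x + c.
have dF x : is_derive x 1 F 1.
  by apply: der_eq (derD (der_id x) (der_cst c x)) _; rewrite addr0.
have F'E : F^`()%classic = cst 1.
  by apply/funext => x; rewrite derive1E; case: (dF x).
pose G x := f x * normal_pdf 0 1 (x - c).
transitivity (\int[leb]_x (((G \o F) * F^`()%classic) x)%:E)%E.
  apply: eq_integral => x _; rewrite F'E -EFinM; congr EFin.
  by rewrite /G/= fctE/= mulr1 /F addrK.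
rewrite -(@increasing_ge0_integration_by_substitutionT _ F G).
- apply: eq_integral => x _; rewrite -EFinM; congr EFin.
  by rewrite /G normal_pdf_shift mulrA.
- by move=> x y xy; rewrite /F ltrD2r.
- by rewrite F'E => ?; exact: cvg_cst.
- by rewrite F'E; exact: is_cvg_cst.
- by rewrite F'E; exact: is_cvg_cst.
- by move=> x; case: (dF x).
- exact: cvg_addrr_Ny.
- exact: cvg_addrr.
- move=> x; apply: cvgM; first exact: cf.
  apply: (@continuous_comp _ _ _ (fun x => x - c) (normal_pdf 0 1)).
    exact: cshift.
  by apply: continuous_normal_pdf; rewrite oner_eq0.
- by move=> x; rewrite mulr_ge0// normal_pdf_ge0.
Qed.

Lemma integrable_normal_bounded f M : continuous f -> (forall x, `|f x| <= M) ->
  gauss.-integrable [set: R] (EFin \o f).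
Proof.
move=> cf fM; apply: measurable_bounded_integrable => //.
- by rewrite [X in (X < _)%E](@probability_setT _ _ _ gauss) ltry.
- exact: continuous_measurable_fun.
- exists M; split; first exact: num_real.
  by move=> y My x _ /=; rewrite (le_trans (fM x))// ltW.
Qed.

Lemma integrable_normal_expR c :
  gauss.-integrable [set: R] (EFin \o (fun x => expR (c * x))).
Proof.
have ce : continuous (fun x => expR (c * x)).
  move=> x; apply: continuous_comp; last exact: continuous_expR.
  by apply: cvgM; [exact: cvg_cst|exact: cvg_id].
apply/integrableP; split.
  by apply/measurable_EFinP; exact: continuous_measurable_fun.
have -> : (\int[gauss]_x `|(EFin \o (fun x => expR (c * x))) x| =
    (expR (c ^+ 2 / 2))%:E * \int[gauss]_x (1 * expR (c * x - c ^+ 2 / 2))%:E)%E.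
  rewrite -ge0_integralZl//; last first.
    apply/measurable_EFinP/measurable_funM => //.
    apply: continuous_measurable_fun => x.
    apply: continuous_comp; last exact: continuous_expR.
    apply: cvgB; last exact: cvg_cst.
    by apply: cvgM; [exact: cvg_cst|exact: cvg_id].
  apply: eq_integral => x _ /=; rewrite ger0_norm ?expR_ge0// -EFinM mul1r -expRD.
  by congr (expR _)%:E; ring.
rewrite -(@ge0_integral_normal_shift (fun=> 1) c) => [||x]; last 2 first.
- by move=> x; exact: cvg_cst.
- exact: ler01.
by rewrite integral_cst// [X in (_ * (_ * X) < _)%E](@probability_setT _ _ _ gauss) !mule1 ltry.
Qed.



Lemma der_under_normal (F dF : R -> R -> R) (G : R -> R) a u v : u < a < v ->
  (forall x, u < x < v -> gauss.-integrable [set: R] (EFin \o F x)) ->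
  (forall x y, u < x < v -> is_derive x 1 (F^~ y) (dF x y)) ->
  gauss.-integrable [set: R] (EFin \o G) ->
  (forall x y, u < x < v -> `|dF x y| <= G y) ->
  is_derive a 1 (fun x => \int[gauss]_y F x y) (\int[gauss]_y dF a y).
Proof.
move=> uav intF dFP intG dFG.
have G0 y : 0 <= G y by apply: le_trans (dFG a y uav); exact: normr_ge0.
have d1E x y : u < x < v -> partial1of2 F x y = dF x y.
  by move=> xuv; rewrite partial1of2E; case: (dFP x y xuv).
have Ia : `]u, v[%classic a by rewrite /= in_itv.
have h1 x : `]u, v[%classic x -> gauss.-integrable [set: R] (EFin \o F x).
  by rewrite /= in_itv => /intF.
have h2 x y : `]u, v[%classic x -> [set: R] y -> derivable (F^~ y) x 1.
  by rewrite /= in_itv => xuv _; case: (dFP x y xuv).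
have h3 x y : `]u, v[%classic x -> [set: R] y -> `|partial1of2 F x y| <= G y.
  by rewrite /= in_itv => xuv _; rewrite d1E// dFG.
apply: DeriveDef.
  exact: (derivable_under_integral measurableT Ia h1 h2 G0 intG h3).
rewrite -derive1E (differentiation_under_integral measurableT Ia h1 h2 G0 intG h3).
by apply: eq_Rintegral => y _; rewrite d1E.
Qed.

Lemma integral_normal_cst c : \int[gauss]_x c = c :> R.
Proof.
by rewrite Rintegral_cst// [X in fine X](@probability_setT _ _ _ gauss) mulr1.
Qed.

Lemma integrable_normalZ r f : gauss.-integrable [set: R] (EFin \o f) ->
  gauss.-integrable [set: R] (EFin \o (fun x => r * f x)).
Proof.
by move=> hf; apply: eq_integrable (integrableZl measurableT r hf).
Qed.

Lemma integrable_normalD f (g : R -> R) : gauss.-integrable [set: R] (EFin \o f) ->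
  gauss.-integrable [set: R] (EFin \o g) ->
  gauss.-integrable [set: R] (EFin \o (fun x => f x + g x)).
Proof.
by move=> hf hg; apply: eq_integrable (integrableD measurableT hf hg).
Qed.

Lemma continuous_expRlin c d : continuous (fun x : R => expR (c * x - d)).
Proof.
move=> x; apply: continuous_comp; last exact: continuous_expR.
apply: cvgB; last exact: cvg_cst.
by apply: cvgM; [exact: cvg_cst|exact: cvg_id].
Qed.

Lemma integrable_normal_tilt f M c : continuous f -> (forall x, `|f x| <= M) ->
  gauss.-integrable [set: R] (EFin \o (fun x => f x * expR (c * x - c ^+ 2 / 2))).
Proof.
move=> cf fM; have M0 : 0 <= M by apply: le_trans (fM 0); exact: normr_ge0.
have := @integrableZl _ _ _ gauss _ measurableT (M * expR (- (c ^+ 2 / 2)))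
  _ (integrable_normal_expR c).
apply: le_integrable => //.
  apply/measurable_EFinP/measurable_funM; apply: continuous_measurable_fun => //.
  exact: continuous_expRlin.
move=> x _ /=; rewrite lee_fin.
rewrite !normrM (ger0_norm M0) !(ger0_norm (expR_ge0 _)) -mulrA -expRD.
by rewrite (addrC (- _)) ler_wpM2r ?expR_ge0.
Qed.

(** A bounded function becomes nonnegative once a constant is added. *)
Lemma integral_normal_shift f M c : continuous f -> (forall x, `|f x| <= M) ->
  \int[gauss]_x f (x + c) = \int[gauss]_x (f x * expR (c * x - c ^+ 2 / 2)).
Proof.
move=> cf fM; have M0 : 0 <= M by apply: le_trans (fM 0); exact: normr_ge0.
have cM : continuous (fun _ : R => M) by move=> x; exact: cvg_cst.
have ge0 (g : R -> R) : continuous g -> (forall x, 0 <= g x) ->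
    \int[gauss]_x g (x + c) = \int[gauss]_x (g x * expR (c * x - c ^+ 2 / 2)).
  by move=> cg g0; rewrite /Rintegral ge0_integral_normal_shift.
have cfs : continuous (fun x => f (x + c)).
  move=> x; apply: continuous_comp; last exact: cf.
  by apply: cvgD; [exact: cvg_id|exact: cvg_cst].
have fMi := @integrable_normal_bounded (fun x => f (x + c)) M cfs (fun x => fM _).
have := ge0 (fun x => f x + M).
have -> : \int[gauss]_x (f (x + c) + M) = \int[gauss]_x f (x + c) + \int[gauss]_x M.
  rewrite RintegralD//; apply: (@integrable_normal_bounded _ M) => // x.
  by rewrite ger0_norm.
have -> : \int[gauss]_x ((f x + M) * expR (c * x - c ^+ 2 / 2)) =
    \int[gauss]_x (f x * expR (c * x - c ^+ 2 / 2)) +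
    \int[gauss]_x (M * expR (c * x - c ^+ 2 / 2)).
  rewrite -RintegralD//; last 2 first.
  - exact: (@integrable_normal_tilt _ M).
  - by apply: (@integrable_normal_tilt _ M) => // x; rewrite ger0_norm.
  by apply: eq_Rintegral => x _; rewrite mulrDl.
rewrite -(ge0 (fun=> M))//= => h; apply/(addIr (\int[gauss]_x M))/h.
  by move=> x; apply: cvgD; [exact: cf|exact: cvg_cst].
by move=> x; have := fM x; rewrite ler_norml -lerBlDr sub0r => /andP[].
Qed.

Lemma normr_le_expR x : 1 + `|x| <= expR x + expR (- x).
Proof.
have [x0|x0] := leP 0 x.
  by rewrite ger0_norm// (le_trans (expR_ge1Dx x))// lerDl expR_ge0.
by rewrite ltr0_norm// (le_trans (expR_ge1Dx (- x)))// lerDr expR_ge0.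
Qed.

Lemma integrable_normal_expR2 c M :
  gauss.-integrable [set: R] (EFin \o (fun x => M * (expR (c * x) + expR (- c * x)))).
Proof.
rewrite (_ : _ \o _ = (fun x => M%:E *
    ((EFin \o (fun x => expR (c * x))) x + (EFin \o (fun x => expR (- c * x))) x))%E).
  apply: integrableZl => //; apply: integrableD => //; exact: integrable_normal_expR.
by apply/funext.
Qed.

(** Gaussian integration by parts: both sides of the Cameron--Martin formula
    are differentiated at shift [0]. *)
Lemma normal_stein f (df : R -> R) M : (forall x, is_derive x 1 f (df x)) ->
  (forall x, `|f x| <= M) -> (forall x, `|df x| <= M) ->
  \int[gauss]_x (f x * x) = \int[gauss]_x df x.
Proof.
move=> fP fM dfM; have M0 : 0 <= M by apply: le_trans (fM 0); exact: normr_ge0.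
have cf : continuous f by move=> x; exact: der_continuous (fP x).
have cfs c : continuous (fun x => f (x + c)).
  move=> x; apply: continuous_comp; last exact: cf.
  by apply: cvgD; [exact: cvg_id|exact: cvg_cst].
have i01 : -1 < (0 : R) < 1 by rewrite ltrN10 ltr01.
have d1 : is_derive (0 : R) 1 (fun c => \int[gauss]_x f (x + c)) (\int[gauss]_x df (x + 0)).
  apply: (@der_under_normal (fun c x => f (x + c)) (fun c x => df (x + c))
    (fun=> M) _ _ _ i01).
  - by move=> c _; exact: (@integrable_normal_bounded (fun x => f (x + c)) M).
  - move=> c x _; apply: der_eq (der_comp (fP _) (derD (der_cst x c) (der_id c))) _.
    by rewrite add0r mulr1.
  - apply: (@integrable_normal_bounded _ M) => x; first exact: cvg_cst.
    by rewrite ger0_norm.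
  - by move=> c x _.
have d2 : is_derive (0 : R) 1
    (fun c => \int[gauss]_x (f x * expR (c * x - c ^+ 2 / 2)))
    (\int[gauss]_x (f x * (expR (0 * x - 0 ^+ 2 / 2) * (x - 0)))).
  apply: (@der_under_normal (fun c x => f x * expR (c * x - c ^+ 2 / 2))
    (fun c x => f x * (expR (c * x - c ^+ 2 / 2) * (x - c)))
    (fun x => M * (expR (2 * x) + expR (- 2 * x))) _ _ _ i01).
  - by move=> c _; exact: (@integrable_normal_tilt _ M).
  - move=> c x _; apply: derMl.
    apply: (@der_ext _ (fun c => expR (c * x - c * c * 2^-1))) => [d|].
      by rewrite expr2.
    apply: der_eq (der_exp (derB (derM (der_id c) (der_cst x c))
      (derM (derM (der_id c) (der_id c)) (der_cst _ c)))) _.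
    by rewrite expr2; congr (_ * _); field.
  - exact: integrable_normal_expR2.
  - move=> c x /andP[c1 c2]; rewrite !normrM ler_pM ?normr_ge0 ?mulr_ge0//.
    have : expR `|x| * expR `|x| <= expR (2 * x) + expR (- 2 * x).
      rewrite -expRD (_ : `|x| + `|x| = 2 * `|x|); last by ring.
      have [x0|x0] := leP 0 x.
        by rewrite ger0_norm// lerDl expR_ge0.
      by rewrite ltr0_norm// mulrN -mulNr lerDr expR_ge0.
    apply: le_trans; rewrite ger0_norm ?expR_ge0// ler_pM ?expR_ge0//.
      rewrite ler_expR; have : c * x <= `|x|.
        rewrite (le_trans (ler_norm _))// normrM ler_piMl// ler_norml.
        by rewrite !ltW.
      have := sqr_ge0 c; lra.
    apply: le_trans (expR_ge1Dx _).
    rewrite (le_trans (ler_normB _ _))// addrC lerD2r ler_norml; lra.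
have d3 : is_derive (0 : R) 1 (fun c => \int[gauss]_x f (x + c))
    (\int[gauss]_x (f x * (expR (0 * x - 0 ^+ 2 / 2) * (x - 0)))).
  apply: der_ext d2 => c; exact/esym/(@integral_normal_shift _ M).
transitivity (\int[gauss]_x (f x * (expR (0 * x - 0 ^+ 2 / 2) * (x - 0)))).
  apply: eq_Rintegral => x _.
  by rewrite subr0 mul0r expr0n/= mul0r subrr expR0 mul1r.
transitivity (\int[gauss]_x df (x + 0)); last first.
  by apply: eq_Rintegral => x _; rewrite addr0.
by case: d1 d3 => _ <- [_ <-].
Qed.

End gaussian.

(** * The heat flow of [sech] *)
Section sech_average.
Variable R : realType.
Implicit Types (x b c d s t M : R) (f : R -> R).

Local Notation gauss := (normal_prob (0 : R) 1).

(** This is the solution at time [s] of the heat equation started at [f].  The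
    noise is symmetrized so that [sech_mean_le] applies under the integral. *)
Definition heat_avg f s b :=
  \int[gauss]_x ((f (b + Num.sqrt s * x) + f (b - Num.sqrt s * x)) / 2).

Definition psi := heat_avg (@sech R).

Section bounded_function.
Variables (f df : R -> R).
Hypotheses (fP : forall x, is_derive x 1 f (df x)).
Hypotheses (f1 : forall x, `|f x| <= 1) (df1 : forall x, `|df x| <= 1).

Lemma heat_avg_bound s b x :
  `|(f (b + Num.sqrt s * x) + f (b - Num.sqrt s * x)) / 2| <= 1.
Proof.
rewrite normrM (@ger0_norm _ 2^-1)// ler_pdivrMr// mul1r.
by rewrite (le_trans (ler_normD _ _))// -[2]/(1 + 1) lerD.
Qed.

Lemma continuous_heat_avg s b :
  continuous (fun x => (f (b + Num.sqrt s * x) + f (b - Num.sqrt s * x)) / 2).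
Proof.
move=> x; have d1 c := derMl c (der_id x).
have d2 := derD (der_cst b x) (d1 (Num.sqrt s)).
have d3 := derB (der_cst b x) (d1 (Num.sqrt s)).
exact: der_continuous (derM (derD (der_comp (fP _) d2) (der_comp (fP _) d3)) (der_cst 2^-1 x)).
Qed.

Lemma heat_avg_integrable s b : gauss.-integrable [set: R]
  (EFin \o (fun x => (f (b + Num.sqrt s * x) + f (b - Num.sqrt s * x)) / 2)).
Proof.
by apply: (@integrable_normal_bounded _ _ 1);
  [exact: continuous_heat_avg|exact: heat_avg_bound].
Qed.

Lemma der_heat_avg s b : is_derive b 1 (heat_avg f s) (heat_avg df s b).
Proof.
have bb : b - 1 < b < b + 1 by rewrite ltrBlDr !ltrDl ltr01.
apply: (@der_under_normal _
  (fun b x => (f (b + Num.sqrt s * x) + f (b - Num.sqrt s * x)) / 2)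
  (fun b x => (df (b + Num.sqrt s * x) + df (b - Num.sqrt s * x)) / 2)
  (fun=> 1) _ _ _ bb).
- by move=> c _; exact: heat_avg_integrable.
- move=> c x _.
  have d1 := derD (der_id c) (der_cst (Num.sqrt s * x) c).
  have d2 := derB (der_id c) (der_cst (Num.sqrt s * x) c).
  apply: der_eq (derM (derD (der_comp (fP _) d1) (der_comp (fP _) d2))
    (der_cst 2^-1 c)) _.
  by rewrite mulr0 !addr0 subr0 !mulr1.
- apply: (@integrable_normal_bounded _ _ 1) => x; first exact: cvg_cst.
  by rewrite normr1.
- move=> c x _; rewrite normrM (@ger0_norm _ 2^-1)// ler_pdivrMr// mul1r.
  by rewrite (le_trans (ler_normD _ _))// -[2]/(1 + 1) lerD.
Qed.

Lemma lipschitz1 x y : `|f x - f y| <= `|x - y|.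
Proof.
have cf : continuous f by move=> z; exact: der_continuous (fP z).
wlog xy : x y / x < y => [wl|].
  have [|yx|->] := ltgtP x y; [exact: wl| |by rewrite subrr normr0].
  by rewrite distrC (distrC x); exact: wl.
have [|c _] := @MVT _ f df x y xy (fun z _ => fP z).
  exact: continuous_subspaceT.
by rewrite distrC (distrC x) => ->; rewrite normrM ler_piMl.
Qed.

(** The average inherits the Lipschitz constant of [f] in space, and in time it
    is Lipschitz in the amplitude [Num.sqrt s], which covers [s = 0]. *)
Lemma continuous_heat_avg2 : continuous (fun p : R * R => heat_avg f p.1 p.2).
Proof.
pose w x := 1 * (expR (1 * x) + expR (- 1 * x)).
pose K := \int[gauss]_x w x.
have intK : gauss.-integrable [set: R] (EFin \o w).
  exact: integrable_normal_expR2.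
have lip s b s' b' : `|heat_avg f s b - heat_avg f s' b'| <=
    `|b - b'| + `|Num.sqrt s - Num.sqrt s'| * K.
  rewrite /heat_avg -RintegralB//; [|exact: heat_avg_integrable..].
  apply: le_trans (le_normr_Rintegral _ _) _ => //.
    apply: (@integrable_normal_bounded _ _ 2) => x.
      by apply: cvgB; exact: continuous_heat_avg.
    apply: le_trans (ler_normB _ _) _; rewrite -[2]/(1 + 1).
    by apply: lerD; exact: heat_avg_bound.
  have -> : `|b - b'| + `|Num.sqrt s - Num.sqrt s'| * K =
      \int[gauss]_x (`|b - b'| + `|Num.sqrt s - Num.sqrt s'| * w x).
    rewrite RintegralD//; first last.
    - rewrite (_ : _ \o _ = (fun x => `|Num.sqrt s - Num.sqrt s'|%:E *
        (EFin \o w) x)%E)//.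
      exact: integrableZl.
    - apply: (@integrable_normal_bounded _ _ `|b - b'|) => x; first exact: cvg_cst.
      by rewrite normr_id.
    by rewrite integral_normal_cst RintegralZl.
  apply: le_Rintegral => //.
  - apply: (@integrable_normal_bounded _ _ 2) => x.
      apply: cvg_norm.
      by apply: cvgB; exact: continuous_heat_avg.
    rewrite normr_id; apply: le_trans (ler_normB _ _) _; rewrite -[2]/(1 + 1).
    by apply: lerD; exact: heat_avg_bound.
  - rewrite (_ : _ \o _ = (fun x => `|b - b'|%:E + `|Num.sqrt s - Num.sqrt s'|%:E *
        (EFin \o w) x)%E)//.
    apply: integrableD => //; last exact: integrableZl.
    apply: (@integrable_normal_bounded _ (fun=> `|b - b'|) `|b - b'|) => x.
      exact: cvg_cst.
    by rewrite normr_id.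
  move=> x _; rewrite -mulrBl normrM (@ger0_norm _ 2^-1)// ler_pdivrMr//.
  rewrite opprD addrACA (le_trans (ler_normD _ _))// mulr_natr mulr2n.
  have h : `|(Num.sqrt s - Num.sqrt s') * x| <=
      `|Num.sqrt s - Num.sqrt s'| * w x.
    rewrite normrM ler_wpM2l// /w !mul1r mulN1r.
    by apply: le_trans (normr_le_expR x); rewrite lerDr.
  apply: lerD; apply: le_trans (lipschitz1 _ _) _.
    rewrite (_ : _ - _ = (b - b') + (Num.sqrt s - Num.sqrt s') * x); last by ring.
    by rewrite (le_trans (ler_normD _ _))// lerD2l.
  rewrite (_ : _ - _ = (b - b') - (Num.sqrt s - Num.sqrt s') * x); last by ring.
  by rewrite (le_trans (ler_normB _ _))// lerD2l.
move=> [s b].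
have c1 : (fun p : R * R => `|p.2 - b|) @ nbhs (s, b) --> `|b - b|.
  by apply: cvg_norm; apply: cvgB; [exact: cvg_snd|exact: cvg_cst].
have c2 : (fun p : R * R => `|Num.sqrt p.1 - Num.sqrt s|) @ nbhs (s, b) -->
    `|Num.sqrt s - Num.sqrt s|.
  apply: cvg_norm; apply: cvgB; last exact: cvg_cst.
  have cs : continuous (fun p : R * R => Num.sqrt p.1).
    move=> p; apply: (@continuous_comp _ _ _ (fun p : R * R => p.1) (@Num.sqrt R)).
      exact: cvg_fst.
    exact: sqrt_continuous.
  exact: (cs (s, b)).
have c3 := cvgD c1 (cvgM c2 (cvg_cst K)).
rewrite !subrr normr0 mul0r addr0 in c3.
have c4 : (fun p : R * R => `|heat_avg f p.1 p.2 - heat_avg f s b|) @ nbhs (s, b) -->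
    (0 : R).
  have h := @squeeze_cvgr (R * R)%type (nbhs (s, b)) _ R (fun=> 0)
   (fun p : R * R => `|p.2 - b| + `|Num.sqrt p.1 - Num.sqrt s| * K)
   (fun p : R * R => `|heat_avg f p.1 p.2 - heat_avg f s b|).
  apply: h.
  - by apply: nearW => p; rewrite normr_ge0/=; exact: lip.
  - exact: cvg_cst.
  - exact: c3.
by apply/subr_cvg0; apply: norm_cvg0.
Qed.

End bounded_function.

Lemma sech_norm_le1 x : `|sech x| <= 1.
Proof. by rewrite ger0_norm ?sech_le1// ltW// sech_gt0. Qed.

Lemma psi_continuous : continuous (fun p : R * R => psi p.1 p.2).
Proof.
exact: continuous_heat_avg2 (@der_sech R) sech_norm_le1 (@dsech_bound R).
Qed.

Lemma psi0 b : psi 0 b = sech b.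
Proof.
rewrite /psi /heat_avg sqrtr0.
rewrite -[RHS]integral_normal_cst; apply: eq_Rintegral => x _.
by rewrite mul0r addr0 subr0; field.
Qed.

Definition dpsi := heat_avg (@dsech R).
Definition ddpsi := heat_avg (@ddsech R).

Lemma der_psi s b : is_derive b 1 (psi s) (dpsi s b).
Proof. exact: der_heat_avg (@der_sech R) sech_norm_le1 (@dsech_bound R) s b. Qed.

Lemma der_dpsi s b : is_derive b 1 (dpsi s) (ddpsi s b).
Proof. exact: der_heat_avg (@der_dsech R) (@dsech_bound R) (@ddsech_bound R) s b. Qed.

(** The heat equation for [psi], along a line of slope [q]: the time derivative
    of the noise amplitude produces a factor [x], which Gaussian integration by
    parts turns into a second space derivative. *)
Lemma der_psi_path c q s : 0 < s ->
  is_derive s 1 (fun s => psi s (c + q * s))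
    (ddpsi s (c + q * s) / 2 + q * dpsi s (c + q * s)).
Proof.
move=> s0; have r0 : 0 < Num.sqrt s by rewrite sqrtr_gt0.
pose b t := c + q * t.
pose D t x : R := (dsech (b t + Num.sqrt t * x) - dsech (b t - Num.sqrt t * x)) / 2.
pose P t x : R := (dsech (b t + Num.sqrt t * x) + dsech (b t - Num.sqrt t * x)) / 2.
have D1 t x : `|D t x| <= 1.
  rewrite /D normrM (@ger0_norm _ 2^-1)// ler_pdivrMr// mul1r.
  by rewrite (le_trans (ler_normB _ _))// -[2]/(1 + 1) lerD ?dsech_bound.
have P1 t x : `|P t x| <= 1 by exact: heat_avg_bound (@dsech_bound R) _ _ _.
have intP : gauss.-integrable [set: R] (EFin \o P s).
  exact: heat_avg_integrable (@der_dsech R) (@dsech_bound R) s (b s).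
have dD x : is_derive x 1 (D s) (Num.sqrt s *
    ((ddsech (b s + Num.sqrt s * x) + ddsech (b s - Num.sqrt s * x)) / 2)).
  have d1 c := derMl c (der_id x).
  have d2 := derD (der_cst (b s) x) (d1 (Num.sqrt s)).
  have d3 := derB (der_cst (b s) x) (d1 (Num.sqrt s)).
  apply: der_eq (derM (derB (der_comp (der_dsech _) d2) (der_comp (der_dsech _) d3))
    (der_cst 2^-1 x)) _.
  by field.
have intDx : gauss.-integrable [set: R] (EFin \o (fun x => D s x * x)).
  apply: le_integrable (integrable_normal_expR2 1 1) => //.
    apply/measurable_EFinP/measurable_funM => //.
    by apply: continuous_measurable_fun => x; exact: der_continuous (dD x).
  move=> x _ /=; rewrite lee_fin mulN1r !mul1r normrM.
  rewrite [leRHS]ger0_norm ?addr_ge0 ?expR_ge0//.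
  apply: le_trans (normr_le_expR x); rewrite -[leLHS]add0r lerD//.
  by rewrite ler_piMl.
have stein : \int[gauss]_x (D s x * x) = Num.sqrt s * ddpsi s (b s).
  rewrite (normal_stein (M := 1 + Num.sqrt s) dD); first last.
  - move=> x; rewrite normrM (ger0_norm (sqrtr_ge0 s)).
    apply: (@le_trans _ _ (Num.sqrt s * 1)); last by rewrite mulr1 lerDr.
    by rewrite ler_wpM2l ?sqrtr_ge0// heat_avg_bound//; exact: ddsech_bound.
  - by move=> x; rewrite (le_trans (D1 s x))// lerDl sqrtr_ge0.
  rewrite RintegralZl//.
  apply: (@integrable_normal_bounded _ _ 1) => [x|x]; last first.
    exact: heat_avg_bound (@ddsech_bound R) _ _ _.
  have dP (y : R) : is_derive y 1 (@ddsech R) (dsech y -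
      2 * (dsech y * (sech y * sech y) + sech y * (dsech y * sech y + sech y * dsech y))).
    have d := der_sech y.
    apply: der_ext (derB d (derMl 2 (derM d (derM d d)))) => z.
    by rewrite /ddsech; ring.
  exact: continuous_heat_avg dP s (b s) x.
have -> : ddpsi s (b s) / 2 + q * dpsi s (b s) =
    \int[gauss]_x ((2 * Num.sqrt s)^-1 * (D s x * x) + q * P s x).
  rewrite RintegralD//; last 2 first.
  - exact: (integrable_normalZ _ intDx).
  - exact: (integrable_normalZ _ intP).
  rewrite !RintegralZl// stein; congr (_ + _).
  by field; exact: lt0r_neq0.
(* The amplitude has an unbounded derivative at time 0; on this neighbourhood of
   [s] it is bounded. *)
have ss : s / 2 < s < 2 * s by lra.
pose w x := (2 * Num.sqrt (s / 2))^-1 * (expR (1 * x) + expR (- 1 * x)).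
apply: (@der_under_normal _
  (fun t x => (sech (b t + Num.sqrt t * x) + sech (b t - Num.sqrt t * x)) / 2)
  (fun t x => (2 * Num.sqrt t)^-1 * (D t x * x) + q * P t x)
  (fun x => w x + `|q|) _ _ _ ss).
- by move=> t _; exact: heat_avg_integrable (@der_sech R) sech_norm_le1 t (b t).
- move=> t x /andP[c1 c2]; have t0 : 0 < t by lra.
  have dr := is_derive1_sqrt t0.
  have db := derD (der_cst c t) (derMl q (der_id t)).
  have d2 := derD db (derM dr (der_cst x t)).
  have d3 := derB db (derM dr (der_cst x t)).
  apply: der_eq (derM (derD (der_comp (der_sech _) d2) (der_comp (der_sech _) d3))
    (der_cst 2^-1 t)) _.
  rewrite /D /P /b; set u := dsech _; set v := dsech _; rewrite !mulr0 !add0r !addr0 mulr1.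
  by field; rewrite lt0r_neq0// sqrtr_gt0.
- apply: integrable_normalD; first exact: integrable_normal_expR2.
  apply: (@integrable_normal_bounded _ (fun=> `|q|) `|q|) => x; first exact: cvg_cst.
  by rewrite normr_id.
move=> t x /andP[c1 c2]; have t0 : 0 < t by lra.
rewrite (le_trans (ler_normD _ _))//; apply: lerD; last by rewrite normrM ler_piMr.
rewrite normrM; apply: ler_pM => //.
  have h : 0 < Num.sqrt (s / 2) by rewrite sqrtr_gt0; lra.
  have h' : Num.sqrt (s / 2) <= Num.sqrt t by rewrite ler_sqrt ltW.
  rewrite ger0_norm ?invr_ge0 ?mulr_ge0 ?sqrtr_ge0// lef_pV2 ?posrE ?mulr_gt0//.
    by rewrite ler_pM2l.
  exact: lt_le_trans h'.
rewrite mul1r mulN1r normrM; apply: le_trans (normr_le_expR x).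
by rewrite -[leLHS]add0r lerD// ler_piMl.
Qed.

(** The inequality [sech_mean_le], averaged over the noise. *)
Lemma psi_le b s : psi s b <= cosh b * psi s 0.
Proof.
rewrite /psi /heat_avg -RintegralZl//; last first.
  exact: heat_avg_integrable (@der_sech R) sech_norm_le1 s 0.
apply: le_Rintegral => //.
- exact: heat_avg_integrable (@der_sech R) sech_norm_le1 s b.
- pose w x := (sech (0 + Num.sqrt s * x) + sech (0 - Num.sqrt s * x)) / 2.
  rewrite (_ : _ \o _ = (fun x => (cosh b)%:E * (EFin \o w) x)%E)//.
  apply: integrableZl => //.
  exact: heat_avg_integrable (@der_sech R) sech_norm_le1 s 0.
move=> x _; rewrite add0r sub0r; apply: le_trans (sech_mean_le _ _) _.
have -> : sech (- (Num.sqrt s * x)) = sech (Num.sqrt s * x).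
  by rewrite /sech /cosh opprK addrC.
by rewrite le_eqVlt; apply/orP; left; apply/eqP; field.
Qed.

End sech_average.

(** * The function [rfun] *)
Section rfun_formula.
Variable R : realType.
Implicit Types (x b t : R).

Local Notation gauss := (normal_prob (0 : R) 1).

Lemma continuous_sech2 a c : continuous (fun x : R => (cosh (a + c * x))^-2).
Proof.
move=> x; have d := der_comp (der_sech _) (derD (der_cst a x) (derMl c (der_id x))).
have := der_continuous (derM d d).
rewrite (_ : (fun y => _) = (fun x => (cosh (a + c * x))^-2))//.
by apply/funext => y; rewrite /sech -invfM expr2.
Qed.

Lemma sech2_bound x : `|(cosh x)^-2| <= 1.
Proof.
rewrite ger0_norm ?invr_ge0 ?exprn_ge0 ?(ltW (cosh_gt0 _))//.
by rewrite -one_minus_tanh2 lerBlDr lerDl sqr_ge0.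
Qed.

Lemma rfunE t : rfun t =
  (\int[gauss]_x (cosh (t + Num.sqrt t * x))^-2) / 2 +
  (\int[gauss]_x (cosh (- t + Num.sqrt t * x))^-2) / 2.
Proof.
have ge0 x : 0 <= (cosh x)^-2 by rewrite invr_ge0 exprn_ge0// ltW// cosh_gt0.
have intf a c : gauss.-integrable [set: R] (EFin \o (fun x => (cosh (a + c * x))^-2)).
  apply: (@integrable_normal_bounded _ _ 1); first exact: continuous_sech2.
  by move=> x; exact: sech2_bound.
have fin a c : (\int[gauss]_x ((cosh (a + c * x))^-2)%:E)%E \is a fin_num.
  exact: integrable_fin_num (intf a c).
rewrite /rfun /Rintegral.
have -> : (\int[(bernoulli_prob (2^-1 : R) \x normal_prob (0 : R) 1)%E]_w
    (1 - tanh (t * spin R w.1 + Num.sqrt t * w.2) ^+ 2)%:E =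
  \int[bernoulli_prob (2^-1 : R)]_y
    \int[gauss]_x ((cosh (t * spin R y + Num.sqrt t * x))^-2)%:E)%E.
  under eq_integral do rewrite one_minus_tanh2.
  rewrite fubini_tonelli1//; last by move=> w; rewrite lee_fin.
  apply/measurable_EFinP.
  apply: (@measurableT_comp _ _ _ _ _ _ (fun x : R => (cosh x)^-2)).
    have := @continuous_sech2 0 1.
    rewrite (_ : (fun x => _) = (fun x => (cosh x)^-2)).
      exact: continuous_measurable_fun.
    by apply/funext => x; rewrite add0r mul1r.
  apply: measurable_funD; apply: measurable_funM => //.
  exact: (@measurableT_comp _ _ _ _ _ _ (@spin R)).
rewrite integral_bernoulli_prob; last 2 first.
- lra.
- by move=> y; apply: integral_ge0 => x _; rewrite lee_fin.
rewrite /= mulr1 mulrN1 fineD ?fineM ?fin_numM//.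
have -> : unstable.onem (2^-1 : R) = 2^-1 by rewrite /unstable.onem; field.
by rewrite /= ![2^-1 * _]mulrC.
Qed.

(** Translating the noise by [Num.sqrt t] for one value of the spin and by
    [- Num.sqrt t] for the other absorbs the spin into the tilts
    [expR (Num.sqrt t * x)] and [expR (- Num.sqrt t * x)]; their sum cancels one
    of the two factors [sech]. *)
Lemma rfun_psi t : 0 <= t -> rfun t = expR (- (t / 2)) * psi t 0.
Proof.
move=> t0; have rt : Num.sqrt t * Num.sqrt t = t by rewrite -expr2 sqr_sqrtr.
pose f x := (cosh (Num.sqrt t * x))^-2.
have cf : continuous f.
  have := @continuous_sech2 0 (Num.sqrt t).
  by rewrite (_ : (fun x => _) = f)//; apply/funext => x; rewrite add0r.
have f1 x : `|f x| <= 1 by exact: sech2_bound.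
rewrite rfunE.
have -> : \int[gauss]_x (cosh (t + Num.sqrt t * x))^-2 =
    \int[gauss]_x f (x + Num.sqrt t).
  by apply: eq_Rintegral => x _; rewrite /f mulrDr rt addrC.
have -> : \int[gauss]_x (cosh (- t + Num.sqrt t * x))^-2 =
    \int[gauss]_x f (x + - Num.sqrt t).
  by apply: eq_Rintegral => x _; rewrite /f mulrDr mulrN rt addrC.
rewrite !(@integral_normal_shift _ f 1)// -mulrDl -RintegralD//; last 2 first.
- exact: (@integrable_normal_tilt _ _ 1).
- exact: (@integrable_normal_tilt _ _ 1).
rewrite /psi /heat_avg -RintegralZl//; last first.
  exact: heat_avg_integrable (@der_sech R) (@sech_norm_le1 R) t 0.
rewrite -RintegralZr//; last first.
  pose u c x := f x * expR (c * x - c ^+ 2 / 2).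
  pose u1 := u (Num.sqrt t); pose u2 := u (- Num.sqrt t).
  rewrite (_ : _ \o _ = ((EFin \o u1) \+ (EFin \o u2))%E)//.
  by apply: integrableD => //; exact: (@integrable_normal_tilt _ _ 1).
apply: eq_Rintegral => x _.
rewrite sqrrN expr2 rt add0r sub0r -mulrDr !expRD.
have -> : sech (- (Num.sqrt t * x)) = sech (Num.sqrt t * x).
  by rewrite /sech /cosh opprK addrC.
rewrite /f /sech mulNr -mulrDl.
have := cosh_neq0 (Num.sqrt t * x).
have -> : expR (Num.sqrt t * x) + expR (- (Num.sqrt t * x)) = 2 * cosh (Num.sqrt t * x).
  by rewrite /cosh; field.
by move: (cosh _) => c c0; field.
Qed.

Lemma rfun_le1 t : rfun t <= 1.
Proof.
rewrite rfunE.
have le a : \int[gauss]_x (cosh (a + Num.sqrt t * x))^-2 <= 1.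
  rewrite -[leRHS]integral_normal_cst; apply: le_Rintegral => //.
  - apply: (@integrable_normal_bounded _ _ 1); first exact: continuous_sech2.
    by move=> x; exact: sech2_bound.
  - apply: (@integrable_normal_bounded _ (fun=> 1) 1) => x; first exact: cvg_cst.
    by rewrite normr1.
  - by move=> x _; apply: le_trans (sech2_bound _); exact: ler_norm.
by have := le t; have := le (- t); lra.
Qed.

End rfun_formula.

(** * The heat operator and its maximum principle *)
Section one_variable_maximum.
Variable R : realType.
Implicit Types (f g : R -> R) (x d e : R).

Lemma der_quotient f x d : is_derive x 1 f d -> forall e, 0 < e ->
  exists2 r, 0 < r & forall h, h != 0 -> `|h| < r ->
    `|(f (x + h) - f x) / h - d| < e.
Proof.
move=> [df <-] e e0.
have := df; rewrite /derivable => /cvgrPdist_lt /(_ _ e0).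
case=> r /= r0 hr; exists r => // h h0 hlt.
have := hr h; rewrite /ball_/= sub0r normrN => /(_ hlt h0).
rewrite distrC /GRing.scale/= mulr1 addrC (addrC h) mulrC.
by rewrite addrC [X in _ - X](_ : _ = 'D_1 f x).
Qed.

Lemma der_at_left_max f x d : is_derive x 1 f d -> 0 < x ->
  (forall y, 0 <= y <= x -> f y <= f x) -> 0 <= d.
Proof.
move=> fd x0 fmax; rewrite leNgt; apply/negP => d0.
have nd0 : 0 < - d by rewrite oppr_gt0.
have [r r0 hr] := der_quotient fd nd0.
pose h := - (Num.min x (r / 2)).
have mx0 : 0 < Num.min x (r / 2) by rewrite lt_min x0 divr_gt0.
have h0 : h < 0 by rewrite oppr_lt0.
have hx : Num.min x (r / 2) <= x by rewrite ge_min lexx.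
have hr2 : Num.min x (r / 2) <= r / 2 by rewrite ge_min lexx orbT.
have q0 : 0 <= (f (x + h) - f x) / h.
  rewrite -mulrNN -invrN mulr_ge0//; last by rewrite invr_ge0 oppr_ge0 ltW.
  by rewrite opprB subr_ge0 fmax// /h subr_ge0 hx/= lerBlDr lerDl ltW.
have hr' : `|h| < r by rewrite normrN gtr0_norm//; move: hr2 r0; lra.
have := hr h (ltr0_neq0 h0) hr'.
by rewrite ltr_norml => /andP[_]; move: q0; lra.
Qed.

Lemma der2_at_max f g (d : R) : (forall s : R, is_derive s 1 f (g s)) ->
  is_derive (0 : R) 1 g d -> (forall s, f s <= f 0) -> d <= 0.
Proof.
move=> fg gd fmax; rewrite leNgt; apply/negP => d0.
have g0 : g 0 = 0.
  have i0 : (0 : R) \in `]-1, 1[ by rewrite in_itv/= ltrN10 ltr01.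
  have [_ e0] : is_derive (0 : R) 1 f 0.
    by apply: (@derive1_at_max _ f (-1) 1 0) => // t _; case: (fg t).
  by have [_ <-] := fg 0.
have [r r0 hr] := der_quotient gd d0.
have gpos h : 0 < h -> h < r -> 0 < g h.
  move=> h0 hlt; have := hr h (lt0r_neq0 h0); rewrite gtr0_norm// => /(_ hlt).
  rewrite add0r g0 subr0 ltr_norml => /andP[+ _].
  by rewrite ltrBrDr addNr pmulr_lgt0// invr_gt0.
have r20 : 0 < r / 2 by rewrite divr_gt0.
have [c] := MVT r20 (fun x _ => fg x)
  (continuous_subspaceT (fun x => der_continuous (fg x))).
rewrite in_itv/= => /andP[c0 cr] e.
have : 0 < f (r / 2) - f 0.
  by rewrite e subr0 mulr_gt0// gpos//; lra.
by rewrite subr_gt0 ltNge fmax.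
Qed.

End one_variable_maximum.

Section heat_operator.
Variables (R : realType) (n m : nat) (b : 'I_m -> 'rV[R]_n).
Implicit Types (N W : R -> 'rV[R]_n -> R) (z d : R) (h : 'rV[R]_n).

(** [heat_defect N z h d] says that [d] is the value at [(z, h)] of the heat
    operator, time derivative minus half the sum of the second derivatives in
    the directions [b k].  Only derivatives along lines are required. *)
Definition heat_defect N z h d : Prop :=
  exists (dz : R) (N1 : 'I_m -> R -> R) (N2 : 'I_m -> R),
  [/\ is_derive z 1 (N^~ h) dz,
      forall k s, is_derive (s : R) 1 (fun s : R => N z (h + s *: b k)) (N1 k s),
      forall k, is_derive (0 : R) 1 (N1 k) (N2 k)
    & d = dz - 2^-1 * \sum_k N2 k].

Lemma heat_eq N z h d d' : heat_defect N z h d -> d = d' -> heat_defect N z h d'.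
Proof. by move=> + <-. Qed.

Lemma heat_ext N N' z h d : (forall z h, N z h = N' z h) ->
  heat_defect N z h d -> heat_defect N' z h d.
Proof.
move=> NN'; have -> // : N = N'.
by apply/funext => t; apply/funext => u.
Qed.

Lemma heatD N N' z h d d' : heat_defect N z h d -> heat_defect N' z h d' ->
  heat_defect (fun z h => N z h + N' z h) z h (d + d').
Proof.
move=> [dz [N1 [N2 [hz h1 h2 ->]]]] [dz' [N1' [N2' [hz' h1' h2' ->]]]].
exists (dz + dz'), (fun k s => N1 k s + N1' k s), (fun k => N2 k + N2' k).
split; [exact: derD|by move=> k s; exact: derD|by move=> k; exact: derD|].
by rewrite big_split/=; ring.
Qed.

Lemma heat_time (c : R -> R) c' N z h d : is_derive z 1 c c' ->
  heat_defect N z h d ->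
  heat_defect (fun z h => c z * N z h) z h (c z * d + c' * N z h).
Proof.
move=> hc [dz [N1 [N2 [hz h1 h2 ->]]]].
exists (c' * N z h + c z * dz), (fun k s => c z * N1 k s), (fun k => c z * N2 k).
split; [exact: derM|by move=> k s; exact: derMl|by move=> k; exact: derMl|].
by rewrite -mulr_sumr; ring.
Qed.

Lemma heatZ c N z h d : heat_defect N z h d ->
  heat_defect (fun z h => c * N z h) z h (c * d).
Proof.
move=> hN; apply: heat_eq (heat_time (der_cst c z) hN) _.
by rewrite mul0r addr0.
Qed.

Lemma heatB N N' z h d d' : heat_defect N z h d -> heat_defect N' z h d' ->
  heat_defect (fun z h => N z h - N' z h) z h (d - d').
Proof.
move=> hN /(heatZ (-1)) hN'.
apply: heat_ext (heat_eq (heatD hN hN') _) => [t u|]; by rewrite mulN1r.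
Qed.

Lemma heat_sum (I : finType) (N : I -> R -> 'rV[R]_n -> R) (d : I -> R) z h :
  (forall i, heat_defect (N i) z h (d i)) ->
  heat_defect (fun z h => \sum_i N i z h) z h (\sum_i d i).
Proof.
move=> hN; elim: (index_enum I) => [|i s ih].
  apply: (@heat_ext (fun _ _ => 0 * 0)) => [t u|]; first by rewrite big_nil mulr0.
  rewrite big_nil; exists 0, (fun _ _ => 0), (fun _ => 0).
  split; [exact: der_cst|by move=> k t; exact: der_cst|by move=> k; exact: der_cst|].
  by rewrite big1// mulr0 subr0.
rewrite big_cons; apply: heat_ext (heatD (hN i) ih) => t u.
by rewrite big_cons.
Qed.

Lemma heat_id_time z h : heat_defect (fun z _ => z) z h 1.
Proof.
exists 1, (fun _ _ => 0), (fun _ => 0).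
split; [exact: der_id|by move=> k t; exact: der_cst|by move=> k; exact: der_cst|].
by rewrite big1// mulr0 subr0.
Qed.

(** The barrier [W] confines the problem to a compact box: [N - e * (W + z)] is
    nonpositive outside of it, so a positive value forces a positive maximum at a positive time,
    where the heat operator cannot be negative.  But the term [e * z] makes the
    defect of this function at most [- e]. *)
Lemma heat_max_principle N W (tau : R) :
  (forall z h, 0 <= z <= tau ->
    {for (z, h), continuous (fun p : R * 'rV[R]_n => N p.1 p.2)}) ->
  (forall z h, 0 < z <= tau -> exists2 d, heat_defect N z h d & d <= 0) ->
  (forall h, N 0 h <= 0) ->
  continuous (fun p : R * 'rV[R]_n => W p.1 p.2) ->
  (forall z h, heat_defect W z h 0) ->
  (forall z h, 0 <= W z h) ->
  (forall e, 0 < e -> exists rho, forall z h, 0 <= z <= tau ->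
    ~~ [forall i, `|h 0 i| <= rho] -> N z h <= e * W z h) ->
  forall z h, 0 <= z <= tau -> N z h <= 0.
Proof.
move=> cN dN N0 cW dW W0 growth z1 h1 z1tau; rewrite leNgt; apply/negP => N1.
have /andP[z10 z1t] := z1tau.
(* [e] is small enough for [N - e * (W + z)] to stay positive at [(z1, h1)]. *)
pose D := W z1 h1 + z1 + 1.
have D0 : 0 < D by rewrite /D ltr_wpDl// addr_ge0.
pose e := N z1 h1 / D / 2.
have e0 : 0 < e by rewrite !divr_gt0.
pose M z h := N z h - e * (W z h + z).
have M1 : 0 < M z1 h1.
  have eD : e * D = N z1 h1 / 2 by rewrite /e; field; exact: lt0r_neq0.
  have : e * (W z1 h1 + z1) <= e * D by rewrite ler_wpM2l ?(ltW e0)// lerDl.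
  by rewrite eD /M; lra.
have [rho hrho] := growth e e0.
have out z h : 0 <= z <= tau -> ~~ [forall i, `|h 0 i| <= rho] -> M z h <= 0.
  move=> zt ho; rewrite /M subr_le0 (le_trans (hrho z h zt ho))//.
  by rewrite ler_wpM2l ?(ltW e0)// lerDl; case/andP: zt.
pose box : set 'rV[R]_n := [set h | forall i, `[- rho, rho]%classic (h 0 i)].
have boxP h : box h <-> [forall i, `|h 0 i| <= rho].
  split=> [hb|/forallP hb i].
    by apply/forallP => i; have := hb i; rewrite /= in_itv/= ler_norml.
  by rewrite /= in_itv/= -ler_norml.
pose K : set (R * 'rV[R]_n) := `[0, tau]%classic `*` box.
have cK : compact K.
  apply: compact_setX; first exact: segment_compact.
  by apply: (@rV_compact R n (fun=> `[- rho, rho]%classic)) => i; exact: segment_compact.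
have K1 : K (z1, h1).
  split; first by rewrite /= in_itv.
  by apply/boxP; case: (boolP [forall i, _]) => // /(out _ _ z1tau); rewrite leNgt M1.
have cM : {within K, continuous (fun p : R * 'rV[R]_n => M p.1 p.2)}.
  apply: continuous_in_subspaceT => -[z h]; rewrite inE => -[]; rewrite /= in_itv/= => zt _.
  apply: cvgB; first exact: cN.
  apply: cvgM; first exact: cvg_cst.
  by apply: cvgD; [exact: cW|exact: cvg_fst].
have [[z0 h0]] := compact_EVT_max (ex_intro _ _ K1) cK cM.
rewrite inE => -[]; rewrite /= in_itv/= => z0tau hb0 Mmax.
have M0 : 0 < M z0 h0 by apply: lt_le_trans M1 _; apply: (Mmax (z1, h1)); rewrite inE.
have max z h : 0 <= z <= tau -> M z h <= M z0 h0.
  move=> zt; case: (boolP [forall i, `|h 0 i| <= rho]) => hb.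
    apply: (Mmax (z, h)); rewrite inE; split; first by rewrite /= in_itv.
    exact/boxP.
  by rewrite (le_trans (out _ _ zt hb))// ltW.
have z0gt : 0 < z0.
  rewrite lt_neqAle; case/andP: (z0tau) => -> _; rewrite andbT eq_sym.
  apply/eqP => z00; move: M0; rewrite z00 /M addr0 subr_gt0 ltNge.
  by rewrite (le_trans (N0 _))// mulr_ge0// ltW.
have zt0 : 0 < z0 <= tau by rewrite z0gt; case/andP: z0tau.
have [d hd d0] := dN z0 h0 zt0.
have := heatB hd (heatZ e (heatD (dW z0 h0) (heat_id_time z0 h0))).
rewrite add0r mulr1 => -[dz [M1' [M2 [hz h1' h2 ed]]]].
have dz0 : 0 <= dz.
  apply: der_at_left_max hz z0gt _ => y /andP[y0 yz]; apply: max.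
  by rewrite y0 (le_trans yz)//; case/andP: zt0.
have M20 k : M2 k <= 0.
  apply: der2_at_max (h1' k) (h2 k) _ => s; rewrite scale0r addr0.
  exact: max.
have : \sum_k M2 k <= 0 by apply: sumr_le0.
by move: ed d0 e0 dz0; lra.
Qed.

End heat_operator.

(** * Exponential sums over spin configurations *)
Section gibbs_sums.
Variables (R : realType) (n m : nat) (b : 'I_m -> 'rV[R]_n).
Local Notation config := {ffun 'I_n -> bool}.
Implicit Types (u v h : 'rV[R]_n) (x y : config) (z : R) (c d : config -> R).

Definition lin u x : R := \sum_i u 0 i * spin R (x i).

(** The quadratic form of the matrix [\sum_k (b k)^T *m b k]. *)
Definition quad x : R := \sum_k lin (b k) x ^+ 2.

(** The weight at time [z] in the external field [h]: time is the strength of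
    the interaction. *)
Definition gibbs z h x : R := expR (z / 2 * quad x + lin h x).

Definition wsum c z h : R := \sum_x c x * gibbs z h x.

Definition part := wsum (fun=> 1).

Lemma lin_line h u s x : lin (h + s *: u) x = lin h x + s * lin u x.
Proof.
rewrite /lin mulr_sumr -big_split/=; apply: eq_bigr => i _.
by rewrite !mxE mulrDl mulrA.
Qed.

Lemma linZ s u x : lin (s *: u) x = s * lin u x.
Proof. by rewrite /lin mulr_sumr; apply: eq_bigr => i _; rewrite mxE mulrA. Qed.

Lemma gibbs_gt0 z h x : 0 < gibbs z h x.
Proof. exact: expR_gt0. Qed.

Lemma wsum_gt0 c z h x0 : (forall x, 0 <= c x) -> 0 < c x0 -> 0 < wsum c z h.
Proof.
move=> c0 cx0; rewrite /wsum (bigD1 x0)//=; apply: ltr_pwDl.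
  by rewrite mulr_gt0// gibbs_gt0.
by apply: sumr_ge0 => x _; rewrite mulr_ge0// ltW// gibbs_gt0.
Qed.

Lemma part_gt0 z h : 0 < part z h.
Proof.
by apply: (@wsum_gt0 _ _ _ [ffun=> true]) => [x|]; [exact: ler01|exact: ltr01].
Qed.

Lemma part_neq0 z h : part z h != 0.
Proof. exact: lt0r_neq0 (part_gt0 z h). Qed.

Lemma der_wsum_time c z h : is_derive z 1 (fun z => wsum c z h)
  (wsum (fun x => c x * (2^-1 * quad x)) z h).
Proof.
apply: der_sum => x.
have d1 := der_exp (derD (derM (derM (der_id z) (der_cst 2^-1 z))
  (der_cst (quad x) z)) (der_cst (lin h x) z)).
by apply: der_eq (derMl (c x) d1) _; rewrite /gibbs; ring.
Qed.

Lemma der_wsum_line c z h u (s : R) : is_derive s 1 (fun s : R => wsum c z (h + s *: u))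
  (wsum (fun x => c x * lin u x) z (h + s *: u)).
Proof.
apply: der_sum => x; rewrite /gibbs.
apply: (@der_ext _ (fun s => c x * expR (z / 2 * quad x + (lin h x + s * lin u x)))).
  by move=> t; rewrite lin_line.
have d1 := der_exp (derD (der_cst (z / 2 * quad x) s)
  (derD (der_cst (lin h x) s) (derM (der_id s) (der_cst (lin u x) s)))).
by apply: der_eq (derMl (c x) d1) _; rewrite lin_line; ring.
Qed.

Lemma wsumD c d z h : wsum (fun x => c x + d x) z h = wsum c z h + wsum d z h.
Proof. by rewrite -big_split/=; apply: eq_bigr => x _; rewrite mulrDl. Qed.

Lemma wsumZ r c z h : wsum (fun x => r * c x) z h = r * wsum c z h.
Proof. by rewrite mulr_sumr; apply: eq_bigr => x _; rewrite mulrA. Qed.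

Lemma wsum_sum (I : finType) (c : I -> config -> R) z h :
  wsum (fun x => \sum_i c i x) z h = \sum_i wsum (c i) z h.
Proof. by rewrite exchange_big; apply: eq_bigr => x _; rewrite mulr_suml. Qed.

Lemma eq_wsum c d z h : c =1 d -> wsum c z h = wsum d z h.
Proof. by move=> cd; apply: eq_bigr => x _; rewrite cd. Qed.

(** Second derivatives in the directions [b k] add up to the quadratic form
    that time differentiation brings down. *)
Lemma heat_balance c z h :
  wsum (fun x => c x * (2^-1 * quad x)) z h =
  2^-1 * \sum_k wsum (fun x => c x * lin (b k) x * lin (b k) x) z h.
Proof.
rewrite -wsum_sum -wsumZ; apply: eq_wsum => x.
by rewrite mulrCA /quad mulr_sumr; congr (_ * _); apply: eq_bigr => k _; ring.
Qed.

Lemma heat_wsum c z h : heat_defect b (wsum c) z h 0.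
Proof.
exists (wsum (fun x => c x * (2^-1 * quad x)) z h),
  (fun k s => wsum (fun x => c x * lin (b k) x) z (h + s *: b k)),
  (fun k => wsum (fun x => c x * lin (b k) x * lin (b k) x) z h); split.
- exact: der_wsum_time.
- by move=> k s; exact: der_wsum_line.
- move=> k; have := der_wsum_line (fun x => c x * lin (b k) x) z h (b k) 0.
  by rewrite scale0r addr0.
- by rewrite heat_balance subrr.
Qed.

Section perspective.
Variables (phi phi1 phi2 : R -> R) (c d : config -> R).
Hypothesis phiP : forall z h,
  is_derive (wsum c z h / wsum d z h) 1 phi (phi1 (wsum c z h / wsum d z h)).
Hypothesis phi1P : forall z h,
  is_derive (wsum c z h / wsum d z h) 1 phi1 (phi2 (wsum c z h / wsum d z h)).
Hypothesis d0 : forall z h, wsum d z h != 0.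

Let a z h := wsum c z h / wsum d z h.

(** The derivative of the quotient of the two sums in the direction [b k]. *)
Definition slope z h k := (wsum (fun x => c x * lin (b k) x) z h -
  a z h * wsum (fun x => d x * lin (b k) x) z h) / wsum d z h.

(** For two solutions [C] and [D] of the heat equation, [D * phi (C / D)] fails
    to solve it only by the curvature of [phi].  The squared covariance in the
    evolution of a variance, and the relative Fisher information in that of an
    entropy, are both instances. *)
Lemma heat_persp z h :
  heat_defect b (fun z h => wsum d z h * phi (wsum c z h / wsum d z h)) z h
    (- (2^-1 * wsum d z h * phi2 (a z h) * \sum_k slope z h k ^+ 2)).
Proof.
pose ct := wsum (fun x => c x * (2^-1 * quad x)) z h.
pose dt := wsum (fun x => d x * (2^-1 * quad x)) z h.
pose c1 k h := wsum (fun x => c x * lin (b k) x) z h.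
pose d1 k h := wsum (fun x => d x * lin (b k) x) z h.
pose c2 k := wsum (fun x => c x * lin (b k) x * lin (b k) x) z h.
pose d2 k := wsum (fun x => d x * lin (b k) x * lin (b k) x) z h.
exists (dt * phi (a z h) + phi1 (a z h) * (ct - a z h * dt)).
exists (fun k s => d1 k (h + s *: b k) * phi (a z (h + s *: b k)) +
  phi1 (a z (h + s *: b k)) *
    (c1 k (h + s *: b k) - a z (h + s *: b k) * d1 k (h + s *: b k))).
exists (fun k => d2 k * phi (a z h) + phi1 (a z h) * (c2 k - a z h * d2 k) +
  wsum d z h * phi2 (a z h) * slope z h k ^+ 2).
have da z' h' : a z' h' * wsum d z' h' = wsum c z' h' by rewrite /a divfK.
have dline k s : is_derive (s : R) 1 (fun s : R => a z (h + s *: b k))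
    ((c1 k (h + s *: b k) - a z (h + s *: b k) * d1 k (h + s *: b k)) /
     wsum d z (h + s *: b k)).
  apply: der_eq (derM (der_wsum_line c z h (b k) s)
    (derV (der_wsum_line d z h (b k) s) (d0 _ _))) _.
  by rewrite /a /c1 /d1; field.
split.
- have dq := derM (der_wsum_time c z h) (derV (der_wsum_time d z h) (d0 _ _)).
  apply: der_eq (derM (der_wsum_time d z h) (@der_comp R phi (fun z => a z h) z _ _ (phiP z h) dq)) _.
  by rewrite -/ct -/dt /a; field.
- move=> k s; apply: der_eq (derM (der_wsum_line d z h (b k) s)
    (@der_comp R phi (fun s => a z (h + s *: b k)) s _ _ (phiP z (h + s *: b k)) (dline k s))) _.
  by rewrite -/(a _ _) -/(d1 _ _) -/(c1 _ _); field.
- move=> k.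
  have e0 (N : 'rV[R]_n -> R) : N (h + 0 *: b k) = N h by rewrite scale0r addr0.
  have := derD (derM (der_wsum_line (fun x => d x * lin (b k) x) z h (b k) 0)
      (@der_comp R phi (fun s => a z (h + s *: b k)) 0 _ _ (phiP z (h + 0 *: b k)) (dline k 0)))
    (derM (@der_comp R phi1 (fun s => a z (h + s *: b k)) 0 _ _ (phi1P z (h + 0 *: b k)) (dline k 0))
      (derB (der_wsum_line (fun x => c x * lin (b k) x) z h (b k) 0)
        (derM (dline k 0) (der_wsum_line (fun x => d x * lin (b k) x) z h (b k) 0)))).
  move=> hd; apply: der_eq hd _; rewrite scale0r addr0 -/(a _ _) -/(d1 _ _) -/(c1 _ _) -/(d2 _) -/(c2 _).
  by rewrite /slope -/(d1 _ _) -/(c1 _ _); field.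
rewrite big_split/= -mulr_sumr big_split/= -mulr_suml -mulr_sumr sumrB -mulr_sumr.
rewrite {1}/ct {1}/dt /ct /dt !heat_balance -/c2 -/d2.
by field.
Qed.

End perspective.

End gibbs_sums.

(** * Isolating one spin *)
Section joint_continuity.
Variables (R : realType) (T : topologicalType).
Implicit Types (f g : T -> R).

Lemma continuous_bigsum (I : Type) (s : seq I) (P : pred I) (F : I -> T -> R) :
  (forall i, continuous (F i)) -> continuous (fun p => \sum_(i <- s | P i) F i p).
Proof.
move=> cF; elim: s => [|i s ih].
  rewrite (_ : (fun p => _) = (fun=> 0)); first by move=> p; exact: cvg_cst.
  by apply/funext => p; rewrite big_nil.
rewrite (_ : (fun p => _) = (fun p => (if P i then F i p else 0) +
  \sum_(i <- s | P i) F i p)); last first.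
  by apply/funext => p; rewrite big_cons; case: ifP => // _; rewrite add0r.
move=> p; apply: cvgD; last exact: ih.
by case: ifP => _; [exact: cF|exact: cvg_cst].
Qed.

Lemma continuousMM f g : continuous f -> continuous g ->
  continuous (fun p => f p * g p).
Proof. by move=> cf cg p; apply: cvgM; [exact: cf|exact: cg]. Qed.

Lemma continuousDD f g : continuous f -> continuous g ->
  continuous (fun p => f p + g p).
Proof. by move=> cf cg p; apply: cvgD; [exact: cf|exact: cg]. Qed.

Lemma continuousBB f g : continuous f -> continuous g ->
  continuous (fun p => f p - g p).
Proof. by move=> cf cg p; apply: cvgB; [exact: cf|exact: cg]. Qed.

Lemma continuous_expR_comp f : continuous f -> continuous (fun p => expR (f p)).
Proof.
move=> cf p; apply: (@continuous_comp _ _ _ f expR); first exact: cf.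
exact: continuous_expR.
Qed.

End joint_continuity.

Section resolved_coordinate.
Variables (R : realType) (n m : nat) (b : 'I_m -> 'rV[R]_n).
Local Notation config := {ffun 'I_n -> bool}.
Implicit Types (u v h : 'rV[R]_n) (x y : config) (z : R) (c d : config -> R).
Implicit Types (i : 'I_n).

Definition flip i x : config := [ffun j => if j == i then ~~ x j else x j].

Lemma flipK i : involutive (flip i).
Proof.
by move=> x; apply/ffunP => j; rewrite !ffunE; case: eqP => // _; rewrite negbK.
Qed.

Lemma spin_flip i x : spin R (flip i x i) = - spin R (x i).
Proof. by rewrite ffunE eqxx; case: (x i); rewrite /spin/= ?opprK. Qed.

Lemma spin_sqr (s : bool) : spin R s * spin R s = 1.
Proof. by case: s; rewrite /spin ?mulr1// mulrNN mulr1. Qed.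

Definition off i u x : R := \sum_(j | j != i) u 0 j * spin R (x j).

Lemma lin_off i u x : lin u x = u 0 i * spin R (x i) + off i u x.
Proof. by rewrite /lin (bigD1 i). Qed.

Lemma off_flip i u x : off i u (flip i x) = off i u x.
Proof. by apply: eq_bigr => j /negbTE ji; rewrite ffunE ji. Qed.

Lemma sum_flip i (F : config -> R) : \sum_x F x = \sum_x (F x + F (flip i x)) / 2.
Proof.
rewrite -mulr_suml big_split/=.
rewrite [X in (_ + X) / 2](_ : _ = \sum_x F x); first by field.
by rewrite [RHS](reindex_inj (inv_inj (flipK i))).
Qed.

(** Per unit of time, the field exerted on the spin [i] by the others. *)
Definition cavity_field i x : R := \sum_k b k 0 i * off i (b k) x.

(** The part of the weight that does not involve the spin [i]. *)
Definition cavity_weight i x z h : R :=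
  expR (z / 2 * (\sum_k off i (b k) x ^+ 2) + off i h x).

(** The [i]th diagonal entry of the interaction. *)
Definition self_coupling i : R := \sum_k b k 0 i ^+ 2.

Lemma gibbs_cavity i x z h : gibbs b z h x = cavity_weight i x z h *
  expR (z * self_coupling i / 2) *
  expR (spin R (x i) * (h 0 i + cavity_field i x * z)).
Proof.
rewrite /gibbs /cavity_weight -!expRD; congr expR.
rewrite (lin_off i h) /quad.
have -> : \sum_k lin (b k) x ^+ 2 = \sum_k off i (b k) x ^+ 2 +
    2 * spin R (x i) * cavity_field i x + self_coupling i.
  rewrite /cavity_field /self_coupling mulr_sumr -!big_split/=.
  apply: eq_bigr => k _; rewrite (lin_off i).
  transitivity (off i (b k) x ^+ 2 + 2 * spin R (x i) * (b k 0 i * off i (b k) x) +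
    b k 0 i ^+ 2 * (spin R (x i) * spin R (x i))); first by ring.
  by rewrite spin_sqr mulr1.
by field.
Qed.

Lemma cavity_field_flip i x : cavity_field i (flip i x) = cavity_field i x.
Proof. by apply: eq_bigr => k _; rewrite off_flip. Qed.

Lemma cavity_weight_flip i x z h :
  cavity_weight i (flip i x) z h = cavity_weight i x z h.
Proof.
have e : \sum_k off i (b k) (flip i x) ^+ 2 = \sum_k off i (b k) x ^+ 2.
  by apply: eq_bigr => k _; rewrite (off_flip i (b k)).
by rewrite /cavity_weight e (off_flip i h).
Qed.

Lemma cosh_spin (s : bool) (t : R) :
  (expR (spin R s * t) + expR (- spin R s * t)) / 2 = cosh t.
Proof. by case: s; rewrite /spin/cosh ?opprK ?mul1r mulN1r// addrC. Qed.

Lemma part_cavity i z h : part b z h = expR (z * self_coupling i / 2) *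
  \sum_x cavity_weight i x z h * cosh (h 0 i + cavity_field i x * z).
Proof.
rewrite /part /wsum (sum_flip i) mulr_sumr; apply: eq_bigr => x _.
rewrite !mul1r !(gibbs_cavity i) cavity_weight_flip cavity_field_flip spin_flip.
rewrite -(cosh_spin (x i)).
move: (cavity_weight _ _ _ _) (expR (spin R (x i) * _)) (expR (- spin R (x i) * _)).
by move: (expR _) => r w p q; ring.
Qed.

(** An explicit solution of the heat equation.  Summed over [x] and divided by
    [part], it starts at the variance of the spin [i] under a product measure, and
    is the expected variance of that spin once the whole interaction has been
    traded for a random field. *)
Definition cavity i x z h : R :=
  cavity_weight i x z h * psi (self_coupling i * z) (h 0 i + cavity_field i x * z).

Lemma off_line i h u (s : R) x : off i (h + s *: u) x = off i h x + s * off i u x.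
Proof.
rewrite /off mulr_sumr -big_split/=; apply: eq_bigr => j _.
by rewrite !mxE mulrDl mulrA.
Qed.

(** The exponential factor and [psi] solve heat equations separately; the cross
    terms cancel because the field inside [psi] drifts at the speed
    [cavity_field i x]. *)
Lemma heat_cavity i x z h : 0 < z -> 0 < self_coupling i ->
  heat_defect b (cavity i x) z h 0.
Proof.
move=> z0 e0; set e := self_coupling i; set q := cavity_field i x.
pose w := \sum_k off i (b k) x ^+ 2.
pose P (f : R -> R -> R) h := f (e * z) (h 0 i + q * z).
pose W h := cavity_weight i x z h.
have dtime : is_derive z 1 (fun z => psi (e * z) (h 0 i + q * z))
    (e * (P (@ddpsi R) h / 2) + q * P (@dpsi R) h).
  have ee : e != 0 by exact: lt0r_neq0.
  (* The time of [psi] is [e * z], whence the slope [q / e]. *)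
  have dp := der_psi_path (h 0 i) (q / e) (mulr_gt0 e0 z0).
  have de := derMl e (der_id z).
  have := @der_comp R (fun s => psi s (h 0 i + q / e * s)) (fun z => e * z) z _ _ dp de.
  have eq t : q / e * (e * t) = q * t by field.
  move=> hd; apply: der_ext (der_eq hd _) => [t|]; rewrite eq//.
  by rewrite /P; field.
have dW (s : R) k : is_derive s 1 (fun s : R => W (h + s *: b k))
    (off i (b k) x * W (h + s *: b k)).
  apply: (@der_ext _ (fun s => expR (z / 2 * w + (off i h x + s * off i (b k) x)))).
    by move=> t; rewrite /W /cavity_weight off_line.
  apply: der_eq (der_exp (derD (der_cst (z / 2 * w) s)
    (derD (der_cst (off i h x) s) (derM (der_id s) (der_cst (off i (b k) x) s))))) _.
  by rewrite /W /cavity_weight off_line -/w; ring.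
have dP (f g : R -> R -> R) (s : R) k : (forall s t : R, is_derive t 1 (f s) (g s t)) ->
    is_derive s 1 (fun s : R => P f (h + s *: b k)) (b k 0 i * P g (h + s *: b k)).
  move=> fg.
  apply: (@der_ext _ (fun s => f (e * z) (h 0 i + s * b k 0 i + q * z))).
    by move=> t; rewrite /P !mxE.
  apply: der_eq (der_comp (fg (e * z) _) (derD (derD (der_cst (h 0 i) s)
    (derM (der_id s) (der_cst (b k 0 i) s))) (der_cst (q * z) s))) _.
  by rewrite /P !mxE; ring.
exists (W h * (2^-1 * w * P (@psi R) h + (e * (P (@ddpsi R) h / 2) + q * P (@dpsi R) h))).
exists (fun k s => W (h + s *: b k) * (off i (b k) x * P (@psi R) (h + s *: b k) +
  b k 0 i * P (@dpsi R) (h + s *: b k))).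
exists (fun k => W h * (off i (b k) x ^+ 2 * P (@psi R) h +
  2 * (b k 0 i * off i (b k) x) * P (@dpsi R) h + b k 0 i ^+ 2 * P (@ddpsi R) h)).
split.
- apply: der_eq (derM (der_exp (derD (derM (derM (der_id z) (der_cst 2^-1 z))
    (der_cst w z)) (der_cst (off i h x) z))) dtime) _.
  by rewrite /W /cavity_weight -/w /P; ring.
- move=> k s; apply: der_eq (derM (dW s k) (dP _ _ s k (@der_psi R))) _.
  by ring.
- move=> k; apply: der_eq (derM (dW 0 k) (derD
    (derMl (off i (b k) x) (dP _ _ 0 k (@der_psi R)))
    (derMl (b k 0 i) (dP _ _ 0 k (@der_dpsi R))))) _.
  by rewrite scale0r addr0; ring.
rewrite -mulr_sumr !big_split/= -!mulr_suml -mulr_sumr -/w -/(self_coupling i) -/e.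
by rewrite -/(cavity_field i x) -/q; field.
Qed.

Definition cavity_sum i z h := \sum_x cavity i x z h.

Lemma heat_cavity_sum i z h : 0 < z -> 0 < self_coupling i ->
  heat_defect b (cavity_sum i) z h 0.
Proof.
move=> z0 e0; apply: heat_eq (heat_sum (fun x => heat_cavity x h z0 e0)) _.
by rewrite big1.
Qed.

Lemma cavity_sum0 i h : cavity_sum i 0 h = part b 0 h * sech (h 0 i) ^+ 2.
Proof.
rewrite (part_cavity i) !mul0r expR0 mul1r mulr_suml; apply: eq_bigr => x _.
rewrite /cavity !mulr0 addr0 psi0 -mulrA; congr (_ * _).
by rewrite /sech; have := cosh_neq0 (h 0 i); move: (cosh _) => t t0; field.
Qed.

(** Among all fields on the spin [i], the zero field gives the largest expected
    variance; this is where [rfun] comes in. *)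
Lemma cavity_sum_le i z h : 0 <= z ->
  cavity_sum i z h <= rfun (self_coupling i * z) * part b z h.
Proof.
move=> z0; have e0 : 0 <= self_coupling i by apply: sumr_ge0 => k _; exact: sqr_ge0.
rewrite (part_cavity i) rfun_psi ?mulr_ge0// mulrACA -expRD.
rewrite [X in expR X](_ : _ = 0); last by field.
rewrite expR0 mul1r mulr_sumr; apply: ler_sum => x _.
rewrite /cavity mulrCA ler_wpM2l ?expR_ge0//.
by rewrite [leRHS]mulrC; exact: psi_le.
Qed.

Lemma continuous_coord i : continuous (fun p : R * 'rV[R]_n => p.2 0 i).
Proof.
move=> p; apply: (@continuous_comp _ _ _ (fun p : R * 'rV[R]_n => p.2)
  (fun h : 'rV[R]_n => h 0 i)); first exact: cvg_snd.
exact: coord_continuous.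
Qed.

Lemma continuous_time : continuous (fun p : R * 'rV[R]_n => p.1).
Proof. by move=> p; exact: cvg_fst. Qed.

Lemma continuous_const (T : topologicalType) (r : R) : continuous (fun _ : T => r).
Proof. by move=> p; exact: cvg_cst. Qed.

Lemma continuous_wsum c : continuous (fun p : R * 'rV[R]_n => wsum b c p.1 p.2).
Proof.
apply: continuous_bigsum => x; apply: continuousMM; first exact: continuous_const.
apply: continuous_expR_comp; apply: continuousDD.
  apply: continuousMM; last exact: continuous_const.
  by apply: continuousMM; [exact: continuous_time|exact: continuous_const].
apply: continuous_bigsum => i; apply: continuousMM; last exact: continuous_const.
exact: continuous_coord.
Qed.

Lemma continuous_cavity_sum i :
  continuous (fun p : R * 'rV[R]_n => cavity_sum i p.1 p.2).
Proof.
apply: continuous_bigsum => x; apply: continuousMM.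
  apply: continuous_expR_comp; apply: continuousDD.
    apply: continuousMM; last exact: continuous_const.
    by apply: continuousMM; [exact: continuous_time|exact: continuous_const].
  apply: continuous_bigsum => j.
  by apply: continuousMM; [exact: continuous_coord|exact: continuous_const].
move=> p.
apply: (@continuous_comp _ _ _
  (fun p : R * 'rV[R]_n => (self_coupling i * p.1, p.2 0 i + cavity_field i x * p.1))
  (fun s : R * R => psi s.1 s.2)); last exact: psi_continuous.
have c1 := continuousMM (@continuous_const _ (self_coupling i)) continuous_time.
have c2 := continuousDD (@continuous_coord i)
  (continuousMM (@continuous_const _ (cavity_field i x)) continuous_time).
exact: (cvg_pair (c1 p) (c2 p)).
Qed.

End resolved_coordinate.

(** * Covariances along the flow *)
Section covariance_bound.
Variables (R : realType) (n m : nat) (b : 'I_m -> 'rV[R]_n).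
Local Notation config := {ffun 'I_n -> bool}.
Implicit Types (u v w h : 'rV[R]_n) (x y : config) (z : R) (c d : config -> R).

Lemma heat_parabolic_scaling (N : R -> 'rV[R]_n -> R) (r : R) z h (d : R) :
  heat_defect b N (r ^+ 2 * z) (r *: h) d ->
  heat_defect b (fun z h => N (r ^+ 2 * z) (r *: h)) z h (r ^+ 2 * d).
Proof.
move=> [dz [N1 [N2 [hz h1 h2 ->]]]].
exists (r ^+ 2 * dz), (fun k s => r * N1 k (r * s)), (fun k => r ^+ 2 * N2 k).
have line k (s : R) : r *: (h + s *: b k) = r *: h + (r * s) *: b k.
  by rewrite scalerDr scalerA.
split.
- apply: der_eq (@der_comp R (fun z => N z (r *: h)) (fun z => r ^+ 2 * z) z _ _ hz
    (derMl (r ^+ 2) (der_id z))) _.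
  by rewrite mulr1 mulrC.
- move=> k s.
  have hd : is_derive s 1 (fun t : R => N (r ^+ 2 * z) (r *: h + (r * t) *: b k))
      (r * N1 k (r * s)).
    apply: der_eq (@der_comp R (fun s => N (r ^+ 2 * z) (r *: h + s *: b k))
      (fun s => r * s) s _ _ (h1 k _) (derMl r (der_id s))) _.
    by rewrite mulr1 mulrC.
  have e : (fun t : R => N (r ^+ 2 * z) (r *: h + (r * t) *: b k)) =
      (fun t : R => N (r ^+ 2 * z) (r *: (h + t *: b k))).
    by apply/funext => t; rewrite line.
  by rewrite e in hd.
- move=> k; have h2' : is_derive (r * 0 : R) 1 (N1 k) (N2 k) by rewrite mulr0.
  apply: der_eq (derMl r (@der_comp R (N1 k) (fun s => r * s) 0 _ _ h2'
    (derMl r (der_id 0)))) _.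
  by rewrite mulr1; ring.
- by rewrite -mulr_sumr; ring.
Qed.

Lemma quad_ge0 x : 0 <= quad b x.
Proof. by apply: sumr_ge0 => k _; exact: sqr_ge0. Qed.

Lemma gibbs_sqr_le z h x : 0 <= z ->
  gibbs b z h x ^+ 2 <= gibbs b (2 ^+ 2 * z) (2 *: h) x.
Proof.
move=> z0; rewrite expr2 -expRD ler_expR linZ.
have := mulr_ge0 z0 (quad_ge0 x); lra.
Qed.

(** Choosing the signs of [h], one weight is at least [exp (sum_i |h_i|)]. *)
Lemma part_ge_coord z h i : 0 <= z -> `|h 0 i| <= part b z h.
Proof.
move=> z0; pose x : config := [ffun j => 0 <= h 0 j].
have lx : lin h x = \sum_j `|h 0 j|.
  apply: eq_bigr => j _; rewrite ffunE /spin; case: ifP => [h0|/negbT].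
    by rewrite mulr1 ger0_norm.
  by rewrite -ltNge => h0; rewrite mulrN1 ltr0_norm.
have : gibbs b z h x <= part b z h.
  rewrite /part /wsum (bigD1 x)//= mul1r lerDl.
  by apply: sumr_ge0 => y _; rewrite mul1r ltW// gibbs_gt0.
apply: le_trans; apply: le_trans (expR_ge1Dx _).
rewrite lx (bigD1 i)//=.
have s0 : 0 <= \sum_(j | j != i) `|h 0 j| by apply: sumr_ge0.
by have := mulr_ge0 z0 (quad_ge0 x); lra.
Qed.

(** The barrier is [part] itself at parabolic scale 2.  It dominates the sum of
    the squared weights, hence any multiple of [part] wherever [part] is large. *)
Lemma gibbs_max_principle (N : R -> 'rV[R]_n -> R) (tau C : R) :
  (forall z h, 0 <= z <= tau ->
    {for (z, h), continuous (fun p : R * 'rV[R]_n => N p.1 p.2)}) ->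
  (forall z h, 0 < z <= tau -> exists2 d, heat_defect b N z h d & d <= 0) ->
  (forall h, N 0 h <= 0) ->
  (forall z h, 0 <= z <= tau -> N z h <= C * part b z h) ->
  forall z h, 0 <= z <= tau -> N z h <= 0.
Proof.
move=> cN dN N0 NC.
pose W z h := part b (2 ^+ 2 * z) (2 *: h).
apply: (@heat_max_principle _ _ _ b N W tau cN dN N0).
- move=> p.
  apply: (@continuous_comp _ _ _
    (fun p : R * 'rV[R]_n => (2 ^+ 2 * p.1, 2 *: p.2))
    (fun p : R * 'rV[R]_n => part b p.1 p.2)); last exact: continuous_wsum.
  have c1 := continuousMM (@continuous_const _ _ (2 ^+ 2)) (@continuous_time R n).
  have c2 : continuous (fun p : R * 'rV[R]_n => 2 *: p.2).
    by move=> r; apply: cvgZr; exact: cvg_snd.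
  exact: (cvg_pair (c1 p) (c2 p)).
- move=> z h; apply: heat_eq (heat_parabolic_scaling (heat_wsum _ _ _ _)) _.
  by rewrite mulr0.
- by move=> z h; exact/ltW/part_gt0.
move=> e e0; exists (#|{: config}|%:R * C ^+ 2 / e ^+ 2) => z h zt.
rewrite negb_forall => /existsP[i]; rewrite -ltNge => hi.
have [z0 zt'] := andP zt.
apply: le_trans (NC z h zt) _.
have sq : \sum_x gibbs b z h x ^+ 2 <= W z h.
  by apply: ler_sum => x _; rewrite mul1r gibbs_sqr_le.
have Wi : #|{: config}|%:R * C ^+ 2 / e ^+ 2 <= W z h.
  apply: le_trans (ltW hi) _; have z40 : 0 <= 2 ^+ 2 * z by rewrite mulr_ge0.
  apply: le_trans (part_ge_coord (2 *: h) i z40); rewrite mxE normrM.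
  by rewrite ger0_norm// ler_peMl// ler1n.
(* For each weight [g], [C * g <= e / 2 * g ^+ 2 + C ^+ 2 / (2 * e)]. *)
have step : C * part b z h <= e / 2 * (\sum_x gibbs b z h x ^+ 2) +
    #|{: config}|%:R * (C ^+ 2 / (2 * e)).
  have -> : #|{: config}|%:R * (C ^+ 2 / (2 * e)) =
      \sum_(x : config) (C ^+ 2 / (2 * e)) by rewrite sumr_const mulr_natl.
  rewrite /part /wsum !mulr_sumr -big_split/=; apply: ler_sum => x _.
  rewrite mul1r; set g := gibbs _ _ _ _; rewrite -subr_ge0.
  rewrite (_ : _ - _ = (e * g - C) ^+ 2 / (2 * e)).
    by rewrite divr_ge0 ?sqr_ge0// mulr_ge0// ltW.
  by field; exact: lt0r_neq0.
apply: le_trans step _.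
have -> : #|{: config}|%:R * (C ^+ 2 / (2 * e)) =
    e / 2 * (#|{: config}|%:R * C ^+ 2 / e ^+ 2) by field; exact: lt0r_neq0.
have e20 : 0 <= e / 2 by rewrite divr_ge0// ltW.
have := ler_wpM2l e20 sq; have := ler_wpM2l e20 Wi; lra.
Qed.

Definition ex c z h : R := wsum b c z h / part b z h.

Lemma exD c d z h : ex (fun x => c x + d x) z h = ex c z h + ex d z h.
Proof. by rewrite /ex wsumD mulrDl. Qed.

Lemma exZ r c z h : ex (fun x => r * c x) z h = r * ex c z h.
Proof. by rewrite /ex wsumZ mulrA. Qed.

Lemma ex_sum (I : finType) (c : I -> config -> R) z h :
  ex (fun x => \sum_i c i x) z h = \sum_i ex (c i) z h.
Proof. by rewrite /ex wsum_sum mulr_suml. Qed.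

Lemma eq_ex c d z h : c =1 d -> ex c z h = ex d z h.
Proof. by move=> cd; rewrite /ex (eq_wsum _ _ _ cd). Qed.

Lemma ex1 z h : ex (fun=> 1) z h = 1.
Proof. by rewrite /ex divff// part_neq0. Qed.

Lemma ex_cst r z h : ex (fun=> r) z h = r.
Proof. by rewrite -[RHS]mulr1 -(ex1 z h) -exZ; apply: eq_ex => x; rewrite mulr1. Qed.

Lemma le_ex c d z h : (forall x, c x <= d x) -> ex c z h <= ex d z h.
Proof.
move=> cd; apply: ler_wpM2r; first by rewrite invr_ge0 ltW ?part_gt0.
by rewrite /wsum; apply: ler_sum => x _; rewrite ler_wpM2r// ltW// gibbs_gt0.
Qed.

Lemma ex_ge0 c z h : (forall x, 0 <= c x) -> 0 <= ex c z h.
Proof. by move=> c0; rewrite -(ex_cst 0 z h); exact: le_ex. Qed.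

Definition cova z h u v : R :=
  ex (fun x => lin u x * lin v x) z h - ex (lin u) z h * ex (lin v) z h.

Definition dot u v : R := \sum_i u 0 i * v 0 i.

Lemma linD u v x : lin (u + v) x = lin u x + lin v x.
Proof. by rewrite -{1}[v]scale1r lin_line mul1r. Qed.

Lemma covaC z h u v : cova z h u v = cova z h v u.
Proof.
rewrite /cova [ex (lin v) z h * _]mulrC.
by rewrite (@eq_ex (fun x => lin v x * lin u x) (fun x => lin u x * lin v x)) => // x; rewrite mulrC.
Qed.

Lemma covaDl z h u v w : cova z h (u + v) w = cova z h u w + cova z h v w.
Proof.
rewrite /cova (@eq_ex _ (fun x => lin u x * lin w x + lin v x * lin w x)).
  by rewrite exD (@eq_ex (lin (u + v)) _ _ _ (linD u v)) exD; ring.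
by move=> x; rewrite linD mulrDl.
Qed.

Lemma covaZl z h r u w : cova z h (r *: u) w = r * cova z h u w.
Proof.
rewrite /cova (@eq_ex _ (fun x => r * (lin u x * lin w x))).
  by rewrite exZ (@eq_ex (lin (r *: u)) _ _ _ (linZ r u)) exZ; ring.
by move=> x; rewrite linZ mulrA.
Qed.

Lemma ex_var c z h : ex (fun x => (c x - ex c z h) ^+ 2) z h =
  ex (fun x => c x * c x) z h - ex c z h * ex c z h.
Proof.
set a := ex c z h.
rewrite (@eq_ex _ (fun x => c x * c x + (- (2 * a) * c x + a ^+ 2))).
  by rewrite !exD exZ ex_cst -/a; ring.
by move=> x; ring.
Qed.

Lemma cova_ge0 z h u : 0 <= cova z h u u.
Proof. by rewrite /cova -ex_var; apply: ex_ge0 => x; exact: sqr_ge0. Qed.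

Lemma discriminant_le (A B C : R) : 0 <= A ->
  (forall t, 0 <= A * t ^+ 2 + 2 * B * t + C) -> B ^+ 2 <= A * C.
Proof.
rewrite le_eqVlt => /predU1P[<-|A0] pos.
  have [->|B0] := eqVneq B 0; first by rewrite mul0r expr0n.
  have := pos (- (C + 1) / (2 * B)); rewrite mul0r add0r.
  rewrite (_ : 2 * B * _ + C = - 1); last by field.
  by rewrite lerNr oppr0 leNgt ltr01.
have := pos (- B / A).
rewrite (_ : _ + C = (A * C - B ^+ 2) / A); last by field; exact: lt0r_neq0.
by rewrite pmulr_lge0 ?invr_gt0// subr_ge0.
Qed.

Lemma cova_cauchy_schwarz z h u v :
  cova z h u v ^+ 2 <= cova z h u u * cova z h v v.
Proof.
apply: discriminant_le (cova_ge0 _ _ _) _ => t.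
have := cova_ge0 z h (t *: u + v).
rewrite covaDl covaZl !(covaC _ _ _ (_ + _)) !covaDl !covaZl (covaC _ _ v u).
by rewrite (_ : t * _ + _ = cova z h u u * t ^+ 2 + 2 * cova z h u v * t +
  cova z h v v); last ring.
Qed.

(** The image of [v] under the covariance matrix. *)
Definition cova_row z h v : 'rV[R]_n := \row_i cova z h v (delta_mx 0 i).

Lemma lin_delta i x : lin (delta_mx 0 i : 'rV[R]_n) x = spin R (x i).
Proof.
rewrite /lin (bigD1 i)//= mxE !eqxx mul1r big1 ?addr0// => j ji.
by rewrite mxE (negbTE ji) andbF mul0r.
Qed.

Lemma cova_dot z h v u : cova z h v u = dot u (cova_row z h v).
Proof.
have -> : dot u (cova_row z h v) = \sum_i cova z h v (u 0 i *: delta_mx 0 i).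
  by apply: eq_bigr => i _; rewrite mxE [RHS]covaC covaZl covaC.
rewrite {1}(row_sum_delta u) covaC.
elim/big_rec2: _ => [|i y1 y2 _ ih].
  by rewrite -(scale0r 0) covaZl mul0r.
by rewrite covaDl ih [X in X + _]covaC.
Qed.

Lemma dot_ge0 u : 0 <= dot u u.
Proof. by apply: sumr_ge0 => i _; rewrite -expr2 sqr_ge0. Qed.

(** Cauchy--Schwarz between [v] and its image. *)
Lemma cova_row_norm z h v (K : R) : 0 <= K ->
  (forall u, cova z h u u <= K * dot u u) ->
  dot (cova_row z h v) (cova_row z h v) <= K ^+ 2 * dot v v.
Proof.
move=> K0 hK; set w := cova_row z h v.
have [->|w0] := eqVneq (dot w w) 0; first by rewrite mulr_ge0 ?dot_ge0 ?exprn_ge0.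
have wp : 0 < dot w w by rewrite lt_neqAle eq_sym w0 dot_ge0.
have := cova_cauchy_schwarz z h v w; rewrite (cova_dot z h v w) -/w => cs.
rewrite -(ler_pM2r wp) -expr2; apply: le_trans cs _.
rewrite expr2 (_ : K * K * _ * _ = (K * dot v v) * (K * dot w w)); last by ring.
by apply: ler_pM; rewrite ?cova_ge0.
Qed.

Hypothesis b_le1 : forall u, \sum_k dot (b k) u ^+ 2 <= dot u u.

Lemma slope_le z h v (K : R) : 0 <= K ->
  (forall u, cova z h u u <= K * dot u u) ->
  \sum_k cova z h v (b k) ^+ 2 <= K ^+ 2 * dot v v.
Proof.
move=> K0 hK; apply: le_trans (cova_row_norm v K0 hK).
by apply: le_trans (b_le1 _); apply: ler_sum => k _; rewrite cova_dot.
Qed.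

Definition var_part v z h : R := part b z h * cova z h v v.

Lemma var_partE v z h : var_part v z h = wsum b (fun x => lin v x * lin v x) z h -
  part b z h * (wsum b (lin v) z h / part b z h) ^+ 2.
Proof.
rewrite /var_part /cova /ex; have := part_neq0 b z h.
by move: (part _ _ _) => p p0; field.
Qed.

(** A variance grows, along the flow, by the squared covariances with the
    directions [b k]. *)
Lemma heat_var_part v z h : heat_defect b (var_part v) z h
  (part b z h * \sum_k cova z h v (b k) ^+ 2).
Proof.
apply: (@heat_ext _ _ _ b (fun z h => wsum b (fun x => lin v x * lin v x) z h -
  part b z h * (wsum b (lin v) z h / part b z h * (wsum b (lin v) z h / part b z h)))).
  by move=> t u; rewrite var_partE expr2.
have d2 (t : R) : is_derive t 1 (fun t : R => t * t) (2 * t).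
  by apply: der_eq (derM (der_id t) (der_id t)) _; ring.
have d1 (t : R) : is_derive t 1 (fun t : R => 2 * t) 2.
  by apply: der_eq (derMl 2 (der_id t)) _; ring.
apply: heat_eq (heatB (heat_wsum b _ z h)
  (@heat_persp _ _ _ b (fun t => t * t) (fun t => 2 * t) (fun=> 2) (lin v) (fun=> 1)
    (fun t u => d2 _) (fun t u => d1 _) (part_neq0 b) z h)) _.
rewrite sub0r opprK -/(part b z h) [2^-1 * _]mulrC divfK//.
congr (_ * _); apply: eq_bigr => k _; congr (_ ^+ 2).
rewrite /slope /cova /ex -/(part b z h).
rewrite (@eq_wsum _ _ _ b (fun x => 1 * lin (b k) x) (lin (b k)))//; last first.
  by move=> x; rewrite mul1r.
by have := part_neq0 b z h; move: (part _ _ _) => p p0; field.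
Qed.

Lemma sum_sqr_le (a : 'I_n -> R) : (\sum_i a i) ^+ 2 <= n%:R * \sum_i a i ^+ 2.
Proof.
have -> : n%:R * (\sum_i a i ^+ 2) = \sum_(i < n) \sum_(j < n) (a i ^+ 2 + a j ^+ 2) / 2.
  set S := \sum_i a i ^+ 2.
  have inner i : \sum_(j < n) (a i ^+ 2 + a j ^+ 2) / 2 = (n%:R * a i ^+ 2 + S) / 2.
    by rewrite -mulr_suml big_split/= sumr_const card_ord mulr_natl.
  rewrite (eq_bigr _ (fun i _ => inner i)) -mulr_suml big_split/= sumr_const card_ord.
  by rewrite -mulr_sumr -/S -[S *+ n]mulr_natl; field.
rewrite expr2 mulr_suml; apply: ler_sum => i _; rewrite mulr_sumr; apply: ler_sum => j _.
have := sqr_ge0 (a i - a j); lra.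
Qed.

Lemma cova_crude z h v : cova z h v v <= n%:R * dot v v.
Proof.
apply: (@le_trans _ _ (ex (fun x => lin v x * lin v x) z h)).
  by rewrite lerBlDr lerDl -expr2 sqr_ge0.
rewrite -[leRHS](ex_cst _ z h); apply: le_ex => x; rewrite -expr2.
have -> : dot v v = \sum_i (v 0 i * spin R (x i)) ^+ 2.
  apply: eq_bigr => i _; rewrite -[LHS]mulr1 -(spin_sqr R (x i)); ring.
exact: (sum_sqr_le (fun i => v 0 i * spin R (x i))).
Qed.

End covariance_bound.

(** * The Volterra bound on the covariance *)
Section volterra_covariance.
Variables (R : realType) (n m : nat) (b : 'I_m -> 'rV[R]_n).
Local Notation config := {ffun 'I_n -> bool}.
Implicit Types (u v w h : 'rV[R]_n) (x y : config) (z M : R).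

Variables (eta : R) (Q k : R -> R).
Hypothesis eta_gt0 : 0 < eta.
Hypothesis b_le1 : forall u, \sum_j dot (b j) u ^+ 2 <= dot u u.
Hypothesis self_eta : forall i, self_coupling b i = eta.
Hypothesis Q_ge0 : forall z, 0 <= z -> 0 <= Q z.
Hypothesis k_ge0 : forall z, 0 <= z -> 0 <= k z.
Hypothesis kP : forall z, 0 <= z -> is_derive z 1 k (Q z ^+ 2).
Hypothesis Q_super : forall z, 0 <= z -> Num.min n%:R (rfun (eta * z) + k z) <= Q z.

Let final_part v z h := \sum_i v 0 i ^+ 2 * cavity_sum b i z h.

Lemma psi_ge0 (s t : R) : 0 <= psi s t.
Proof.
by apply: Rintegral_ge0 => x _; rewrite divr_ge0// addr_ge0// ltW// sech_gt0.
Qed.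

Lemma final_part_ge0 v z h : 0 <= final_part v z h.
Proof.
apply: sumr_ge0 => i _; rewrite mulr_ge0 ?sqr_ge0//; apply: sumr_ge0 => x _.
by rewrite mulr_ge0 ?expR_ge0// psi_ge0.
Qed.

Lemma final_part_le v z h : 0 <= z ->
  final_part v z h <= rfun (eta * z) * dot v v * part b z h.
Proof.
move=> z0; rewrite /dot mulr_sumr mulr_suml; apply: ler_sum => i _.
rewrite (_ : _ * (v 0 i * v 0 i) * _ = v 0 i ^+ 2 * (rfun (eta * z) * part b z h)).
  by rewrite ler_wpM2l ?sqr_ge0// -(self_eta i) cavity_sum_le.
by ring.
Qed.

(** Without interaction, a spin is independent of the others. *)
Lemma ex_spin_tanh c h i : (forall x, c (flip i x) = c x) ->
  ex b (fun x => spin R (x i) * c x) 0 h = tanh (h 0 i) * ex b c 0 h.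
Proof.
move=> ci; rewrite /ex mulrA; congr (_ / _).
rewrite /wsum (sum_flip i) [in RHS](sum_flip i) mulr_sumr; apply: eq_bigr => x _.
rewrite !(gibbs_cavity b i) !ci !spin_flip cavity_weight_flip cavity_field_flip.
rewrite !mul0r expR0 !mulr1 mulr0 addr0 tanhE.
have ch := cosh_neq0 (h 0 i).
have cE : expR (h 0 i) + expR (- h 0 i) = 2 * cosh (h 0 i) by rewrite /cosh; field.
have sE : expR (h 0 i) - expR (- h 0 i) = 2 * sinh (h 0 i) by rewrite /sinh; field.
move: (cavity_weight b i x 0 h) (c x) ch cE sE => w a.
case: (x i); rewrite /spin ?opprK !(mul1r, mulN1r);
  move: (expR _) (expR _) (cosh _) (sinh _) => p q C S C0 pq pq'.
- transitivity (w * a * (q - p) / 2); first by field.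
  by rewrite pq'; transitivity (S / C * (w * a * (q + p) / 2)); [rewrite pq|]; field.
- transitivity (w * a * (q - p) / 2); first by field.
  by rewrite pq'; transitivity (S / C * (w * a * (q + p) / 2)); [rewrite pq|]; field.
Qed.

Lemma cova0 h v : cova b 0 h v v = \sum_i v 0 i ^+ 2 * sech (h 0 i) ^+ 2.
Proof.
have E1 i : ex b (fun x => spin R (x i)) 0 h = tanh (h 0 i).
  rewrite -[RHS]mulr1 -(ex1 b 0 h) -ex_spin_tanh//.
  by apply: eq_ex => x; rewrite mulr1.
have E2 i j : ex b (fun x => spin R (x i) * spin R (x j)) 0 h =
    tanh (h 0 i) * tanh (h 0 j) + (j == i)%:R * sech (h 0 i) ^+ 2.
  have [->|ji] := eqVneq j i.
    rewrite (@eq_ex _ _ _ b _ (fun=> 1)); last by move=> x; exact: spin_sqr.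
    by rewrite ex1 mul1r /sech exprVn -one_minus_tanh2 -expr2; ring.
  rewrite ex_spin_tanh ?E1 ?mul0r ?addr0// => x.
  by rewrite ffunE (negbTE ji).
rewrite /cova /lin.
rewrite (@eq_ex _ _ _ b _ (fun x => \sum_i \sum_j (v 0 i * v 0 j) *
    (spin R (x i) * spin R (x j)))); last first.
  move=> x; rewrite mulr_suml; apply: eq_bigr => i _; rewrite mulr_sumr.
  by apply: eq_bigr => j _; ring.
have Elin : ex b (fun x => \sum_i v 0 i * spin R (x i)) 0 h = \sum_i v 0 i * tanh (h 0 i).
  by rewrite ex_sum; apply: eq_bigr => i _; rewrite exZ E1.
rewrite Elin ex_sum mulr_suml -sumrB; apply: eq_bigr => i _.
rewrite ex_sum mulr_sumr -sumrB (bigD1 i)//= big1 ?addr0 => [|j /negbTE ji].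
  by rewrite exZ E2 eqxx mul1r; ring.
by rewrite exZ E2 ji mul0r; ring.
Qed.

(* If [K <= n] and [K <= Q + d], then [K ^+ 2 - Q ^+ 2 <= 2 * n * d].  With an
   error [d] of exponential rate [4 * n], integrating this quantity over time
   reproduces the error with a factor 1/2. *)
Let lam : R := 4 * n%:R.

Let excess M := forall z h v, 0 <= z ->
  var_part b v z h - final_part v z h <= dot v v * (k z + M * expR (lam * z)) * part b z h.

(** In [excess M] the variance is bounded by its final part plus the integrated
    quadratic term, up to an exponential error.  Since the final part is at most
    [rfun], the variance is then bounded by [Q] up to the same error. *)
Lemma excess_cova_le M z h v : 0 <= M -> excess M -> 0 <= z ->
  cova b z h v v <= Num.min n%:R (Q z + M * expR (lam * z)) * dot v v.
Proof.
move=> M0 eM z0; have m0 : 0 <= M * expR (lam * z) by rewrite mulr_ge0// expR_ge0.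
have d0 := dot_ge0 v; have c1 := cova_crude b z h v.
have c2 : cova b z h v v <= (rfun (eta * z) + k z + M * expR (lam * z)) * dot v v.
  have p0 := part_gt0 b z h.
  rewrite -(ler_pM2l p0) -/(var_part b v z h).
  have := eM z h v z0; have := final_part_le v h z0; lra.
have Qm := Q_super z0.
case: (leP n%:R (Q z + _)) => // nQ.
have rk : rfun (eta * z) + k z <= Q z.
  by move: Qm; rewrite ge_min => /orP[nQz|//]; move: nQ m0; lra.
by apply: le_trans c2 _; rewrite ler_wpM2r// lerD2r.
Qed.

(** One step of the Gronwall iteration.  The variance minus its final part grows
    at the rate of the squared covariance; the bound of [excess_cova_le] on the
    latter is fed back through the maximum principle. *)
Lemma excess_halve M : 0 <= M -> excess M -> excess (M / 2).
Proof.
move=> M0 eM z0 h0 v0 z00.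
pose N z h := var_part b v0 z h - final_part v0 z h -
  dot v0 v0 * (k z + M / 2 * expR (lam * z)) * part b z h.
have n0 : 0 <= n%:R :> R by exact: ler0n.
suff : N z0 h0 <= 0 by rewrite subr_le0.
apply: (@gibbs_max_principle _ _ _ b N z0 (n%:R * dot v0 v0)); last by rewrite z00 lexx.
- move=> z h /andP[z1 _].
  have cp : continuous (fun p : R * 'rV[R]_n => part b p.1 p.2) by exact: continuous_wsum.
  have cf : continuous (fun p : R * 'rV[R]_n => final_part v0 p.1 p.2).
    apply: continuous_bigsum => i; apply: continuousMM; first exact: continuous_const.
    exact: continuous_cavity_sum.
  have cv : {for (z, h), continuous (fun p : R * 'rV[R]_n => var_part b v0 p.1 p.2)}.
    rewrite (_ : (fun p => _) = (fun p : R * 'rV[R]_n =>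
        wsum b (fun x => lin v0 x * lin v0 x) p.1 p.2 -
        part b p.1 p.2 * (wsum b (lin v0) p.1 p.2 / part b p.1 p.2 *
          (wsum b (lin v0) p.1 p.2 / part b p.1 p.2)))); last first.
      by apply/funext => p; rewrite var_partE expr2.
    have cq : {for (z, h), continuous (fun p : R * 'rV[R]_n =>
        wsum b (lin v0) p.1 p.2 / part b p.1 p.2)}.
      apply: cvgM; first exact: continuous_wsum.
      by apply: cvgV; [exact: part_neq0|exact: cp].
    apply: cvgB; first exact: continuous_wsum.
    by apply: cvgM; [exact: cp|apply: cvgM; exact: cq].
  have ck : {for (z, h), continuous (fun p : R * 'rV[R]_n =>
      k p.1 + M / 2 * expR (lam * p.1))}.
    have dk := derD (kP z1) (derMl (M / 2) (der_exp (derMl lam (der_id z)))).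
    apply: (@continuous_comp _ _ _ (fun p : R * 'rV[R]_n => p.1)
      (fun z => k z + M / 2 * expR (lam * z))); first exact: cvg_fst.
    exact: der_continuous dk.
  apply: cvgB; first by apply: cvgB; [exact: cv|exact: cf].
  apply: cvgM; last exact: cp.
  by apply: cvgM; [exact: cvg_cst|exact: ck].
- move=> z h /andP[z1 _]; have z10 := ltW z1.
  have hf : heat_defect b (final_part v0) z h 0.
    have hc i : heat_defect b (cavity_sum b i) z h 0.
      by apply: heat_cavity_sum; rewrite ?self_eta.
    apply: heat_eq (heat_sum (fun i => heatZ (v0 0 i ^+ 2) (hc i))) _.
    by rewrite big1// => i _; rewrite mulr0.
  have dk := derMl (dot v0 v0) (derD (kP z10)
    (derMl (M / 2) (der_exp (derMl lam (der_id z))))).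
  have := heatB (heatB (heat_var_part b v0 z h) hf)
    (heat_time dk (heat_wsum b (fun=> 1) z h)).
  rewrite -/(part b z h) => hN; eexists; first exact: hN.
  rewrite subr0 mulr0 add0r mulr1 subr_le0.
  set K := Num.min n%:R (Q z + M * expR (lam * z)).
  have Q0 := Q_ge0 z10.
  have m0 : 0 <= M * expR (lam * z) by rewrite mulr_ge0// expR_ge0.
  have K0 : 0 <= K by rewrite le_min n0 addr_ge0.
  have Kn : K <= n%:R by rewrite ge_min lexx.
  have KQ : K <= Q z + M * expR (lam * z) by rewrite ge_min lexx orbT.
  have sl := slope_le b_le1 v0 K0 (fun u => excess_cova_le h u M0 eM z10).
  rewrite [leLHS]mulrC; apply: ler_wpM2r; first exact/ltW/part_gt0.
  apply: le_trans sl _; rewrite mulrC ler_wpM2l ?dot_ge0// /lam.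
  move: Kn KQ Q0 m0 K0; set e := expR _; set q := Q z; move=> *.
  have [Kq|qK] := leP K q; nra.
- move=> h; rewrite /N.
  have -> : var_part b v0 0 h = final_part v0 0 h.
    rewrite /var_part cova0 mulr_sumr; apply: eq_bigr => i _.
    by rewrite cavity_sum0; ring.
  have p0 := ltW (part_gt0 b 0 h).
  rewrite subrr sub0r oppr_le0 !mulr_ge0 ?dot_ge0// addr_ge0 ?k_ge0//.
  by rewrite !mulr_ge0// expR_ge0.
- move=> z h /andP[z1 _]; rewrite /N.
  have p0 := part_gt0 b z h; have f0 := final_part_ge0 v0 z h.
  apply: (@le_trans _ _ (var_part b v0 z h)).
    have : 0 <= dot v0 v0 * (k z + M / 2 * expR (lam * z)) * part b z h.
      rewrite !mulr_ge0 ?dot_ge0 ?(ltW p0)// addr_ge0 ?k_ge0//.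
      by rewrite !mulr_ge0// expR_ge0.
    move: f0; lra.
  by rewrite [leRHS]mulrC ler_wpM2l ?(ltW p0)// cova_crude.
Qed.

Lemma excess_crude : excess n%:R.
Proof.
move=> z h v z0; have p0 := part_gt0 b z h.
apply: (@le_trans _ _ (var_part b v z h)).
  by rewrite lerBlDr lerDl final_part_ge0.
rewrite [leRHS]mulrC ler_wpM2l ?(ltW p0)//.
apply: le_trans (cova_crude b z h v) _; rewrite mulrC ler_wpM2l ?dot_ge0//.
have e1 : 1 <= expR (lam * z).
  by apply: le_trans (expR_ge1Dx _); rewrite lerDl !mulr_ge0.
have := k_ge0 z0; have : 0 <= n%:R :> R by []; nra.
Qed.

Theorem cova_le z h v : 0 <= z -> cova b z h v v <= Q z * dot v v.
Proof.
move=> z0.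
have iter j : excess (n%:R / 2 ^+ j).
  elim: j => [|j ih]; first by rewrite expr0 divr1; exact: excess_crude.
  by rewrite exprSr invfM mulrA; apply: excess_halve ih; rewrite divr_ge0 ?exprn_ge0.
apply/ler_addgt0Pr => e e0.
pose A := n%:R * expR (lam * z) * dot v v.
have A0 : 0 <= A by rewrite !mulr_ge0 ?expR_ge0 ?dot_ge0.
have [j Aj] : exists j, A / 2 ^+ j <= e.
  exists (Num.bound (A / e)); rewrite ler_pdivrMr ?exprn_gt0//.
  rewrite mulrC -ler_pdivrMr//; apply: le_trans (ltW (archi_boundP _)) _.
    by rewrite divr_ge0// ltW.
  by rewrite -natrX ler_nat ltnW// ltn_expl.
have M0 : 0 <= n%:R / 2 ^+ j :> R by rewrite divr_ge0 ?exprn_ge0.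
apply: le_trans (excess_cova_le h v M0 (iter j) z0) _.
apply: (@le_trans _ _ ((Q z + n%:R / 2 ^+ j * expR (lam * z)) * dot v v)).
  by rewrite ler_wpM2r ?dot_ge0// ge_min lexx orbT.
rewrite mulrDl lerD2l; apply: le_trans Aj.
by rewrite le_eqVlt; apply/orP; left; apply/eqP; rewrite /A; ring.
Qed.

End volterra_covariance.

(** * Entropies along the flow *)
Section entropy.
Variables (R : realType) (n m : nat) (b : 'I_m -> 'rV[R]_n).
Local Notation config := {ffun 'I_n -> bool}.
Implicit Types (u v w h : 'rV[R]_n) (x y : config) (z : R) (c d f g : config -> R).
Implicit Types (i j : 'I_n).

Definition xlnx (t : R) : R := t * ln t.

Lemma der_xlnx (t : R) : 0 < t -> is_derive t 1 xlnx (ln t + 1).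
Proof.
move=> t0; apply: der_eq (derM (der_id t) (is_derive1_ln t0)) _.
by rewrite mul1r divff// lt0r_neq0.
Qed.

(** The pointwise form of the Gibbs variational principle. *)
Lemma xlnx_ge (p q : R) : 0 < p -> 0 < q -> p * ln q + p - q <= xlnx p.
Proof.
move=> p0 q0; have qp : 0 < q / p by rewrite divr_gt0.
have := expR_ge1Dx (ln (q / p)); rewrite lnK ?posrE// ln_div ?posrE// => h.
have := ler_wpM2l (ltW p0) h; rewrite (_ : p * (q / p) = q); last first.
  by field; exact: lt0r_neq0.
by rewrite /xlnx; lra.
Qed.

Lemma agree_offE i x y : agree_off i x y = (y == x) || (y == flip i x).
Proof.
apply/forallP/orP => [h|[/eqP -> j|/eqP -> j]]; last 2 first.
- by rewrite eqxx implybT.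
- by rewrite ffunE; case: (j == i) => //=; rewrite eqxx.
have [xy|xy] := eqVneq (y i) (x i); [left|right]; apply/eqP/ffunP => j.
  by have [->//|ji] := eqVneq j i; have := h j; rewrite ji => /eqP.
rewrite ffunE; have [->|ji] := eqVneq j i; last by have := h j; rewrite ji => /eqP.
by move: xy; case: (x i); case: (y i).
Qed.

Lemma flip_neq i x : flip i x != x.
Proof.
by apply/eqP => /ffunP /(_ i); rewrite ffunE eqxx; case: (x i).
Qed.

Lemma sum_agree i x (F : config -> R) :
  \sum_(y | agree_off i x y) F y = F x + F (flip i x).
Proof.
rewrite (bigD1 x) ?agree_offE ?eqxx//=; congr (_ + _).
rewrite (bigD1 (flip i x))/= ?agree_offE ?eqxx ?orbT ?flip_neq//= big1 ?addr0//.
move=> y; rewrite agree_offE => /andP[/andP[/orP[/eqP ->|/eqP ->]]];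
  by rewrite ?eqxx.
Qed.

(** Restricting the sums to one class of [agree_off i] makes the conditional
    expectations quotients of two solutions of the heat equation. *)
Definition agree_indic i x c : config -> R := fun y => (agree_off i x y)%:R * c y.

Lemma wsum_agree i x c z h : wsum b (agree_indic i x c) z h =
  c x * gibbs b z h x + c (flip i x) * gibbs b z h (flip i x).
Proof.
rewrite -(sum_agree i x (fun y => c y * gibbs b z h y)) [RHS]big_mkcond/=.
apply: eq_bigr => y _; rewrite /agree_indic.
by case: ifP => _; rewrite ?mul1r// !mul0r.
Qed.

Lemma wsum_agree_gt0 i x c z h : (forall y, 0 < c y) ->
  0 < wsum b (agree_indic i x c) z h.
Proof. by move=> c0; rewrite wsum_agree addr_gt0// mulr_gt0// gibbs_gt0. Qed.

Lemma wsum_pos_gt0 c z h : (forall y, 0 < c y) -> 0 < wsum b c z h.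
Proof.
move=> c0; apply: (@wsum_gt0 _ _ _ _ _ _ _ [ffun=> true]) => // x; exact/ltW.
Qed.

(** A Taylor bound at the endpoint of the unit interval. *)
Lemma taylor_le (g0 g1 g2 : R -> R) (r : R) :
  (forall s : R, is_derive s 1 g0 (g1 s)) -> (forall s : R, is_derive s 1 g1 (g2 s)) ->
  (forall s, g2 s <= r) -> g0 1 <= g0 0 + g1 0 + r / 2.
Proof.
move=> d0 d1 g2r.
have g1le s : 0 < s -> g1 s - g1 0 <= r * s.
  move=> s0; have [t _ ->] := MVT s0 (fun t _ => d1 t)
    (continuous_subspaceT (fun t => der_continuous (d1 t))).
  by rewrite subr0 ler_wpM2r// ltW.
have dp (s : R) := derB (derB (d0 s) (derM (der_id s) (der_cst (g1 0) s)))
  (derMl (r / 2) (derM (der_id s) (der_id s))).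
have [t] := MVT ltr01 (fun t _ => dp t)
  (continuous_subspaceT (fun t => der_continuous (dp t))).
rewrite in_itv/= => /andP[t0 _]; have := g1le t t0.
by lra.
Qed.

Section positive_function.
Variable f : config -> R.
Hypothesis f_gt0 : forall x, 0 < f x.

Definition entropy_part z h : R :=
  wsum b (fun x => xlnx (f x)) z h - part b z h * xlnx (wsum b f z h / part b z h).

(** Both the configurations of a class count it, whence the factor 1/2 in
    [local_part]. *)
Definition local_term i x z h : R :=
  wsum b (agree_indic i x (fun y => xlnx (f y))) z h -
  wsum b (agree_indic i x (fun=> 1)) z h *
    xlnx (wsum b (agree_indic i x f) z h / wsum b (agree_indic i x (fun=> 1)) z h).

Definition local_part i z h : R := \sum_x 2^-1 * local_term i x z h.

Lemma heat_xlnx c d z h : (forall z h, 0 < wsum b c z h) -> (forall z h, 0 < wsum b d z h) ->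
  heat_defect b (fun z h => wsum b d z h * xlnx (wsum b c z h / wsum b d z h)) z h
    (- (2^-1 * wsum b d z h * (wsum b c z h / wsum b d z h)^-1 *
      \sum_k slope b c d z h k ^+ 2)).
Proof.
move=> c0 d0; have a0 z' h' : 0 < wsum b c z' h' / wsum b d z' h' by rewrite divr_gt0.
apply: (@heat_persp _ _ _ b xlnx (fun t => ln t + 1) (fun t => t^-1)).
- by move=> z' h'; exact: der_xlnx.
- move=> z' h'; apply: der_eq (derD (is_derive1_ln (a0 z' h')) (der_cst 1 _)) _.
  by rewrite addr0.
- by move=> z' h'; exact: lt0r_neq0.
Qed.

Let a z h := ex b f z h.

Lemma a_gt0 z h : 0 < a z h.
Proof. by rewrite divr_gt0 ?part_gt0// wsum_pos_gt0. Qed.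

Lemma heat_entropy_part z h : heat_defect b entropy_part z h
  (part b z h * ((\sum_k slope b f (fun=> 1) z h k ^+ 2) / (2 * a z h))).
Proof.
apply: heat_eq (heatB (heat_wsum b _ z h) (@heat_xlnx f (fun=> 1) z h _ _)) _.
- by move=> z' h'; exact: wsum_pos_gt0.
- by move=> z' h'; exact: part_gt0.
rewrite sub0r opprK -/(part b z h) -/(ex b f z h) -/(a z h).
by field; exact: lt0r_neq0 (a_gt0 z h).
Qed.

(** The local entropies are supersolutions: they are built from conditional
    expectations, whose [xlnx] loses mass along the flow. *)
Lemma heat_local_part i z h : exists2 d, heat_defect b (local_part i) z h d & 0 <= d.
Proof.
pose D x := 2^-1 * (0 - - (2^-1 * wsum b (agree_indic i x (fun=> 1)) z h *
  (wsum b (agree_indic i x f) z h / wsum b (agree_indic i x (fun=> 1)) z h)^-1 *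
  \sum_k slope b (agree_indic i x f) (agree_indic i x (fun=> 1)) z h k ^+ 2)).
have p1 x z' h' : 0 < wsum b (agree_indic i x (fun=> 1)) z' h'.
  by apply: wsum_agree_gt0 => _; exact: ltr01.
have pf x z' h' : 0 < wsum b (agree_indic i x f) z' h' by exact: wsum_agree_gt0.
exists (\sum_x D x).
  apply: heat_sum => x; apply: heatZ; apply: heatB; first exact: heat_wsum.
  by apply: heat_xlnx.
apply: sumr_ge0 => x _; rewrite /D sub0r opprK !mulr_ge0//; first exact: ltW.
  by rewrite invr_ge0 divr_ge0// ltW.
by apply: sumr_ge0 => k _; exact: sqr_ge0.
Qed.

(** Jensen's inequality on each class. *)
Lemma local_part_ge0 i z h : 0 <= local_part i z h.
Proof.
apply: sumr_ge0 => x _; rewrite mulr_ge0// subr_ge0.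
set A := wsum b (agree_indic i x f) z h; set Z := wsum b (agree_indic i x (fun=> 1)) z h.
have A0 : 0 < A by exact: wsum_agree_gt0.
have Z0 : 0 < Z by apply: wsum_agree_gt0 => _; exact: ltr01.
set r := A / Z; have r0 : 0 < r by rewrite divr_gt0.
have Ar : A = Z * r by rewrite /r mulrC divfK// lt0r_neq0.
have ZE : Z = gibbs b z h x + gibbs b z h (flip i x) by rewrite /Z wsum_agree !mul1r.
have AE : A = f x * gibbs b z h x + f (flip i x) * gibbs b z h (flip i x).
  by rewrite /A wsum_agree.
rewrite wsum_agree.
have h1 := ler_wpM2r (ltW (gibbs_gt0 b z h x)) (xlnx_ge (f_gt0 x) r0).
have h2 := ler_wpM2r (ltW (gibbs_gt0 b z h (flip i x))) (xlnx_ge (f_gt0 (flip i x)) r0).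
apply: le_trans (lerD h1 h2).
rewrite le_eqVlt; apply/orP; left; apply/eqP.
transitivity (A * ln r + A - r * Z); last by rewrite AE ZE; ring.
by rewrite /xlnx Ar; ring.
Qed.

(** Entropic stability: a bound on the covariances of all tilts of the measure
    controls the displacement of the mean by the entropy.  The Gibbs variational
    principle compares the mean of [lin u] under the measure weighted by [f] with
    the cumulant generating function, which is quadratic up to the bound on the
    covariances; it remains to optimize over [u]. *)
Lemma entropic_stability z h (K : R) : 0 <= K ->
  (forall u, \sum_k dot (b k) u ^+ 2 <= dot u u) -> 
  (forall h u, cova b z h u u <= K * dot u u) ->
  (\sum_k slope b f (fun=> 1) z h k ^+ 2) / (2 * a z h) * part b z h <=
  K * entropy_part z h.
Proof.
move=> K0 b_le1 hK; set p := part b z h; have p0 : 0 < p by exact: part_gt0.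
have a0 := a_gt0 z h.
pose e := ex b (fun x => xlnx (f x)) z h - xlnx (a z h).
have eE : entropy_part z h = p * e.
  rewrite /entropy_part /e /a /ex -/p; set X := xlnx (_ / _).
  by field; exact: lt0r_neq0.
pose s u := ex b (fun x => f x * lin u x) z h - a z h * ex b (lin u) z h.
have sD u v : s (u + v) = s u + s v.
  rewrite /s (@eq_ex _ _ _ b _ (fun x => f x * lin u x + f x * lin v x)); last first.
    by move=> x; rewrite linD mulrDr.
  by rewrite exD (@eq_ex _ _ _ b (lin (u + v)) _ _ _ (linD u v)) exD; ring.
have sZ r u : s (r *: u) = r * s u.
  rewrite /s (@eq_ex _ _ _ b _ (fun x => r * (f x * lin u x))); last first.
    by move=> x; rewrite linZ; ring.
  by rewrite exZ (@eq_ex _ _ _ b (lin (r *: u)) _ _ _ (linZ r u)) exZ; ring.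
pose t : 'rV[R]_n := \row_i s (delta_mx 0 i).
have sE u : s u = dot u t.
  have -> : dot u t = \sum_i s (u 0 i *: delta_mx 0 i).
    by apply: eq_bigr => i _; rewrite mxE sZ.
  rewrite {1}(row_sum_delta u); elim/big_rec2: _ => [|i y1 y2 _ ih].
    by rewrite -(scale0r 0) sZ mul0r.
  by rewrite sD ih.
have slopeE k : slope b f (fun=> 1) z h k = s (b k).
  rewrite /slope /s /a /ex -/(part b z h) -/p.
  rewrite (@eq_wsum _ _ _ b (fun x => 1 * lin (b k) x) (lin (b k)))//; last first.
    by move=> x; rewrite mul1r.
  by field; exact: lt0r_neq0.
have sle : \sum_k slope b f (fun=> 1) z h k ^+ 2 <= dot t t.
  by apply: le_trans (b_le1 t); apply: ler_sum => k _; rewrite slopeE sE.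
have cumulant u : ln (part b z (h + u)) <= ln p + ex b (lin u) z h + K * dot u u / 2.
  have pE (r : R) : part b z (h + r *: u) != 0 by exact: part_neq0.
  have d1 (r : R) : is_derive r 1 (fun r : R => part b z (h + r *: u))
      (wsum b (lin u) z (h + r *: u)).
    apply: der_eq (der_wsum_line b (fun=> 1) z h u r) _.
    by apply: eq_wsum => x; rewrite mul1r.
  have d0 (r : R) : is_derive r 1 (fun r : R => ln (part b z (h + r *: u)))
      (ex b (lin u) z (h + r *: u)) by apply: der_ln (d1 r) _; exact: part_gt0.
  have d2 (r : R) : is_derive r 1 (fun r : R => ex b (lin u) z (h + r *: u))
      (cova b z (h + r *: u) u u).
    apply: der_eq (derM (der_wsum_line b (lin u) z h u r) (derV (d1 r) (pE r))) _.
    by rewrite /cova /ex; field.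
  have := taylor_le d0 d2 (fun r => hK _ u).
  by rewrite scale1r scale0r addr0.
have dual u : s u <= e + a z h * K * dot u u / 2.
  pose q := part b z (h + u) / p.
  have q0 : 0 < q by rewrite divr_gt0// part_gt0.
  have gu x : gibbs b z (h + u) x = gibbs b z h x * expR (lin u x).
    by rewrite /gibbs -expRD linD addrA.
  have qE : ex b (fun x => expR (lin u x)) z h = q.
    rewrite /ex /q /part /wsum; congr (_ / _); apply: eq_bigr => x _.
    by rewrite gu mul1r mulrC.
  pose g x := a z h / q * expR (lin u x).
  have g0 x : 0 < g x by rewrite mulr_gt0 ?expR_gt0// divr_gt0.
  have lng x : ln (g x) = ln (a z h / q) + lin u x.
    by rewrite /g lnM ?expRK// posrE ?expR_gt0// divr_gt0.
  have : ex b (fun x => f x * ln (g x) + f x - g x) z h <= ex b (fun x => xlnx (f x)) z h.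
    by apply: le_ex => x; exact: xlnx_ge.
  rewrite (@eq_ex _ _ _ b _ (fun x => ln (a z h / q) * f x + f x * lin u x +
    (f x + - (a z h / q) * expR (lin u x)))); last first.
    by move=> x; rewrite lng /g; ring.
  rewrite exD !exD !exZ qE -/(a z h) ln_div ?posrE// /q ln_div ?posrE ?part_gt0//.
  rewrite -/q (_ : - (a z h / q) * q = - a z h); last by field; exact: lt0r_neq0.
  have := ler_wpM2l (ltW a0) (cumulant u).
  by rewrite /s /e /xlnx; lra.
rewrite eE (_ : _ / _ * p = p * (\sum_k slope b f (fun=> 1) z h k ^+ 2 / (2 * a z h))); last first.
  by rewrite -mulr_suml mulrC.
rewrite (_ : K * (p * e) = p * (K * e)); last by ring.
have a20 : 0 < 2 * a z h by rewrite pmulr_rgt0.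
rewrite ler_pM2l// -mulr_suml ler_pdivrMr//; apply: le_trans sle _.
have dot0 v : dot 0 v = 0.
  by rewrite /dot big1// => i _; rewrite mxE mul0r.
have e0 : 0 <= e by have := dual 0; rewrite sE !dot0 mulr0 mul0r addr0.
have [->|t0] := eqVneq (dot t t) 0; first by rewrite mulr_ge0 ?(ltW a20)// mulr_ge0.
have tp : 0 < dot t t by rewrite lt_neqAle eq_sym t0 dot_ge0.
have dotZ (r : R) : dot (r *: t) (r *: t) = r ^+ 2 * dot t t.
  by rewrite /dot mulr_sumr; apply: eq_bigr => i _; rewrite mxE; ring.
have A0 : 0 <= a z h * K * dot t t / 2.
  by rewrite divr_ge0// mulr_ge0 ?dot_ge0// mulr_ge0 ?(ltW a0).
(* [dual] along the line of [t] is a nonnegative quadratic polynomial. *)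
have : (- dot t t / 2) ^+ 2 <= a z h * K * dot t t / 2 * e.
  apply: discriminant_le => // r; have := dual (r *: t); rewrite sZ sE dotZ; lra.
rewrite (_ : (- dot t t / 2) ^+ 2 = dot t t * (dot t t / 4)); last by field.
rewrite (_ : a z h * K * dot t t / 2 * e = dot t t * (a z h * K * e / 2)); last by field.
by rewrite ler_pM2l//; lra.
Qed.

End positive_function.

End entropy.

(** * Tensorization of entropy for product measures *)
Section conditional_expectation.
Variables (R : realType) (n m : nat) (b : 'I_m -> 'rV[R]_n).
Local Notation config := {ffun 'I_n -> bool}.
Implicit Types (h : 'rV[R]_n) (x y : config) (z : R) (f g : config -> R).
Implicit Types (i j : 'I_n).

(** The conditional expectation given all coordinates but the [i]th. *)
Definition cond_ex i z h g x : R :=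
  (g x * gibbs b z h x + g (flip i x) * gibbs b z h (flip i x)) /
  (gibbs b z h x + gibbs b z h (flip i x)).

(** The functions that do not depend on the coordinate [i]. *)
Definition flip_invariant i g := forall x, g (flip i x) = g x.

Lemma gibbs_pair_gt0 i z h x : 0 < gibbs b z h x + gibbs b z h (flip i x).
Proof. by rewrite addr_gt0// gibbs_gt0. Qed.

Lemma cond_ex_flip i z h g : flip_invariant i (cond_ex i z h g).
Proof.
by move=> x; rewrite /cond_ex flipK addrC (addrC (gibbs _ _ _ (flip i x))).
Qed.

Lemma cond_ex_gt0 i z h g : (forall x, 0 < g x) -> forall x, 0 < cond_ex i z h g x.
Proof.
by move=> g0 x; rewrite divr_gt0 ?gibbs_pair_gt0// addr_gt0// mulr_gt0// gibbs_gt0.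
Qed.

(** A conditional expectation is self-adjoint. *)
Lemma ex_cond i z h g u : flip_invariant i u ->
  ex b (fun x => u x * cond_ex i z h g x) z h = ex b (fun x => u x * g x) z h.
Proof.
move=> ui; rewrite /ex /wsum; congr (_ / _).
rewrite (sum_flip i) [RHS](sum_flip i); apply: eq_bigr => x _; congr (_ / _).
rewrite cond_ex_flip ui /cond_ex; have := lt0r_neq0 (gibbs_pair_gt0 i z h x).
by move: (gibbs _ _ _ x) (gibbs _ _ _ (flip i x)) => p q pq; field.
Qed.

Lemma ex_cond1 i z h g : ex b (cond_ex i z h g) z h = ex b g z h.
Proof.
transitivity (ex b (fun x => 1 * cond_ex i z h g x) z h).
  by apply: eq_ex => x; rewrite mul1r.
by rewrite ex_cond//; apply: eq_ex => x; rewrite mul1r.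
Qed.

Lemma wsum_cond_xlnx i z h f (phi : R -> R) :
  \sum_x 2^-1 * (wsum b (agree_indic i x (fun=> 1)) z h *
    phi (wsum b (agree_indic i x f) z h / wsum b (agree_indic i x (fun=> 1)) z h)) =
  wsum b (fun x => phi (cond_ex i z h f x)) z h.
Proof.
rewrite [RHS]/wsum [RHS](sum_flip i); apply: eq_bigr => x _.
rewrite !wsum_agree !mul1r cond_ex_flip -/(cond_ex i z h f x).
by rewrite mulrC; congr (_ / _); ring.
Qed.

Lemma local_partE i z h f : local_part b f i z h =
  part b z h * (ex b (fun x => xlnx (f x)) z h -
                ex b (fun x => xlnx (cond_ex i z h f x)) z h).
Proof.
rewrite /local_part; under eq_bigr do rewrite mulrBr.
rewrite sumrB wsum_cond_xlnx /ex mulrBr !(mulrC (part _ _ _)).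
rewrite !divfK ?part_neq0//; congr (_ - _).
rewrite [RHS]/wsum [RHS](sum_flip i); apply: eq_bigr => x _.
by rewrite wsum_agree mulrC.
Qed.

Lemma entropy_partE z h f : entropy_part b f z h =
  part b z h * (ex b (fun x => xlnx (f x)) z h - xlnx (ex b f z h)).
Proof.
rewrite /entropy_part /ex mulrBr; congr (_ - _).
by rewrite mulrC divfK// part_neq0.
Qed.

Section independent_coordinates.
Variable h : 'rV[R]_n.

Lemma flipC i j x : flip i (flip j x) = flip j (flip i x).
Proof. by apply/ffunP => k; rewrite !ffunE; case: (k == i); case: (k == j). Qed.

Lemma gibbs_flip0 j x :
  gibbs b 0 h (flip j x) = gibbs b 0 h x * expR (- (2 * h 0 j * spin R (x j))).
Proof.
rewrite /gibbs -expRD; congr expR.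
by rewrite !(lin_off j h) off_flip spin_flip; ring.
Qed.

(** Averaging over one coordinate does not reintroduce dependence on another;
    this is where independence is used. *)
Lemma cond_ex_invariant i j g : flip_invariant j g -> flip_invariant j (cond_ex i 0 h g).
Proof.
move=> gj; have [->|ji] := eqVneq j i; first exact: cond_ex_flip.
move=> x; rewrite /cond_ex (flipC i j) !gj !(gibbs_flip0 j).
have -> : flip i x j = x j by rewrite ffunE (negbTE ji).
have := lt0r_neq0 (gibbs_pair_gt0 i 0 h x).
move: (gibbs _ _ _ x) (gibbs _ _ _ (flip i x)) => p q pq.
have := lt0r_neq0 (expR_gt0 (- (2 * h 0 j * spin R (x j)))).
by move: (expR _) => e e0; field; rewrite pq -mulrDl mulf_neq0.
Qed.

Definition average s g := foldr (fun i g => cond_ex i 0 h g) g s.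

Lemma average_invariant s g i : i \in s -> flip_invariant i (average s g).
Proof.
elim: s => // j s ih; rewrite inE => /predU1P[->|/ih]; first exact: cond_ex_flip.
exact: cond_ex_invariant.
Qed.

Lemma average_gt0 s g : (forall x, 0 < g x) -> forall x, 0 < average s g x.
Proof. by move=> g0; elim: s => //= i s ih; exact: cond_ex_gt0. Qed.

Lemma ex_average s g u : (forall i, i \in s -> flip_invariant i u) ->
  ex b (fun x => u x * average s g x) 0 h = ex b (fun x => u x * g x) 0 h.
Proof.
elim: s => //= i s ih us; rewrite ex_cond; last by apply: us; rewrite inE eqxx.
by apply: ih => j js; apply: us; rewrite inE js orbT.
Qed.

Lemma flip_invariant_const g : (forall i, flip_invariant i g) -> forall x y, g x = g y.
Proof.
move=> gi; suff h1 x : g x = g [ffun=> true] by move=> x y; rewrite h1 [RHS]h1.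
pose x_ (s : seq 'I_n) : config := [ffun j => (j \in s) || x j].
have step s : g (x_ s) = g x.
  elim: s => [|i s <-]; first by congr g; apply/ffunP => j; rewrite ffunE.
  have [xi|xi] := boolP (x_ s i).
    congr g; apply/ffunP => j; rewrite !ffunE inE; case: eqP => //= ->.
    by move: xi; rewrite ffunE => ->.
  rewrite -(gi i (x_ s)); congr g; apply/ffunP => j; rewrite !ffunE inE.
  by case: eqP => //= ->; move: xi; rewrite ffunE => /negbTE ->.
rewrite -(step (enum 'I_n)); congr g; apply/ffunP => j.
by rewrite !ffunE mem_enum.
Qed.

Lemma average_full g x : average (enum 'I_n) g x = ex b g 0 h.
Proof.
have inv i : flip_invariant i (average (enum 'I_n) g).
  by apply: average_invariant; rewrite mem_enum.
rewrite -[LHS](ex_cst b _ 0 h).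
rewrite (@eq_ex _ _ _ b _ (fun y => 1 * average (enum 'I_n) g y)).
  by rewrite ex_average//; apply: eq_ex => y; rewrite mul1r.
by move=> y; rewrite mul1r; exact: flip_invariant_const.
Qed.

(** Averaging over other coordinates decreases the entropy lost by averaging over
    the coordinate [i].  With [G] the average, the difference of the two sides is
    the mean of [f * ln (f / c)] for [c] below, and [c] has the mean of [f]. *)
Lemma average_entropy_step f i s : (forall x, 0 < f x) ->
  ex b (fun x => xlnx (average s f x)) 0 h -
    ex b (fun x => xlnx (cond_ex i 0 h (average s f) x)) 0 h <=
  ex b (fun x => xlnx (f x)) 0 h - ex b (fun x => xlnx (cond_ex i 0 h f x)) 0 h.
Proof.
move=> f0; set Tf := cond_ex i 0 h f; set G := average s f; set TG := cond_ex i 0 h G.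
have Tf0 : forall x, 0 < Tf x by exact: cond_ex_gt0.
have G0 : forall x, 0 < G x by exact: average_gt0.
have TG0 : forall x, 0 < TG x by exact: cond_ex_gt0.
have Tfi : flip_invariant i Tf by exact: cond_ex_flip.
have Gs j : j \in s -> flip_invariant j G by exact: average_invariant.
have TGi : flip_invariant i TG by exact: cond_ex_flip.
have TGs j : j \in s -> flip_invariant j TG by move=> js; apply: cond_ex_invariant; exact: Gs.
have lninv j g : flip_invariant j g -> flip_invariant j (fun x => ln (g x)).
  by move=> gj x; rewrite gj.
have eT : ex b (fun x => xlnx (Tf x)) 0 h = ex b (fun x => ln (Tf x) * f x) 0 h.
  rewrite -(ex_cond _ _ _ (lninv _ _ Tfi)); apply: eq_ex => x.
  by rewrite /xlnx mulrC.
have eG : ex b (fun x => xlnx (G x)) 0 h = ex b (fun x => ln (G x) * f x) 0 h.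
  rewrite -(@ex_average s f) => [|j js]; last by apply: lninv; exact: Gs.
  by apply: eq_ex => x; rewrite /xlnx mulrC.
have eTG : ex b (fun x => xlnx (TG x)) 0 h = ex b (fun x => ln (TG x) * f x) 0 h.
  rewrite -(@ex_average s f) => [|j js]; last by apply: lninv; exact: TGs.
  rewrite -(ex_cond _ _ _ (lninv _ _ TGi)); apply: eq_ex => x.
  by rewrite /xlnx mulrC.
pose c x := Tf x * G x / TG x.
have c0 x : 0 < c x by rewrite divr_gt0// mulr_gt0.
have ec : ex b c 0 h = ex b f 0 h.
  transitivity (ex b (fun x => Tf x / TG x * G x) 0 h).
    by apply: eq_ex => x; rewrite /c; ring.
  rewrite -(@ex_cond i _ _ G); last by move=> x; rewrite Tfi TGi.
  transitivity (ex b (fun x => 1 * Tf x) 0 h).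
    apply: eq_ex => x; rewrite -/TG; field; exact: lt0r_neq0.
  by rewrite ex_cond//; apply: eq_ex => x; rewrite mul1r.
have : ex b (fun x => f x * ln (c x) + f x - c x) 0 h <= ex b (fun x => xlnx (f x)) 0 h.
  by apply: le_ex => x; exact: xlnx_ge.
rewrite (@eq_ex _ _ _ b _ (fun x => (ln (Tf x) * f x + ln (G x) * f x) +
  ((- 1) * (ln (TG x) * f x) + (f x + (- 1) * c x)))).
  by rewrite exD exD exD exD !exZ -eT -eG -eTG ec; lra.
move=> x; have -> : ln (c x) = ln (Tf x) + ln (G x) - ln (TG x).
  have TGp : TG x \is Num.pos by rewrite posrE.
  have pp : Tf x * G x \is Num.pos by rewrite posrE mulr_gt0.
  by rewrite /c (ln_div pp TGp) lnM// posrE.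
by ring.
Qed.

(** The entropy telescopes when the coordinates are averaged out in turn. *)
Lemma entropy_tensorize0 f : (forall x, 0 < f x) ->
  entropy_part b f 0 h <= \sum_i local_part b f i 0 h.
Proof.
move=> f0; rewrite entropy_partE; under eq_bigr do rewrite local_partE.
rewrite -mulr_sumr ler_wpM2l ?(ltW (part_gt0 _ _ _))//.
have chain s : ex b (fun x => xlnx (f x)) 0 h - ex b (fun x => xlnx (average s f x)) 0 h <=
    \sum_(i <- s) (ex b (fun x => xlnx (f x)) 0 h -
      ex b (fun x => xlnx (cond_ex i 0 h f x)) 0 h).
  elim: s => [|i s ih]; first by rewrite big_nil subrr.
  rewrite big_cons /=; have := average_entropy_step i s f0; move: ih; lra.
have := chain (enum 'I_n); rewrite big_enum/=.
rewrite (@eq_ex _ _ _ b (fun x => xlnx (average _ f x)) (fun=> xlnx (ex b f 0 h))).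
  by rewrite ex_cst.
by move=> x; rewrite average_full.
Qed.

End independent_coordinates.

End conditional_expectation.

(** * Decay of entropy *)
Section entropy_flow.
Variables (R : realType) (n m : nat) (b : 'I_m -> 'rV[R]_n).
Local Notation config := {ffun 'I_n -> bool}.
Implicit Types (u v h : 'rV[R]_n) (x y : config) (z : R) (c d f g : config -> R).
Implicit Types (i j : 'I_n).

Variables (Q L : R -> R).
Hypothesis b_le1 : forall u, \sum_k dot (b k) u ^+ 2 <= dot u u.
Hypothesis Q_ge0 : forall z, 0 <= z -> 0 <= Q z.
Hypothesis cova_Q : forall z h u, 0 <= z -> cova b z h u u <= Q z * dot u u.
Hypothesis L_ge0 : forall z, 0 <= z -> 0 <= L z.
Hypothesis L0 : L 0 = 0.
Hypothesis LP : forall z, 0 <= z -> is_derive z 1 L (Q z).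

Lemma continuous_xlnx_wsum c d : (forall z h, 0 < wsum b c z h) ->
  (forall z h, 0 < wsum b d z h) ->
  continuous (fun p : R * 'rV[R]_n =>
    wsum b d p.1 p.2 * xlnx (wsum b c p.1 p.2 / wsum b d p.1 p.2)).
Proof.
move=> c0 d0; apply: continuousMM; first exact: continuous_wsum.
move=> p; apply: (@continuous_comp _ _ _
  (fun p : R * 'rV[R]_n => wsum b c p.1 p.2 / wsum b d p.1 p.2) (@xlnx R)).
  apply: cvgM; first exact: continuous_wsum.
  by apply: cvgV; [exact: lt0r_neq0|exact: continuous_wsum].
by apply: der_continuous (der_xlnx _); rewrite divr_gt0.
Qed.

(** Divided by [expR (L z)] the entropy becomes a subsolution, by entropic
    stability, while the local entropies are supersolutions.  At time 0 the
    measure is a product. *)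
Lemma entropy_flow f z h : (forall x, 0 < f x) -> 0 <= z ->
  entropy_part b f z h <= expR (L z) * \sum_i local_part b f i z h.
Proof.
move=> f0; move: z h => z0 h0 z00.
pose N z h := expR (- L z) * entropy_part b f z h - \sum_i local_part b f i z h.
suff : N z0 h0 <= 0.
  rewrite subr_le0 expRN => hN; rewrite -ler_pdivrMl ?expR_gt0//.
pose M := \sum_x `|xlnx (f x)|.
have M0 : 0 <= M by apply: sumr_ge0.
apply: (@gibbs_max_principle _ _ _ b N z0 (M + 1)); last by rewrite z00 lexx.
- move=> z h /andP[z1 _].
  have ce : continuous (fun p : R * 'rV[R]_n => entropy_part b f p.1 p.2).
    apply: continuousBB; first exact: continuous_wsum.
    by apply: continuous_xlnx_wsum => z' h'; [exact: wsum_pos_gt0|exact: part_gt0].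
  have cl i : continuous (fun p : R * 'rV[R]_n => local_part b f i p.1 p.2).
    apply: continuous_bigsum => x; apply: continuousMM; first exact: continuous_const.
    apply: continuousBB; first exact: continuous_wsum.
    apply: continuous_xlnx_wsum => z' h'; first exact: wsum_agree_gt0.
    by apply: wsum_agree_gt0 => _; exact: ltr01.
  apply: cvgB; last exact: continuous_bigsum.
  apply: cvgM; last exact: ce.
  have dL := der_exp (derN (LP z1)).
  apply: (@continuous_comp _ _ _ (fun p : R * 'rV[R]_n => p.1)
    (fun z => expR (- L z))); first exact: cvg_fst.
  exact: der_continuous dL.
- move=> z h /andP[z1 _]; have z10 := ltW z1.
  have /choice[D DP] : forall i, exists d : R,
      heat_defect b (local_part b f i) z h d /\ 0 <= d.
    by move=> i; have [d d1 d2] := heat_local_part b f0 i z h; exists d.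
  have hs := heat_sum (fun i => (DP i).1).
  have := heatB (heat_time (der_exp (derN (LP z10))) (heat_entropy_part b f0 z h)) hs.
  move=> hN; eexists; first exact: hN.
  rewrite subr_le0; apply: (@le_trans _ _ 0); last first.
    by apply: sumr_ge0 => i _; have [] := DP i.
  have := @entropic_stability R n m b f f0 z h (Q z) (Q_ge0 z10) b_le1
    (fun h u => cova_Q h u z10).
  rewrite [X in X <= _]mulrC -subr_le0 => st.
  rewrite -mulrA -mulrDr mulNr pmulr_rle0 ?expR_gt0//.
- move=> h; rewrite /N L0 oppr0 expR0 mul1r subr_le0.
  exact: entropy_tensorize0.
- move=> z h /andP[z1 _].
  have p0 := ltW (part_gt0 b z h).
  have Mp : 0 <= (M + 1) * part b z h by rewrite mulr_ge0// addr_ge0.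
  apply: (@le_trans _ _ (expR (- L z) * ((M + 1) * part b z h))).
    have l0 : 0 <= \sum_i local_part b f i z h.
      by apply: sumr_ge0 => i _; exact: local_part_ge0.
    apply: (@le_trans _ _ (expR (- L z) * entropy_part b f z h)); first by rewrite /N; lra.
    rewrite ler_wpM2l ?expR_ge0// entropy_partE mulrC ler_wpM2r//.
    have eM : ex b (fun x => xlnx (f x)) z h <= M.
      rewrite -[leRHS](ex_cst b _ z h); apply: le_ex => x.
      by rewrite (le_trans (ler_norm _))// /M (bigD1 x)//= lerDl sumr_ge0.
    have a0 : 0 < ex b f z h by rewrite divr_gt0 ?part_gt0// wsum_pos_gt0.
    by have := xlnx_ge a0 ltr01; rewrite ln1 mulr0 add0r; lra.
  by rewrite ler_piMl// -expR0 ler_expR oppr_le0 L_ge0.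
Qed.

End entropy_flow.

Section continuity_of_entropy.
Variable R : realType.

Lemma xlnx_bound (t : R) : t <= 1 -> `|xlnx t| <= 2 * Num.sqrt t.
Proof.
move=> t1; have [t0|t0] := leP t 0.
  by rewrite /xlnx ln0// mulr0 normr0 mulr_ge0// sqrtr_ge0.
set r := Num.sqrt t; have r0 : 0 < r by rewrite sqrtr_gt0.
have tE : t = r * r by rewrite -expr2 sqr_sqrtr// ltW.
have lr : ln r <= 0 by rewrite ln_le0// /r -(sqrtr1 R) ler_sqrt.
have := expR_ge1Dx (- ln r); rewrite expRN lnK ?posrE// => h.
have rr : r * (1 - ln r) <= 1.
  by apply: le_trans (ler_wpM2l (ltW r0) h) _; rewrite divff// lt0r_neq0.
rewrite /xlnx tE lnM ?posrE// ler0_norm; last by nra.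
nra.
Qed.

(** Since [ln] vanishes on the negative axis, continuity holds on both sides of
    the origin. *)
Lemma continuous_xlnx : continuous (@xlnx R).
Proof.
move=> t; have [t0|t0|->] := ltgtP t 0; last 1 first.
- have x0 : xlnx (0 : R) = 0 by rewrite /xlnx mul0r.
  rewrite /continuous_at x0; apply: norm_cvg0.
  have cs : (fun s : R => 2 * Num.sqrt s) @ (0 : R) --> (0 : R).
    have := cvgM (cvg_cst (2 : R)) (@sqrt_continuous R 0).
    by rewrite sqrtr0 mulr0; apply.
  have h := @squeeze_cvgr R (nbhs (0 : R)) _ R (fun=> 0) (fun s : R => 2 * Num.sqrt s)
    (fun s : R => `|xlnx s|).
  apply: h; [|exact: cvg_cst|exact: cs].
  apply: filterS (lt_nbhsl (@ltr01 R)) => s s1.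
  by rewrite normr_ge0/= xlnx_bound// ltW.
- rewrite /continuous_at {2}/xlnx ln0 ?(ltW t0)// mulr0.
  apply: cvg_trans (@cvg_cst _ (0 : R) _ (nbhs t) _).
  apply: near_eq_cvg; apply: filterS (lt_nbhsl t0) => s s0.
  by rewrite /xlnx ln0 ?mulr0// ltW.
- exact: der_continuous (der_xlnx t0).
Qed.

Lemma EntE (T : finType) (mu f : T -> R) :
  Ent mu f = mean mu (fun x => xlnx (f x)) - xlnx (mean mu f).
Proof. by []. Qed.

Lemma continuous_Ent (T : finType) (mu f : T -> R) :
  continuous (fun e : R => Ent mu (fun x => f x + e)).
Proof.
have cf x : continuous (fun e : R => f x + e).
  by apply: continuousDD => e; [exact: cvg_cst|exact: cvg_id].
have cx (g : R -> R) : continuous g -> continuous (fun e => xlnx (g e)).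
  move=> cg e; apply: (@continuous_comp _ _ _ g (@xlnx R)); first exact: cg.
  exact: continuous_xlnx.
apply: continuousBB.
  apply: continuous_bigsum => x; apply: continuousMM; first by move=> e; exact: cvg_cst.
  exact: cx.
apply: cx; apply: continuous_bigsum => x.
by apply: continuousMM => //; move=> e; exact: cvg_cst.
Qed.

(** Both sides are continuous when a constant is added to [f]. *)
Lemma tensorization_positive (n : nat) (S : finType) (mu : {ffun 'I_n -> S} -> R) (C : R) :
  (forall f, (forall x, 0 < f x) ->
    Ent mu f <= C * \sum_(i < n) mean mu (fun x => Ent (cond_law mu i x) f)) ->
  forall f, (forall x, 0 <= f x) ->
    Ent mu f <= C * \sum_(i < n) mean mu (fun x => Ent (cond_law mu i x) f).
Proof.
move=> H f f0.
pose D (e : R) := C * (\sum_(i < n) mean mu (fun x => Ent (cond_law mu i x) (fun y => f y + e))) -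
  Ent mu (fun x => f x + e).
have cD : continuous D.
  apply: continuousBB; last exact: continuous_Ent.
  apply: continuousMM; first by move=> e; exact: cvg_cst.
  apply: continuous_bigsum => i; apply: continuous_bigsum => x.
  apply: continuousMM; first by move=> e; exact: cvg_cst.
  exact: continuous_Ent.
have D0 : D 0 = C * (\sum_(i < n) mean mu (fun x => Ent (cond_law mu i x) f)) - Ent mu f.
  rewrite /D; have -> : (fun x => f x + 0) = f by apply/funext => x; rewrite addr0.
  by [].
rewrite -subr_ge0 -D0.
have cv : D e @[e --> 0^'+] --> D 0 by apply: cvg_at_right_filter; exact: cD.
rewrite -(cvg_lim (@Rhausdorff R) cv); apply: limr_ge; first by apply/cvg_ex; exists (D 0).
near=> e; have e0 : 0 < e by near: e; exact: nbhs_right_gt.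
by rewrite subr_ge0; apply: H => x; rewrite ltr_wpDl.
Unshelve. all: by end_near. Qed.

End continuity_of_entropy.

(** * Truncating the Volterra solution *)
Section volterra.
Variable R : realType.
Local Notation leb := (@lebesgue_measure R).
Implicit Types (z t : R) (q : R -> \bar R).

Lemma continuous_integrable (g : R -> R) a c : continuous g ->
  leb.-integrable `[a, c] (EFin \o g).
Proof.
move=> cg; apply: continuous_compact_integrable; first exact: segment_compact.
exact: continuous_subspaceT.
Qed.

(** Starting the integral at [-1] makes the derivative at [0] two-sided. *)
Lemma antiderivative (g : R -> R) : continuous g -> exists P : R -> R,
  (forall z, 0 <= z -> is_derive z 1 P (g z)) /\
  (forall z, 0 <= z -> P z = \int[leb]_(y in `[0, z]) g y).
Proof.
move=> cg.
exists (fun z => \int[leb]_(y in `[-1, z]) g y - \int[leb]_(y in `[-1, 0]) g y).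
have m10 : -1 < 0 :> R by rewrite ltrN10.
split=> z z0.
  have m1z : -1 < z by exact: lt_le_trans z0.
  have zz : z < z + 1 by rewrite ltrDl.
  have [d1 d2] := @continuous_FTC1_closed R g (-1) z (z + 1) zz
    (continuous_integrable _ _ cg) m1z (cg z).
  have dF : is_derive z 1 (fun z => \int[leb]_(y in `[-1, z]) g y) (g z).
    by split; [exact: d1|rewrite -derive1E; exact: d2].
  by apply: der_eq (derB dF (der_cst _ z)) _; rewrite subr0.
rewrite (@Rintegral_itvB R g (BLeft (-1)) (BRight z) 0)//; last first.
- by rewrite bnd_simp ltW.
- exact: continuous_integrable.
rewrite Rintegral_itv_obnd_cbnd//.
apply: integrableS (continuous_integrable 0 z cg) => //.
exact: subset_itv_oc_cc.
Qed.

Lemma rfun_continuous (eta : R) : 0 <= eta ->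
  continuous (fun z => rfun (eta * Num.max z 0)).
Proof.
move=> e0; rewrite (_ : (fun z => _) = (fun z =>
    expR (- (eta * Num.max z 0 / 2)) * psi (eta * Num.max z 0) 0)); last first.
  by apply/funext => z; rewrite rfun_psi// mulr_ge0// le_max lexx orbT.
have cm : continuous (fun z : R => eta * Num.max z 0).
  apply: continuousMM; first by move=> z; exact: cvg_cst.
  by move=> z; apply: continuous_max; [exact: cvg_id|exact: cvg_cst].
apply: continuousMM.
  apply: continuous_expR_comp => z; apply: cvgN; apply: cvgM; last exact: cvg_cst.
  exact: cm.
move=> z; apply: (@continuous_comp _ _ _ (fun z : R => (eta * Num.max z 0, 0 : R))
  (fun s : R * R => psi s.1 s.2)); last exact: psi_continuous.
exact: (cvg_pair (cm z) (cvg_cst (0 : R))).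
Qed.

(** The minimum of [q] and a constant is a continuous function on the whole
    half-line, even across the blow-up time, and truncation keeps the inequality
    needed for comparison.  Before the blow-up [q] is continuous because [q ^+ 2]
    is integrable; near it, the constant is below [q]. *)
Lemma volterra_truncate (eta N : R) q : 0 <= eta -> 0 <= N ->
  volterra_solution eta q ->
  exists Q : R -> R,
  [/\ continuous Q, forall z, 0 <= Q z,
      forall z, 0 <= z -> ((Q z)%:E <= q z)%E
    & forall z, 0 <= z -> Num.min N (rfun (eta * z) +
        \int[leb]_(y in `[0, z]) (Q y ^+ 2)) <= Q z].
Proof.
move=> eta0 N0 [mq [T [T0 qfin qeq qblow qinf]]].
pose qr z := fine (q z).
(* Extending by the value at 0 makes the truncation continuous on the line. *)
pose pos z := Num.max z 0.
have pos0 z : 0 <= pos z by rewrite le_max lexx orbT.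
have posE z : 0 <= z -> pos z = z by move=> z0; rewrite /pos max_l.
have posT z : (z%:E < T)%E -> ((pos z)%:E < T)%E.
  by move=> zT; rewrite /pos; case: (leP 0 z).
pose Q z := if `[< (T <= (pos z)%:E)%E >] then N else Num.min N (qr (pos z)).
have qrE z : 0 <= z -> (z%:E < T)%E -> q z = (qr z)%:E /\ 0 <= qr z.
  move=> z0 zT; have /andP[h1 h2] := qfin z z0 zT.
  by rewrite /qr fineK ?fine_ge0// ge0_fin_numE.
have QT z : (T <= (pos z)%:E)%E -> Q z = N by move=> h; rewrite /Q asboolT.
have Qlt z : ((pos z)%:E < T)%E -> Q z = Num.min N (qr (pos z)).
  by move=> h; rewrite /Q asboolF// => /(lt_le_trans h); rewrite ltxx.
have Tcase z : (T <= (pos z)%:E)%E \/ ((pos z)%:E < T)%E.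
  by case: (leP T (pos z)%:E) => ?; [left|right].
have Q0 z : 0 <= Q z.
  have [/QT ->//|zT] := Tcase z; rewrite Qlt// le_min N0/=.
  by have [] := qrE _ (pos0 z) zT.
have QN z : Q z <= N.
  by have [/QT ->//|zT] := Tcase z; rewrite Qlt// ge_min lexx.
have Qq z : 0 <= z -> ((Q z)%:E <= q z)%E.
  move=> z0; have [zT|zT] := Tcase z; first by rewrite qinf ?leey// -(posE z z0).
  rewrite Qlt// posE//; rewrite posE// in zT.
  by have [-> _] := qrE z z0 zT; rewrite lee_fin ge_min lexx orbT.
have mq0 (a c : R) : 0 <= a -> measurable_fun `[a, c] q.
  move=> a0; apply: measurable_funS mq => // y /=; rewrite !in_itv/= => /andP[ay _].
  by rewrite andbT (le_trans a0).
have mqr2 (a c : R) : 0 <= a -> measurable_fun `[a, c] (fun y => qr y ^+ 2).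
  move=> a0; apply: measurable_funX; apply: measurableT_comp => //; exact: mq0.
have sq y : 0 <= y -> (y%:E < T)%E -> (q y ^+ 2 = (qr y ^+ 2)%:E)%E.
  by move=> y0 yT; have [-> _] := qrE y y0 yT; rewrite EFin_expe.
have intsq z : 0 <= z -> (z%:E < T)%E ->
    leb.-integrable `[0, z] (EFin \o (fun y => qr y ^+ 2)) /\
    qr z = rfun (eta * z) + \int[leb]_(y in `[0, z]) (qr y ^+ 2).
  move=> z0 zT.
  have ieq : (\int[leb]_(y in `[0%R, z]) (q y ^+ 2) =
      \int[leb]_(y in `[0%R, z]) (qr y ^+ 2)%:E)%E.
    apply: eq_integral => y yin.
    have [y0 yz] : 0 <= y /\ y <= z by move: yin; rewrite inE/= in_itv/= => /andP[].
    by rewrite sq// (le_lt_trans _ zT)// lee_fin.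
  have I0 : (0 <= \int[leb]_(y in `[0%R, z]) (qr y ^+ 2)%:E)%E.
    by apply: integral_ge0 => y _; rewrite lee_fin sqr_ge0.
  have := qeq z z0 zT; have [-> _] := qrE z z0 zT; rewrite ieq => e.
  have Ify : (\int[leb]_(y in `[0%R, z]) (qr y ^+ 2)%:E < +oo)%E.
    rewrite ltNge leye_eq; apply/negP => /eqP h; move: e.
    by rewrite h.
  have Ifin : (\int[leb]_(y in `[0%R, z]) (qr y ^+ 2)%:E)%E \is a fin_num.
    by rewrite ge0_fin_numE.
  split.
    apply/integrableP; split; first by apply/measurable_EFinP; exact: mqr2.
    under eq_integral do rewrite /= ger0_norm ?sqr_ge0//.
    exact: Ify.
  by apply: EFin_inj; rewrite e EFinD; congr (_ + _)%E; rewrite /Rintegral fineK.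
pose c z := \int[leb]_(y in `[0, z]) (qr y ^+ 2).
have cc z : (z%:E < T)%E -> {for z, continuous c}.
  move=> zT.
  have [u zu uT] : exists2 u, pos z < u & (u%:E < T)%E.
    have pT := posT z zT.
    case: (T) pT => [t| |]//; last by move=> _; exists (pos z + 1); rewrite ?ltrDl ?ltry.
    rewrite lte_fin => pt; exists ((pos z + t) / 2); rewrite ?lte_fin; lra.
  have zu' : z < u by apply: le_lt_trans zu; rewrite le_max lexx.
  have u0 : 0 <= u by apply: le_trans (ltW zu).
  (* On an interval reaching below 0, the integrand set to 0 on the
     negative axis has the same primitive, and [z] becomes an interior point. *)
  pose f := (fun y => qr y ^+ 2) \_ (`[0, +oo[%classic : set R).
  pose a := Num.min z 0 - 1.
  have az : a < z by rewrite /a ltrBlDr (le_lt_trans (y := z)) ?ltrDl// ge_min lexx.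
  have a0 : a < 0 by rewrite /a ltrBlDr (le_lt_trans (y := 0)) ?ltrDl// ge_min lexx orbT.
  have inter (y : R) : `[a, y]%classic `&` `[0, +oo[%classic = `[0, y]%classic :> set R.
    apply/seteqP; split => x /=; rewrite !in_itv/= andbT.
      by move=> [/andP[_ ->] ->].
    by move=> /andP[x0 ->]; rewrite x0 (le_trans (ltW a0)).
  have cE y : c y = \int[leb]_(x in `[a, y]) f x by rewrite -Rintegral_mkcondr inter.
  have intf : leb.-integrable `[a, u] (EFin \o f).
    rewrite -restrict_EFin; apply/integrable_restrict => //.
    by rewrite inter; exact: (intsq u u0 uT).1.
  have := parameterized_integral_continuous (ltW (lt_trans az zu')) intf.
  rewrite (_ : (fun x => _) = c); last by apply/funext => y; rewrite cE.
  move=> /continuous_within_itvP => /(_ (lt_trans az zu'))[+ _ _]; apply.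
  by rewrite in_itv/= az zu'.
have QG z : (z%:E < T)%E -> Q z = Num.min N (rfun (eta * Num.max z 0) + c z).
  move=> zT; have pT := posT z zT.
  rewrite Qlt// (intsq _ (pos0 z) pT).2; congr (Num.min _ (_ + _)).
  rewrite /c /pos; case: (leP 0 z) => z0; first by [].
  rewrite set_itv1 Rintegral_set1.
  by rewrite set_itv_ge ?Rintegral_set0// bnd_simp -ltNge.
have cQ : continuous Q.
  move=> z; have [Tz|zT] := leP T z%:E; last first.
    have cG : {for z, continuous (fun z => Num.min N (rfun (eta * Num.max z 0) + c z))}.
      apply: continuous_min; first exact: cvg_cst.
      by apply: cvgD; [exact: rfun_continuous|exact: cc].
    rewrite /continuous_at QG//; apply: cvg_trans cG; apply: near_eq_cvg.
    have [u zu uT] : exists2 u, z < u & (u%:E < T)%E.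
      case: (T) zT => [t| |]//; last by move=> _; exists (z + 1); rewrite ?ltrDl ?ltry.
      rewrite lte_fin => zt; exists ((z + t) / 2); rewrite ?lte_fin; lra.
    apply: filterS (lt_nbhsl zu) => y yu; rewrite QG//.
    by apply: lt_trans uT; rewrite lte_fin.
  have z0 : 0 <= z by move: (lt_le_trans T0 Tz); rewrite lte_fin => /ltW.
  rewrite /continuous_at QT ?posE//.
  suff near1 : \forall y \near z, Q y = N.
    apply: cvg_trans (@cvg_cst _ N _ (nbhs z) _); apply: near_eq_cvg.
    by apply: filterS near1 => y ->.
  have [t Te] : exists t, T = t%:E.
    by case: (T) T0 Tz => [t _ _||]//; exists t.
  subst T.
  rewrite lte_fin in T0.
  have [d d0 dN] : exists2 d, 0 < d & forall y, t - d < y -> y < t -> (N%:E < q y)%E.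
    have := qblow t erefl => /cvgeyPgt /(_ N) [d /= d0 hd].
    exists d => // y y1 y2; apply: hd => //=.
    by rewrite gtr0_norm ?subr_gt0// ltrBlDr addrC -ltrBlDr.
  have Qd y : t - d < y -> Q y = N.
    move=> yd; have [yT|yT] := leP t y.
      by rewrite QT// lee_fin (le_trans yT)// le_max lexx.
    rewrite QG ?lte_fin//.
    have [y0|y0] := leP 0 y.
      have := dN y yd yT; have [-> _] := qrE y y0 yT; rewrite lte_fin => Ny.
      by rewrite min_l// -(intsq y y0 yT).2 ltW.
    have := dN 0 (lt_trans yd y0) T0; have [-> _] := qrE 0 (lexx _) T0.
    rewrite (intsq 0 (lexx 0) T0).2 lte_fin => N0'.
    rewrite min_l// (le_trans (ltW N0'))// lerD2l /c.
    rewrite set_itv1 Rintegral_set1 set_itv_ge ?Rintegral_set0// bnd_simp -ltNge.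
    exact: y0.
  have tz : t - d < z by rewrite lee_fin in Tz; lra.
  by apply: filterS (lt_nbhsr tz) => y; exact: Qd.
exists Q; split => // z z0.
have [Tz|zT] := leP T z%:E; first by rewrite QT ?posE// ge_min lexx.
rewrite [leRHS]QG// max_l// le_min ge_min lexx/= ge_min lerD2l; apply/orP; right.
have cQ2 : continuous (fun y => Q y ^+ 2).
  rewrite (_ : (fun y => _) = (fun y => Q y * Q y)); first exact: continuousMM.
  by apply/funext => y; rewrite expr2.
apply: le_Rintegral => //.
- exact: continuous_integrable.
- exact: (intsq z z0 zT).1.
move=> y; rewrite /= in_itv/= => /andP[y0 yz].
have yT : (y%:E < T)%E by rewrite (le_lt_trans _ zT)// lee_fin.
have [qy qy0] := qrE y y0 yT.
by rewrite ler_pXn2r ?nnegrE//; have := Qq y y0; rewrite qy lee_fin.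
Qed.

End volterra.

(** * Operator norms and factorizations *)
Section linear_algebra.
Variables (R : realType) (n : nat).
Implicit Types (u v w : 'cV[R]_n) (A : 'M[R]_n).

Lemma dotvE u v : dotv u v = (u^T *m v) 0 0.
Proof. by rewrite mxE; apply: eq_bigr => i _; rewrite mxE. Qed.

Lemma dotvC u v : dotv u v = dotv v u.
Proof. by apply: eq_bigr => i _; rewrite mulrC. Qed.

Lemma dotvDl u v w : dotv (u + v) w = dotv u w + dotv v w.
Proof. by rewrite -big_split; apply: eq_bigr => i _; rewrite mxE mulrDl. Qed.

Lemma dotvZl (r : R) u w : dotv (r *: u) w = r * dotv u w.
Proof. by rewrite mulr_sumr; apply: eq_bigr => i _; rewrite mxE mulrA. Qed.

Lemma dotvv_ge0 u : 0 <= dotv u u.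
Proof. by apply: sumr_ge0 => i _; rewrite -expr2 sqr_ge0. Qed.

Lemma dotv_sym A u v : A^T = A -> dotv u (A *m v) = dotv v (A *m u).
Proof.
by move=> As; rewrite [LHS]dotvC !dotvE trmx_mul As mulmxA.
Qed.

(** The Cauchy--Schwarz inequality for a semidefinite form. *)
Lemma psd_cauchy_schwarz A u v : symmetric_psd A ->
  dotv u (A *m v) ^+ 2 <= dotv u (A *m u) * dotv v (A *m v).
Proof.
move=> [As Ap]; apply: discriminant_le (Ap u) _ => t.
have := Ap (t *: u + v).
rewrite mulmxDr -scalemxAr dotvDl dotvZl !(dotvC _ (_ + _)) !dotvDl !dotvZl.
rewrite !(dotvC (A *m _)) (dotv_sym v u As).
by rewrite (_ : t * _ + _ = dotv u (A *m u) * t ^+ 2 + 2 * dotv u (A *m v) * t +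
  dotv v (A *m v)); last ring.
Qed.

Lemma dotv_cauchy_schwarz u v : dotv u v ^+ 2 <= dotv u u * dotv v v.
Proof.
have psd1 : symmetric_psd (1%:M : 'M[R]_n).
  by split=> [|w]; rewrite ?trmx1// mul1mx dotvv_ge0.
by have := psd_cauchy_schwarz u v psd1; rewrite !mul1mx.
Qed.

Lemma dotv_delta i v : dotv (delta_mx i 0) v = v i 0.
Proof.
rewrite /dotv (bigD1 i)//= mxE !eqxx mul1r big1 ?addr0// => j ji.
by rewrite mxE (negbTE ji) mul0r.
Qed.

Lemma mul_delta A i j : (A *m (delta_mx j 0 : 'cV[R]_n)) i 0 = A i j.
Proof. by rewrite -colE mxE. Qed.

(** Subtracting the square of a normalized row kills this row, keeps those
    already killed, and preserves semidefiniteness by Cauchy--Schwarz. *)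
Lemma psd_peel A (s : seq 'I_n) : symmetric_psd A ->
  exists (b : seq 'rV[R]_n) (A' : 'M[R]_n),
  [/\ size b = size s, symmetric_psd A',
      forall i, i \in s -> forall j, A' i j = 0
    & forall i j, A i j = A' i j + \sum_(u <- b) u 0 i * u 0 j].
Proof.
move=> pA; elim: s => [|i s [b [B [sb pB B0 BE]]]].
  by exists [::], A; split => // i j; rewrite big_nil addr0.
have [Bs Bp] := pB.
have Bsym k l : B k l = B l k by rewrite -[in LHS]Bs mxE.
have BiE v : dotv (delta_mx i 0) (B *m v) = (B *m v) i 0 by rewrite dotv_delta.
have Bii : dotv (delta_mx i 0) (B *m delta_mx i 0) = B i i by rewrite BiE mul_delta.
have Bii0 : 0 <= B i i by rewrite -Bii.
have cs v : (B *m v) i 0 ^+ 2 <= B i i * dotv v (B *m v).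
  by have := psd_cauchy_schwarz (delta_mx i 0) v pB; rewrite Bii BiE.
have [Bi0|Bi0] := eqVneq (B i i) 0.
  exists (0 :: b), B; split => //=; first by rewrite sb.
    move=> k; rewrite inE => /predU1P[-> j|/B0//].
    have := cs (delta_mx j 0); rewrite Bi0 mul0r mul_delta => h.
    by apply/eqP; rewrite -sqrf_eq0 eq_le h sqr_ge0.
  by move=> k l; rewrite big_cons !mxE mul0r add0r BE.
have r0 : 0 < B i i by rewrite lt_neqAle eq_sym Bi0.
pose c := \row_j (B i j / Num.sqrt (B i i)).
have cE k l : c 0 k * c 0 l = B i k * B i l / B i i.
  rewrite !mxE mulrACA -invfM -expr2 sqr_sqrtr//.
exists (c :: b), (\matrix_(k, l) (B k l - c 0 k * c 0 l)); split => /=.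
- by rewrite sb.
- split; first by apply/matrixP => k l; rewrite !mxE Bsym (mulrC (B i l / _)).
  move=> v.
  have -> : dotv v (\matrix_(k, l) (B k l - c 0 k * c 0 l) *m v) =
      dotv v (B *m v) - (B *m v) i 0 ^+ 2 / B i i.
    have -> : (B *m v) i 0 ^+ 2 / B i i =
        \sum_k v k 0 * \sum_l (c 0 k * c 0 l) * v l 0.
      have -> : (B *m v) i 0 = \sum_k B i k * v k 0 by rewrite mxE.
      rewrite expr2 mulr_suml mulr_suml; apply: eq_bigr => k _.
      rewrite mulr_sumr mulr_sumr mulr_suml; apply: eq_bigr => l _.
      by rewrite cE; ring.
    rewrite /dotv -sumrB; apply: eq_bigr => k _; rewrite -mulrBr; congr (_ * _).
    by rewrite !mxE -sumrB; apply: eq_bigr => l _; rewrite !mxE mulrBl.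
  by rewrite subr_ge0 ler_pdivrMr// mulrC.
- move=> k ks j; rewrite mxE cE.
  move: ks; rewrite inE => /predU1P[->|ks].
    by rewrite mulrAC divff// mul1r subrr.
  by rewrite (B0 k ks) (Bsym i k) (B0 k ks) !mul0r subrr.
- by move=> k l; rewrite big_cons BE mxE; ring.
Qed.

Lemma psd_factor A : symmetric_psd A ->
  exists b : 'I_n -> 'rV[R]_n, forall i j, A i j = \sum_k b k 0 i * b k 0 j.
Proof.
move=> pA; have [b [B [sb _ B0 BE]]] := psd_peel (enum 'I_n) pA.
exists (fun k => nth 0 b k) => i j.
rewrite BE B0 ?mem_enum// add0r (big_nth 0) sb size_enum_ord.
by rewrite big_mkord.
Qed.

Lemma l2norm_sqr u : l2norm u ^+ 2 = dotv u u.
Proof. by rewrite sqr_sqrtr// dotvv_ge0. Qed.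

Lemma l2norm_ge0 u : 0 <= l2norm u.
Proof. exact: sqrtr_ge0. Qed.

Lemma l2normZ (r : R) u : l2norm (r *: u) = `|r| * l2norm u.
Proof.
rewrite /l2norm dotvZl dotvC dotvZl mulrA -expr2 sqrtrM ?sqr_ge0//.
by rewrite sqrtr_sqr.
Qed.

Lemma dotv_le_l2norm u v : dotv u v <= l2norm u * l2norm v.
Proof.
rewrite (le_trans (ler_norm _))// -(@ler_pXn2r _ 2) ?nnegrE ?mulr_ge0 ?l2norm_ge0//.
by rewrite real_normK ?num_real// exprMn !l2norm_sqr dotv_cauchy_schwarz.
Qed.

Lemma l2norm_mulmx_bound A : exists2 c, 0 <= c & forall u, l2norm (A *m u) <= c * l2norm u.
Proof.
pose S := \sum_i dotv (row i A)^T (row i A)^T.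
have S0 : 0 <= S by apply: sumr_ge0 => i _; exact: dotvv_ge0.
exists (Num.sqrt S); first exact: sqrtr_ge0.
move=> u; rewrite -sqrtrM// ler_sqrt; last by rewrite mulr_ge0 ?dotvv_ge0.
rewrite mulr_suml; apply: ler_sum => i _.
have -> : (A *m u) i 0 = dotv (row i A)^T u.
  by rewrite mxE; apply: eq_bigr => j _; rewrite !mxE.
by rewrite -expr2 dotv_cauchy_schwarz.
Qed.

Let opset A : set R := [set l2norm (A *m u) | u in [set u | l2norm u <= 1]].

Lemma l2norm0 : l2norm (0 : 'cV[R]_n) = 0.
Proof. by rewrite -(scale0r 0) l2normZ normr0 mul0r. Qed.

Lemma opset_has_sup A : has_sup (opset A).
Proof.
split; first by exists (l2norm (A *m 0)), 0; rewrite //= l2norm0 ler01.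
have [c c0 cP] := l2norm_mulmx_bound A; exists c => _ [u u1 <-].
by apply: le_trans (cP u) _; rewrite ler_piMr.
Qed.

Lemma l2norm_mulmx_le A u : l2norm (A *m u) <= opnorm A * l2norm u.
Proof.
have [u0|u0] := eqVneq (l2norm u) 0.
  have [c _ cP] := l2norm_mulmx_bound A.
  by have := cP u; rewrite u0 !mulr0.
have up : 0 < l2norm u by rewrite lt_neqAle eq_sym u0 l2norm_ge0.
rewrite -ler_pdivrMr//.
have -> : l2norm (A *m u) / l2norm u = l2norm (A *m ((l2norm u)^-1 *: u)).
  by rewrite -scalemxAr l2normZ ger0_norm ?invr_ge0 ?l2norm_ge0// mulrC.
apply: (sup_upper_bound (opset_has_sup A)); exists ((l2norm u)^-1 *: u) => //=.
by rewrite l2normZ ger0_norm ?invr_ge0 ?l2norm_ge0// mulVf.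
Qed.

Lemma opnorm_le A c : 0 <= c -> (forall u, l2norm (A *m u) <= c * l2norm u) ->
  opnorm A <= c.
Proof.
move=> c0 cP; apply: ge_sup; first exact: (opset_has_sup A).1.
by move=> _ [u u1 <-]; apply: le_trans (cP u) _; rewrite ler_piMr.
Qed.

Lemma l2norm_eq0 u : l2norm u = 0 -> u = 0.
Proof.
move=> u0; have := l2norm_sqr u; rewrite u0 expr0n/= => /esym/eqP.
rewrite psumr_eq0 => [/allP h|i _]; last by rewrite -expr2 sqr_ge0.
apply/matrixP => i j; rewrite ord1 [RHS]mxE; apply/eqP.
by have := h i (mem_index_enum i); rewrite -expr2 sqrf_eq0.
Qed.

Lemma opnorm_gt0 A : A <> 0 -> 0 < opnorm A.
Proof.
move=> A0; rewrite ltNge; apply/negP => h; apply: A0.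
apply/matrixP => i j; rewrite mxE -mul_delta.
have : l2norm (A *m delta_mx j 0) <= 0.
  by apply: le_trans (l2norm_mulmx_le _ _) _; rewrite mulr_le0_ge0// l2norm_ge0.
move=> h'; rewrite (l2norm_eq0 (u := A *m delta_mx j 0)) ?mxE//.
by apply/eqP; rewrite eq_le h' l2norm_ge0.
Qed.

End linear_algebra.

(** * The Ising model *)
Section ising_bridge.
Variables (R : realType) (n m : nat) (b : 'I_m -> 'rV[R]_n).
Local Notation config := {ffun 'I_n -> bool}.
Implicit Types (x y : config) (z : R) (f g : config -> R) (i : 'I_n).
Variables (J : 'M[R]_n) (h : 'cV[R]_n) (lam : R).
Hypothesis JE : forall i j, J i j = lam * \sum_k b k 0 i * b k 0 j.

Lemma dotv_factor (u v : 'cV[R]_n) :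
  dotv u (J *m v) = lam * \sum_k dot (b k) u^T * dot (b k) v^T.
Proof.
have -> : \sum_k dot (b k) u^T * dot (b k) v^T =
    \sum_i \sum_j u i 0 * v j 0 * \sum_k b k 0 i * b k 0 j.
  under [RHS]eq_bigr do under eq_bigr do rewrite mulr_sumr.
  under [RHS]eq_bigr do rewrite exchange_big/=.
  rewrite [RHS]exchange_big/=; apply: eq_bigr => k _.
  rewrite /dot mulr_suml; apply: eq_bigr => i _; rewrite mulr_sumr.
  by apply: eq_bigr => j _; rewrite !mxE; ring.
rewrite mulr_sumr; apply: eq_bigr => i _; rewrite mxE !mulr_sumr.
by apply: eq_bigr => j _; rewrite JE; ring.
Qed.

Lemma dot_lin (u : 'rV[R]_n) x : dot u (spinv R x)^T = lin u x.
Proof. by apply: eq_bigr => i _; rewrite !mxE. Qed.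

(** The model sits at time [lam] of the flow. *)
Lemma ising_weightE x : ising_weight J h x = gibbs b lam h^T x.
Proof.
have e1 : 2^-1 * dotv (spinv R x) (J *m spinv R x) = lam / 2 * quad b x.
  rewrite dotv_factor mulrA (mulrC 2^-1) /quad; congr (_ * _).
  by apply: eq_bigr => k _; rewrite !dot_lin expr2.
have e2 : dotv h (spinv R x) = lin h^T x by apply: eq_bigr => i _; rewrite !mxE.
by rewrite /ising_weight e1 e2.
Qed.

Lemma isingE x : ising J h x = gibbs b lam h^T x / part b lam h^T.
Proof.
rewrite /ising ising_weightE; congr (_ / _).
by apply: eq_bigr => y _; rewrite ising_weightE mul1r.
Qed.

Lemma mean_ising g : mean (ising J h) g = ex b g lam h^T.
Proof.
rewrite /mean /ex /wsum mulr_suml; apply: eq_bigr => x _.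
by rewrite isingE; ring.
Qed.

Lemma cond_law_ising i x g : mean (cond_law (ising J h) i x) g = cond_ex b i lam h^T g x.
Proof.
have p0 := part_neq0 b lam h^T.
have s0 := lt0r_neq0 (gibbs_pair_gt0 b i lam h^T x).
rewrite /mean /cond_law sum_agree.
rewrite (eq_bigr (fun y => if agree_off i x y then
    ising J h y / (ising J h x + ising J h (flip i x)) * g y else 0)); last first.
  by move=> y _; case: ifP; rewrite ?mul0r.
rewrite -big_mkcond/= sum_agree !isingE /cond_ex.
have pp : gibbs b lam h^T x / part b lam h^T + gibbs b lam h^T (flip i x) / part b lam h^T
   != 0 by rewrite -mulrDl mulf_neq0// invr_eq0.
by field; rewrite s0 p0.
Qed.

Lemma Ent_ising f : Ent (ising J h) f = entropy_part b f lam h^T / part b lam h^T.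
Proof.
rewrite EntE !mean_ising entropy_partE.
by rewrite mulrAC divff ?mul1r// part_neq0.
Qed.

Lemma local_Ent_ising i f :
  mean (ising J h) (fun x => Ent (cond_law (ising J h) i x) f) =
  local_part b f i lam h^T / part b lam h^T.
Proof.
rewrite mean_ising local_partE mulrAC divff ?mul1r ?part_neq0//.
rewrite (@eq_ex _ _ _ b _ (fun x => cond_ex b i lam h^T (fun x => xlnx (f x)) x +
  (-1) * xlnx (cond_ex b i lam h^T f x))); last first.
  by move=> x; rewrite EntE !cond_law_ising mulN1r.
by rewrite exD exZ ex_cond1 mulN1r.
Qed.

Lemma ising_ge0 x : 0 <= ising J h x.
Proof. by rewrite isingE divr_ge0// ltW// ?gibbs_gt0// part_gt0. Qed.

Lemma cov_ising (u : 'cV[R]_n) : cov (ising J h) *m u = (cova_row b lam h^T u^T)^T.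
Proof.
have meanE p q (F : 'cV[R]_n -> 'M[R]_(p, q)) (i : 'I_p) (j : 'I_q) :
    mean_mx (ising J h) F i j = ex b (fun x => F (spinv R x) i j) lam h^T.
  by rewrite -mean_ising /mean_mx summxE; apply: eq_bigr => x _; rewrite mxE.
have covE i j : cov (ising J h) i j = cova b lam h^T (delta_mx 0 j) (delta_mx 0 i).
  rewrite /cov !mxE meanE big_ord1 !mxE !meanE covaC /cova; congr (_ - _).
    apply: eq_ex => x; rewrite !mxE big_ord1 !mxE !lin_delta//.
  by congr (_ * _); apply: eq_ex => x; rewrite mxE lin_delta.
apply/matrixP => i j; rewrite ord1 !mxE [RHS]covaC cova_dot /dot.
by apply: eq_bigr => k _; rewrite covE !mxE [LHS]mulrC covaC.
Qed.

End ising_bridge.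

(** Jensen's inequality for [xlnx]. *)
Lemma Ent_ge0 (R : realType) (T : finType) (mu f : T -> R) :
  (forall x, 0 <= mu x) -> \sum_x mu x = 1 -> (forall x, 0 <= f x) -> 0 <= Ent mu f.
Proof.
move=> mu0 mu1 f0; rewrite EntE subr_ge0.
have m0 : 0 <= mean mu f by apply: sumr_ge0 => x _; rewrite mulr_ge0.
move: m0; rewrite le_eqVlt => /predU1P[m0|m0].
  rewrite -m0 /xlnx mul0r /mean big1// => x _.
  have /eqP := esym m0; rewrite psumr_eq0 => [/allP h|y _]; last by rewrite mulr_ge0.
  by have /eqP h' := h x (mem_index_enum x); rewrite mulrA h' mul0r.
set q := mean mu f.
have -> : xlnx q = \sum_x mu x * (f x * ln q + f x - q).
  under eq_bigr do rewrite mulrBr mulrDr mulrA.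
  rewrite sumrB big_split/= -!mulr_suml mu1 -/(mean mu f) -/q /xlnx; ring.
apply: ler_sum => x _; rewrite ler_wpM2l//.
have := f0 x; rewrite le_eqVlt => /predU1P[<-|fx]; last exact: xlnx_ge.
by rewrite /xlnx !mul0r add0r sub0r oppr_le0 ltW.
Qed.

Theorem theorem3 (R : realType) (n : nat) (h : 'cV[R]_n) (J : 'M[R]_n)
    (alpha : R) (J_neq0 : J <> 0) (J_psd : symmetric_psd J)
    (alpha_ge0 : 0 <= alpha) (J_diag : forall i : 'I_n, J i i = alpha)
    (q : R -> \bar R) (q_sol : volterra_solution (alpha / opnorm J) q) :
  [/\ 0 <= alpha / opnorm J <= 1,
      forall t : R, 0 <= t -> rfun t <= 1,
      ((opnorm (cov (ising J h)))%:E <= q (opnorm J))%E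
    & approx_tensorization (ising J h)
        (expeR (\int[lebesgue_measure]_(z in `[0%R, opnorm J]) q z)%E)].
Proof.
set lam := opnorm J; set eta := alpha / lam.
have lam0 : 0 < lam by exact: opnorm_gt0.
have lam_ge0 := ltW lam0.
have [c cE] := psd_factor J_psd.
have [i0 _] : exists i0 : 'I_n, True.
  apply: contrapT => no; apply: J_neq0; apply/matrixP => i; exfalso.
  by apply: no; exists i.
(* With a zero diagonal all the factors of [J] would vanish. *)
have alpha0 : 0 < alpha.
  rewrite lt_neqAle alpha_ge0 andbT eq_sym; apply/eqP => a0; apply: J_neq0.
  have c0 k i : c k 0 i = 0.
    have := J_diag i; rewrite a0 cE => /eqP.
    rewrite psumr_eq0 => [/allP hk|l _]; last by rewrite -expr2 sqr_ge0.
    by have := hk k (mem_index_enum k); rewrite -expr2 sqrf_eq0 => /eqP.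
  by apply/matrixP => i j; rewrite cE mxE big1// => k _; rewrite c0 mul0r.
have norm_delta : l2norm (delta_mx i0 0 : 'cV[R]_n) = 1.
  by rewrite /l2norm dotv_delta mxE !eqxx sqrtr1.
have eta1 : eta <= 1.
  rewrite ler_pdivrMr// mul1r -(J_diag i0) -mul_delta -dotv_delta.
  apply: le_trans (dotv_le_l2norm _ _) _; rewrite norm_delta mul1r.
  by apply: le_trans (l2norm_mulmx_le _ _) _; rewrite norm_delta mulr1.
have eta0 : 0 < eta by rewrite divr_gt0.
(* Normalized in this way, the interaction has norm at most 1 and [lam] is a time. *)
pose b k := (Num.sqrt lam)^-1 *: c k.
have JE i j : J i j = lam * \sum_k b k 0 i * b k 0 j.
  rewrite cE mulr_sumr; apply: eq_bigr => k _; rewrite !mxE mulrACA -invfM -expr2.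
  by rewrite sqr_sqrtr// mulVKf ?lt0r_neq0.
have b_le1 u : \sum_k dot (b k) u ^+ 2 <= dot u u.
  have e : dotv u^T (J *m u^T) = lam * \sum_k dot (b k) u ^+ 2.
    by rewrite (dotv_factor JE) trmxK.
  have d : dotv u^T u^T = dot u u by apply: eq_bigr => i _; rewrite !mxE.
  rewrite -(ler_pM2l lam0) -e -d; apply: le_trans (dotv_le_l2norm _ _) _.
  rewrite -l2norm_sqr expr2 mulrCA ler_wpM2l ?l2norm_ge0//.
  exact: l2norm_mulmx_le.
have self_eta i : self_coupling b i = eta.
  apply: (mulfI (lt0r_neq0 lam0)); rewrite /eta mulrCA divff ?mulr1 ?lt0r_neq0//.
  by rewrite -(J_diag i) JE.
(* [n] bounds every covariance, so that truncating [q] at [n] loses nothing. *)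
have [Q [cQ Q0 Qq Qsup]] := volterra_truncate (ltW eta0) (ler0n R n) q_sol.
have cQ2 : continuous (fun y => Q y ^+ 2).
  rewrite (_ : (fun y => _) = (fun y => Q y * Q y)); first exact: continuousMM.
  by apply/funext => y; rewrite expr2.
have [k [kP kE]] := antiderivative cQ2.
have [L [LP LE]] := antiderivative cQ.
have k_ge0 z : 0 <= z -> 0 <= k z.
  by move=> z0; rewrite kE//; apply: Rintegral_ge0 => y _; rewrite sqr_ge0.
have L_ge0 z : 0 <= z -> 0 <= L z by move=> z0; rewrite LE//; exact: Rintegral_ge0.
have L0 : L 0 = 0 by rewrite LE// set_itv1 Rintegral_set1.
have Q_ge0 z : 0 <= z -> 0 <= Q z by [].
have Qsup' z : 0 <= z -> Num.min n%:R (rfun (eta * z) + k z) <= Q z.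
  by move=> z0; rewrite kE//; exact: Qsup.
have covQ z g v : 0 <= z -> cova b z g v v <= Q z * dot v v.
  exact: (cova_le eta0 b_le1 self_eta Q_ge0 k_ge0 kP Qsup').
split.
- by rewrite ltW.
- by move=> t _; exact: rfun_le1.
- apply: le_trans (Qq lam lam_ge0); rewrite lee_fin; apply: opnorm_le => // u.
  rewrite -(@ler_pXn2r _ 2) ?nnegrE ?mulr_ge0 ?l2norm_ge0//.
  rewrite exprMn !l2norm_sqr (cov_ising h JE).
  have := cova_row_norm u^T (Q0 lam) (fun v => covQ lam h^T v lam_ge0).
  congr (_ <= _ * _); apply: eq_bigr => i _; by rewrite !mxE.
have pos f : (forall x, 0 < f x) -> Ent (ising J h) f <=
    expR (L lam) * \sum_(i < n) mean (ising J h) (fun x => Ent (cond_law (ising J h) i x) f).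
  move=> f0; have p0 := part_gt0 b lam h^T.
  rewrite (Ent_ising h JE) ler_pdivrMr// -mulrA mulr_suml.
  under eq_bigr do rewrite (local_Ent_ising h JE) divfK ?(lt0r_neq0 p0)//.
  exact: (entropy_flow b_le1 Q_ge0 covQ L_ge0 L0 LP).
have ATE := tensorization_positive pos.
move=> f f0; set S := \sum_(i < n) _.
(* The inequality itself shows that [S] is nonnegative. *)
have S0 : 0 <= S.
  rewrite -(pmulr_rge0 _ (expR_gt0 (L lam))); apply: le_trans (ATE f f0).
  apply: Ent_ge0 => //; first exact: (ising_ge0 h JE).
  transitivity (mean (ising J h) (fun=> 1)).
    by apply: eq_bigr => x _; rewrite mulr1.
  by rewrite (mean_ising h JE) ex1.
apply: (@le_trans _ _ ((expR (L lam))%:E * S%:E)%E).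
  by rewrite -EFinM lee_fin; exact: ATE.
apply: lee_wpmul2r; first by rewrite lee_fin.
have -> : (expR (L lam))%:E = expeR (L lam)%:E by [].
rewrite lee_expeR LE// /Rintegral fineK; last first.
  by apply: integrable_fin_num => //; exact: continuous_integrable.
apply: ge0_le_integral => //.
- by move=> y _; rewrite lee_fin.
- by apply/measurable_EFinP/measurable_funTS; exact: continuous_measurable_fun.
- by apply: measurable_funS q_sol.1 => // y /=; rewrite !in_itv/= => /andP[->].
- by move=> y; rewrite /= in_itv/= => /andP[y0 _]; exact: Qq.
Qed.
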